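(* Let $W_*$ be the integral cellular chain complex of a contractible $C_2$-free $C_2$-CW-complex. Let $C^*$ be a (bounded below) cochain complex of finitely generated free abelian groups and fix a splitting $$H^*(C^* )\cong\bigoplus_{a\in A}H(a),$$ where $H(a)$ is a summand of $H^{d(a)}(C^* )$ isomorphic to $\mathbb Z/(n(a))$, and each $n(a)$ is either $0$, a (strictly positive) power of $2$, or an odd positive integer. Then $H^*\mathrm{Tot}\,\mathrm{Hom}_{C_2}(W_*,C^{*\otimes2})$ is a direct sum of the following summands (where $i$ ranges over all integers $i\ge0$). a) For each unordered pair $a\ne a'$ in $A$, one summand $\mathbb Z/(n(a),n(a'))$ in degree $d(a)+d(a')$, and if both $n(a)$ and $n(a')$ are nonzero, one summand $\mathbb Z/(n(a),n(a'))$ in degree $d(a)+d(a')-1$. b) For each $a$ with $n(a)=0$ and $d(a)$ even, one summand $\mathbb Z$ in degree $2d(a)$ and one summand $\mathbb Z/2$ in each degree $2d(a)+2+2i$. c) For each $a$ with $n(a)=0$ and $d(a)$ odd, one summand $\mathbb Z/2$ in each degree $2d(a)+1+2i$. d) For each $a$ with $n(a)$ odd and $d(a)$ even, one copy of $\mathbb Z/(n(a))$ in degree $2d(a)$. e) For each $a$ with $n(a)$ odd and $d(a)$ odd, one copy of $\mathbb Z/(n(a))$ in degree $2d(a)-1$. f) For each $a$ with $n(a)$ a (strictly positive) power of $2$ and $d(a)$ even, one copy of $\mathbb Z/(2n(a))$ in degree $2d(a)$ and one copy of $\mathbb Z/2$ in degree $2d(a)-1$, and in each degree of the form $2d(a)+1+i$.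 g) For each $a$ with $n(a)$ a (strictly positive) power of $2$ and $d(a)$ odd, one copy of $\mathbb Z/(n(a))$ in degree $2d(a)-1$ and one copy of $\mathbb Z/2$ in each degree $2d(a)+i$.
   Context: $\mathbb Z/(n,n')$ denotes the quotient of $\mathbb Z$ by the ideal generated by $n$ and $n'$. The generator of $C_2$ acts on $C^*\otimes C^*$ by $c\otimes c'\mapsto(-1)^{\deg c\deg c'}c'\otimes c$. $\mathrm{Hom}_{C_2}=\mathrm{Hom}_{\mathbb ZC_2}$ and $\mathrm{Tot}$ is the total complex of the double complex $\mathrm{Hom}_{C_2}(W_i,(C^{*\otimes2})^j)$. When $C^*$ is the cellular cochain complex of a finite type CW-complex $X$, this cohomology is $H^*(X^2\times_{C_2}EC_2;\mathbb Z)$. *)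

(* Defs.v *)
From HB Require Import structures.
From mathcomp Require Import all_boot all_order all_algebra finmap.
From mathcomp Require Import ring_quotient generic_quotient.
From mathcomp Require Import boolp classical_sets functions cardinality.
From mathcomp.multinomials Require Import freeg.

Set Implicit Arguments.
Unset Strict Implicit.
Unset Printing Implicit Defensive.

Import GRing.Theory Num.Theory.
Local Open Scope classical_set_scope.
Local Open Scope ring_scope.

Definition mk_additive (U V : zmodType) (f : U -> V) (h : zmod_morphism f) :
  {additive U -> V} := HB.pack f (GRing.isZmodMorphism.Build U V f h).

Definition zmod_iso (U V : zmodType) : Prop :=
  exists f : {additive U -> V}, bijective f.

Record subzmod (V : zmodType) (S : zmodClosed V) :=
  SubZmod { subzmod_val : V; _ : subzmod_val \in S }.

HB.instance Definition _ V S := [isSub for @subzmod_val V S].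
HB.instance Definition _ V S := [Choice of @subzmod V S by <:].
HB.instance Definition _ V S := [SubChoice_isSubZmodule of @subzmod V S by <:].

Section KernelImage.
Variables (U V : zmodType) (f : {additive U -> V}).

Definition kernel : {pred U} := [pred x | f x == 0].

Fact kernel_closed : zmod_closed kernel.
Proof.
split=> [|x y]; first by rewrite inE raddf0.
by rewrite !inE => /eqP fx /eqP fy; rewrite raddfB fx fy subrr.
Qed.
HB.instance Definition _ := GRing.isZmodClosed.Build U kernel kernel_closed.

Definition img : {pred V} := [pred y | `[< exists x, f x = y >]].

Fact img_closed : zmod_closed img.
Proof.
split=> [|x y]; rewrite !inE; first by exists 0; rewrite raddf0.
by move=> [u <-] [v <-]; exists (u - v); rewrite raddfB.
Qed.
HB.instance Definition _ := GRing.isZmodClosed.Build V img img_closed.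

End KernelImage.

Section DirectSum.
Variables (I : Type) (V : I -> zmodType).

Definition dprod := forall i, V i.
HB.instance Definition _ := Choice.copy dprod (forall i, V i).

Definition dprod0 : dprod := fun=> 0.
Definition dprod_add (f g : dprod) : dprod := fun i => f i + g i.
Definition dprod_opp (f : dprod) : dprod := fun i => - f i.

Fact dprod_addA : associative dprod_add.
Proof. by move=> f g h; apply: functional_extensionality_dep => i; apply: addrA. Qed.
Fact dprod_addC : commutative dprod_add.
Proof. by move=> f g; apply: functional_extensionality_dep => i; apply: addrC. Qed.
Fact dprod_add0 : left_id dprod0 dprod_add.
Proof. by move=> f; apply: functional_extensionality_dep => i; apply: add0r. Qed.
Fact dprod_addN : left_inverse dprod0 dprod_opp dprod_add.
Proof. by move=> f; apply: functional_extensionality_dep => i; apply: addNr. Qed.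
HB.instance Definition _ :=
  GRing.isZmodule.Build dprod dprod_addA dprod_addC dprod_add0 dprod_addN.

Definition finsupp : {pred dprod} :=
  [pred f : dprod | `[< finite_set [set i | f i <> 0] >]].

Fact finsupp_closed : zmod_closed finsupp.
Proof.
split=> [|f g]; rewrite !inE.
  by apply: (sub_finite_set _ (finite_set0 I)) => i /=.
move=> finf fing.
have finfg : finite_set ([set i | f i <> 0] `|` [set i | g i <> 0]).
  by rewrite finite_setU.
apply: (sub_finite_set _ finfg) => i /= fgi; apply: contrapT => /not_orP[].
move=> /contrapT fi /contrapT gi; apply: fgi.
by rewrite -[(f - g) i]/(f i - g i) fi gi subrr.
Qed.
HB.instance Definition _ := GRing.isZmodClosed.Build dprod finsupp finsupp_closed.

Definition dsum : zmodType := subzmod finsupp.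

Definition dsum_fun (f : dsum) : forall i, V i := subzmod_val f.

Lemma dsum_finite (f : dsum) : finite_set [set i | dsum_fun f i <> 0].
Proof. by case: f => f /= /[!inE]. Qed.

Definition mk_dsum (f : forall i, V i) (h : finite_set [set i | f i <> 0]) : dsum :=
  @SubZmod dprod finsupp f (introT (asboolP _) h).

Lemma dsumP (f g : dsum) : (forall i, dsum_fun f i = dsum_fun g i) -> f = g.
Proof. by move=> fg; apply/val_inj; apply: functional_extensionality_dep. Qed.

Lemma dsum_funB (f g : dsum) i : dsum_fun (f - g) i = dsum_fun f i - dsum_fun g i.
Proof. by []. Qed.

Lemma dsum_fun0 i : dsum_fun 0 i = 0.
Proof. by []. Qed.

End DirectSum.

Section Tensor.
Variables X Y : zmodType.

Notation "<< p >>" := (Freeg [:: (1%:Z, p)]).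

Inductive tensor_rel : {freeg (X * Y)} -> Prop :=
| TensorRelL x x' y : tensor_rel (<<(x + x', y)>> - <<(x, y)>> - <<(x', y)>>)
| TensorRelR x y y' : tensor_rel (<<(x, y + y')>> - <<(x, y)>> - <<(x, y')>>).

(* The subgroup generated by the bilinearity relations. *)
Definition tensor_null : {pred {freeg (X * Y)}} :=
  [pred v | `[< forall S : zmodClosed {freeg (X * Y)},
                  (forall w, tensor_rel w -> w \in S) -> v \in S >]].

Fact tensor_null_closed : zmod_closed tensor_null.
Proof.
split=> [|v w]; rewrite !inE; first by move=> S _; rewrite rpred0.
by move=> hv hw S hS; rewrite rpredB ?hv ?hw.
Qed.
HB.instance Definition _ :=
  GRing.isZmodClosed.Build {freeg (X * Y)} tensor_null tensor_null_closed.

Definition tensor : zmodType := Quotient.quot tensor_null.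

Definition tens (x : X) (y : Y) : tensor :=
  (\pi_(Quotient.quot tensor_null) <<(x, y)>>)%qT.

Lemma tensDl x x' y : tens (x + x') y = tens x y + tens x' y.
Proof.
apply/eqP; rewrite -subr_eq0 opprD addrA -!raddfB /= piE /Quotient.equiv subr0.
by rewrite inE => S; apply; exact: TensorRelL.
Qed.

Lemma tensDr x y y' : tens x (y + y') = tens x y + tens x y'.
Proof.
apply/eqP; rewrite -subr_eq0 opprD addrA -!raddfB /= piE /Quotient.equiv subr0.
by rewrite inE => S; apply; exact: TensorRelR.
Qed.

Lemma tensor_ext (M : zmodType) (f g : {additive tensor -> M}) :
  (forall x y, f (tens x y) = g (tens x y)) -> f =1 g.
Proof.
move=> fg; apply: quotW => v; rewrite -[v]freeg_sumE !raddf_sum /=.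
apply: eq_bigr => -[x y] _.
rewrite -[X in Freeg [:: (X, _)]]intz -freegU_mulz !raddfMz.
by congr (_ *~ _); apply: fg.
Qed.

Section Lift.
Variables (M : zmodType) (b : X -> Y -> M).
Hypotheses (bDl : forall x x' y, b (x + x') y = b x y + b x' y)
           (bDr : forall x y y', b x (y + y') = b x y + b x y').

Definition tensor_prelift : {freeg (X * Y)} -> M :=
  fglift (M := zmodule M) (fun p => b p.1 p.2).

Fact tensor_prelift_additive : zmod_morphism tensor_prelift.
Proof. exact: (@lift_is_additive int (X * Y)%type (zmodule M)). Qed.
HB.instance Definition _ :=
  GRing.isZmodMorphism.Build _ _ tensor_prelift tensor_prelift_additive.

Lemma tensor_preliftE x y : tensor_prelift <<(x, y)>> = b x y.
Proof. exact: (liftU (M := zmodule M)). Qed.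

Lemma tensor_prelift_null v : v \in tensor_null -> tensor_prelift v = 0.
Proof.
rewrite inE => hv; suff : v \in kernel tensor_prelift by rewrite inE => /eqP.
apply: hv => _ [x x' y|x y y']; rewrite inE !raddfB /= !tensor_preliftE.
  by rewrite bDl addrAC addrK subrr.
by rewrite bDr addrAC addrK subrr.
Qed.

Fact tensor_lift_additive :
  zmod_morphism (fun t : tensor => tensor_prelift (repr t)).
Proof.
move=> s t; apply/eqP; rewrite -subr_eq0 -!raddfB; apply/eqP.
apply: tensor_prelift_null; rewrite Quotient.idealrBE.
by apply/eqP; rewrite reprK raddfB /= !reprK.
Qed.

(* The additive map with x (x) y |-> b x y. *)
Definition tensor_lift : {additive tensor -> M} := mk_additive tensor_lift_additive.

Lemma tensor_liftE x y : tensor_lift (tens x y) = b x y.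
Proof.
rewrite -tensor_preliftE; apply/eqP; rewrite -subr_eq0 /= -raddfB; apply/eqP.
by apply: tensor_prelift_null; rewrite Quotient.idealrBE reprK.
Qed.
End Lift.

End Tensor.

Section TensorMap.
Variables (X X' Y Y' : zmodType) (f : {additive X -> X'}) (g : {additive Y -> Y'}).

Fact tensor_mapDl x x' y : tens (f (x + x')) (g y) = tens (f x) (g y) + tens (f x') (g y).
Proof. by rewrite raddfD tensDl. Qed.
Fact tensor_mapDr x y y' : tens (f x) (g (y + y')) = tens (f x) (g y) + tens (f x) (g y').
Proof. by rewrite raddfD tensDr. Qed.

Definition tensor_map : {additive tensor X Y -> tensor X' Y'} :=
  tensor_lift tensor_mapDl tensor_mapDr.

Lemma tensor_mapE x y : tensor_map (tens x y) = tens (f x) (g y).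
Proof. exact: tensor_liftE. Qed.
End TensorMap.

Section TensorSwap.
Variables X Y : zmodType.

Definition tensor_swap : {additive tensor X Y -> tensor Y X} :=
  tensor_lift (fun x x' y => tensDr y x x') (fun x y y' => tensDl y y' x).

Lemma tensor_swapE x y : tensor_swap (tens x y) = tens y x.
Proof. exact: tensor_liftE. Qed.
End TensorSwap.

Lemma tens0l (X Y : zmodType) (y : Y) : tens (0 : X) y = 0.
Proof. by apply: (@addrI _ (tens 0 y)); rewrite -tensDl !addr0. Qed.
Lemma tens0r (X Y : zmodType) (x : X) : tens x (0 : Y) = 0.
Proof. by apply: (@addrI _ (tens x 0)); rewrite -tensDr !addr0. Qed.

(* Differentials take a proof of q = p + 1, which avoids casts between the
   groups in degrees p and p - 1 + 1. *)
Record cochain := Cochain {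
  cgrp :> int -> zmodType;
  cdiff : forall p q : int, p + 1 = q -> {additive cgrp p -> cgrp q};
  cdiffK : forall (p q r : int) (hq : p + 1 = q) (hr : q + 1 = r) x,
    cdiff hr (cdiff hq x) = 0 }.

Section Cohomology.
Variables (C : cochain) (p : int).

Definition cocycles : zmodType := subzmod (kernel (cdiff C (erefl (p + 1)))).

Fact coboundary_cocycle (x : C (p - 1)) :
  cdiff C (subrK 1 p) x \in kernel (cdiff C (erefl (p + 1))).
Proof. by rewrite inE cdiffK. Qed.

Fact coboundary_additive :
  zmod_morphism (fun x => SubZmod (coboundary_cocycle x)).
Proof. by move=> x y; apply/val_inj; rewrite /= raddfB. Qed.

Definition coboundary : {additive C (p - 1) -> cocycles} :=
  mk_additive coboundary_additive.

Definition cohomology : zmodType := Quotient.quot (img coboundary).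

End Cohomology.

Record dcochain := DCochain {
  dgrp :> int -> int -> zmodType;
  dh : forall i i' j : int, i + 1 = i' -> {additive dgrp i j -> dgrp i' j};
  dv : forall i j j' : int, j + 1 = j' -> {additive dgrp i j -> dgrp i j'};
  dhK : forall (i i' i'' j : int) (h : i + 1 = i') (h' : i' + 1 = i'') x,
    dh j h' (dh j h x) = 0;
  dvK : forall (i j j' j'' : int) (h : j + 1 = j') (h' : j' + 1 = j'') x,
    dv i h' (dv i h x) = 0;
  dhv : forall (i i' j j' : int) (hi : i + 1 = i') (hj : j + 1 = j') x,
    dh j' hi (dv i hj x) = dv i' hj (dh j hi x) }.

Definition sgnz (V : zmodType) (i : int) (x : V) : V := x *~ ((-1) ^ i).

Lemma sgnzB (V : zmodType) i : zmod_morphism (@sgnz V i).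
Proof. by move=> x y; rewrite /sgnz mulrzBl. Qed.
HB.instance Definition _ (V : zmodType) i :=
  GRing.isZmodMorphism.Build V V (@sgnz V i) (@sgnzB V i).
Lemma sgnz_raddf (U V : zmodType) (f : {additive U -> V}) i x :
  f (sgnz i x) = sgnz i (f x).
Proof. exact: raddfMz. Qed.
Lemma sgnz_add (V : zmodType) i (x y : V) : sgnz i (x + y) = sgnz i x + sgnz i y.
Proof. exact: raddfD. Qed.
Lemma sgnzD (V : zmodType) i j (x : V) : sgnz (i + j) x = sgnz i (sgnz j x).
Proof. by rewrite /sgnz -mulrzA exprzDr // mulrC. Qed.
Lemma sgnz_sub1 (V : zmodType) i (x : V) : sgnz (i - 1) x = - sgnz i x.
Proof. by rewrite addrC sgnzD /sgnz exprN1 invrN1 mulrNz mulr1z. Qed.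
Lemma sgnzK (V : zmodType) i : involutive (@sgnz V i).
Proof. by move=> x; rewrite /sgnz -mulrzA expN1r -expr2 sqrr_sign. Qed.
Lemma sgnzN (V : zmodType) i (x : V) : sgnz (- i) x = sgnz i x.
Proof. by rewrite /sgnz !expN1r abszN. Qed.

Record diag (m : int) := Diag { di : int; dj : int; diagE : di + dj = m }.

Lemma diag_inj m (u v : diag m) : di u = di v -> dj u = dj v -> u = v.
Proof.
by case: u v => i j h [i' j' h'] /= e e'; subst i' j'; congr Diag; apply: Prop_irrelevance.
Qed.

(* Total complex with direct sums along the diagonals and differential
   dh + (-1)^i dv.  When K i j vanishes for i or j small, the diagonals are
   finite and direct sums coincide with products. *)
Section Total.
Variable K : dcochain.

Definition tot_grp (m : int) : zmodType :=
  @dsum (diag m) (fun u => K (di u) (dj u)).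

Lemma dsum_fun_diag (m i j : int) (h h' : i + j = m) (f : tot_grp m) :
  dsum_fun f (Diag h) = dsum_fun f (Diag h').
Proof. by rewrite (Prop_irrelevance h h'). Qed.

Fact diag_leftE (m m' : int) (h : m + 1 = m') (u : diag m') : di u - 1 + dj u = m.
Proof. by rewrite addrAC diagE -h addrK. Qed.
Fact diag_downE (m m' : int) (h : m + 1 = m') (u : diag m') : di u + (dj u - 1) = m.
Proof. by rewrite addrA diagE -h addrK. Qed.

Definition diag_left (m m' : int) (h : m + 1 = m') (u : diag m') : diag m := Diag (diag_leftE h u).
Definition diag_down (m m' : int) (h : m + 1 = m') (u : diag m') : diag m := Diag (diag_downE h u).

Lemma diag_left_inj (m m' : int) (h : m + 1 = m') : injective (diag_left h).
Proof.
move=> u v e; apply: diag_inj; last exact: (congr1 (@dj m) e).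
by apply: (@subIr _ 1); apply: (congr1 (@di m) e).
Qed.

Lemma diag_down_inj (m m' : int) (h : m + 1 = m') : injective (diag_down h).
Proof.
move=> u v e; apply: diag_inj; first exact: (congr1 (@di m) e).
by apply: (@subIr _ 1); apply: (congr1 (@dj m) e).
Qed.

Section Differential.
Variables (m m' : int) (h : m + 1 = m').

Definition tot_diff_fun (f : tot_grp m) (u : diag m') : K (di u) (dj u) :=
  dh K (dj u) (subrK 1 (di u)) (dsum_fun f (diag_left h u)) +
  sgnz (di u) (dv K (di u) (subrK 1 (dj u)) (dsum_fun f (diag_down h u))).

Fact tot_diff_finite f : finite_set [set u | tot_diff_fun f u <> 0].
Proof.
have finL : finite_set (diag_left h @^-1` [set u | dsum_fun f u <> 0]).
  by apply: finite_preimage (dsum_finite f) => u v _ _; apply: diag_left_inj.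
have finD : finite_set (diag_down h @^-1` [set u | dsum_fun f u <> 0]).
  by apply: finite_preimage (dsum_finite f) => u v _ _; apply: diag_down_inj.
have finLD := finL; have {finLD} : finite_set
  (diag_left h @^-1` [set u | dsum_fun f u <> 0] `|`
   diag_down h @^-1` [set u | dsum_fun f u <> 0]) by rewrite finite_setU.
apply: sub_finite_set => u /= fu; apply: contrapT => /not_orP[].
move=> /contrapT fl /contrapT fd; apply: fu.
by rewrite /tot_diff_fun fl fd !raddf0 addr0.
Qed.

Fact tot_diff_additive : zmod_morphism (fun f => mk_dsum (tot_diff_finite f)).
Proof.
move=> f g; apply: dsumP => u; rewrite dsum_funB /= /tot_diff_fun.
by rewrite !dsum_funB !raddfB opprD addrACA.
Qed.

Definition tot_diff : {additive tot_grp m -> tot_grp m'} :=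
  mk_additive tot_diff_additive.
End Differential.

Fact tot_diffK (m m' m'' : int) (h : m + 1 = m') (h' : m' + 1 = m'') f :
  tot_diff h' (tot_diff h f) = 0.
Proof.
apply: dsumP => u; rewrite dsum_fun0 /= /tot_diff_fun /= !raddfD /= !sgnz_raddf.
rewrite dhK dvK !raddf0 add0r !addr0 sgnz_sub1 dhv.
rewrite /diag_down /diag_left /=.
set e1 := diag_downE _ _; set e2 := diag_leftE _ _.
by rewrite (Prop_irrelevance e1 e2) addNr.
Qed.

Definition Tot : cochain := Cochain tot_diffK.

End Total.

Section TensorSquare.
Variable C : cochain.

Definition tdh (p p' q : int) (h : p + 1 = p') :
  {additive tensor (C p) (C q) -> tensor (C p') (C q)} := tensor_map (cdiff C h) idfun.
Definition tdv (p q q' : int) (h : q + 1 = q') :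
  {additive tensor (C p) (C q) -> tensor (C p) (C q')} := tensor_map idfun (cdiff C h).

Lemma tdhE (p p' q : int) (h : p + 1 = p') x y : tdh q h (tens x y) = tens (cdiff C h x) y.
Proof. exact: tensor_mapE. Qed.
Lemma tdvE (p q q' : int) (h : q + 1 = q') x y : tdv p h (tens x y) = tens x (cdiff C h y).
Proof. exact: tensor_mapE. Qed.

Fact tdhK (p p' p'' q : int) (h : p + 1 = p') (h' : p' + 1 = p'') x :
  tdh q h' (tdh q h x) = 0.
Proof.
apply: (tensor_ext (f := tdh q h' \o tdh q h) (g := \0)) => {}x y.
by rewrite -[LHS]/(tdh q h' (tdh q h _)) !tdhE cdiffK tens0l.
Qed.

Fact tdvK (p q q' q'' : int) (h : q + 1 = q') (h' : q' + 1 = q'') x :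
  tdv p h' (tdv p h x) = 0.
Proof.
apply: (tensor_ext (f := tdv p h' \o tdv p h) (g := \0)) => {}x y.
by rewrite -[LHS]/(tdv p h' (tdv p h _)) !tdvE cdiffK tens0r.
Qed.

Fact tdhv (p p' q q' : int) (hp : p + 1 = p') (hq : q + 1 = q') x :
  tdh q' hp (tdv p hq x) = tdv p' hq (tdh q hp x).
Proof.
apply: (tensor_ext (f := tdh q' hp \o tdv p hq) (g := tdv p' hq \o tdh q hp)) => {}x y.
rewrite -[LHS]/(tdh q' hp (tdv p hq _)) -[RHS]/(tdv p' hq (tdh q hp _)).
by rewrite !(tdhE, tdvE).
Qed.

(* The total differential is c (x) c' |-> dc (x) c' + (-1)^(deg c) c (x) dc'. *)
Definition tensor_square : cochain := Tot (DCochain tdhK tdvK tdhv).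

Definition diag_swap m (u : diag m) : diag m :=
  Diag (etrans (addrC (dj u) (di u)) (diagE u)).

Lemma diag_swapK m : involutive (@diag_swap m).
Proof. by move=> u; apply: diag_inj. Qed.

(* The action of the generator of C_2: c (x) c' |-> (-1)^(deg c deg c') c' (x) c. *)
Definition swap_fun m (f : tensor_square m) (u : diag m) :
  tensor (C (di u)) (C (dj u)) :=
  sgnz (di u * dj u) (tensor_swap _ _ (dsum_fun f (diag_swap u))).

Fact swap_finite m (f : tensor_square m) : finite_set [set u | swap_fun f u <> 0].
Proof.
have : finite_set (@diag_swap m @^-1` [set u | dsum_fun f u <> 0]).
  by apply: finite_preimage (dsum_finite f) => u v _ _; apply: (inv_inj (@diag_swapK m)).
apply: sub_finite_set => u /= fu f0; apply: fu.
by rewrite /swap_fun f0 !raddf0.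
Qed.

Fact swap_additive m : zmod_morphism (fun f : tensor_square m => mk_dsum (swap_finite f)).
Proof.
move=> f g; apply: dsumP => u; rewrite dsum_funB /= /swap_fun.
by rewrite !dsum_funB !raddfB.
Qed.

Definition swap m : {additive tensor_square m -> tensor_square m} :=
  mk_additive (@swap_additive m).

Lemma tensor_swapK (X Y : zmodType) (t : tensor X Y) : tensor_swap Y X (tensor_swap X Y t) = t.
Proof.
apply: (tensor_ext (f := tensor_swap Y X \o tensor_swap X Y) (g := idfun)) => x y.
by rewrite -[LHS]/(tensor_swap _ _ (tensor_swap _ _ _)) !tensor_swapE.
Qed.

Fact swapK m : involutive (@swap m).
Proof.
move=> f; apply: dsumP => -[i j h].
rewrite -[LHS]/(sgnz (i * j) (tensor_swap _ _ (sgnz (j * i) (tensor_swap _ _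
  (dsum_fun f (@Diag m i j (diagE (diag_swap (diag_swap (@Diag m i j h)))))))))).
rewrite sgnz_raddf tensor_swapK mulrC sgnzK.
by rewrite (Prop_irrelevance (diagE (diag_swap (diag_swap (@Diag m i j h)))) h).
Qed.

Lemma swap_tdh (p p' q : int) (h : p + 1 = p') x :
  tensor_swap _ _ (tdh q h x) = tdv q h (tensor_swap _ _ x).
Proof.
apply: (tensor_ext (f := tensor_swap _ _ \o tdh q h)
  (g := tdv q h \o tensor_swap _ _)) => {}x y.
rewrite -[LHS]/(tensor_swap _ _ (tdh q h _)) -[RHS]/(tdv q h (tensor_swap _ _ _)).
by rewrite tdhE !tensor_swapE tdvE.
Qed.

Lemma swap_tdv (p q q' : int) (h : q + 1 = q') x :
  tensor_swap _ _ (tdv p h x) = tdh p h (tensor_swap _ _ x).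
Proof.
apply: (tensor_ext (f := tensor_swap _ _ \o tdv p h)
  (g := tdh p h \o tensor_swap _ _)) => {}x y.
rewrite -[LHS]/(tensor_swap _ _ (tdv p h _)) -[RHS]/(tdh p h (tensor_swap _ _ _)).
by rewrite tdvE !tensor_swapE tdhE.
Qed.

Lemma swap_diff_sgn (i j : int) (x : tensor (C j) (C (i - 1))) (y : tensor (C (j - 1)) (C i)) :
  tdh j (subrK 1 i) (sgnz ((i - 1) * j) (tensor_swap _ _ x)) +
  sgnz i (tdv i (subrK 1 j) (sgnz (i * (j - 1)) (tensor_swap _ _ y))) =
  sgnz (i * j) (tensor_swap _ _ (tdh i (subrK 1 j) y + sgnz j (tdv j (subrK 1 i) x))).
Proof.
rewrite (raddfD (tensor_swap _ _)) sgnz_add (sgnz_raddf (tensor_swap _ _)).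
rewrite (sgnz_raddf (tdh _ _)) (sgnz_raddf (tdv _ _)) swap_tdh swap_tdv.
rewrite [RHS]addrC -!sgnzD; congr (_ + _); last by congr sgnz; rewrite mulrBr mulr1 addrC subrK.
by rewrite mulrBl mul1r !sgnzD sgnzN.
Qed.

Fact cdiff_swap (m m' : int) (h : m + 1 = m') (f : tensor_square m) :
  cdiff tensor_square h (swap m f) = swap m' (cdiff tensor_square h f).
Proof.
apply: dsumP => -[i j hu].
apply: (etrans (swap_diff_sgn _ _)).
set u := Diag hu.
have -> : dsum_fun f (diag_swap (diag_down h u)) =
          dsum_fun f (diag_left h (diag_swap u)) by apply: dsum_fun_diag.
have -> : dsum_fun f (diag_swap (diag_left h u)) =
          dsum_fun f (diag_down h (diag_swap u)) by apply: dsum_fun_diag.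
by [].
Qed.

End TensorSquare.

(* A Z[C_2]-module is an abelian group with an additive involution, namely the
   action of the generator of C_2. *)
Record c2module := C2Module {
  c2grp :> zmodType;
  c2act : {additive c2grp -> c2grp};
  c2actK : involutive c2act }.

Record c2cochain := C2Cochain {
  c2cochain_grp :> cochain;
  c2cochain_act : forall p, {additive c2cochain_grp p -> c2cochain_grp p};
  c2cochain_actK : forall p, involutive (c2cochain_act p);
  c2cochain_diff : forall (p q : int) (h : p + 1 = q) x,
    cdiff c2cochain_grp h (c2cochain_act p x) =
    c2cochain_act q (cdiff c2cochain_grp h x) }.

Definition c2cochain_mod (M : c2cochain) (p : int) : c2module :=
  C2Module (@c2cochain_actK M p).

Definition c2tensor_square (C : cochain) : c2cochain :=
  C2Cochain (@swapK C) (@cdiff_swap C).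

(* Chain complexes are indexed by int so that hom_dcochain below is a dcochain. *)
Record c2chain := C2Chain {
  c2chain_mod :> int -> c2module;
  bd : forall i k : int, k + 1 = i -> {additive c2chain_mod i -> c2chain_mod k};
  bdK : forall (i k l : int) (hk : k + 1 = i) (hl : l + 1 = k) x,
    bd hl (bd hk x) = 0;
  bd_act : forall (i k : int) (h : k + 1 = i) x,
    bd h (c2act (c2chain_mod i) x) = c2act (c2chain_mod k) (bd h x) }.

(* Z[C_2] is Z^2 with the generator of C_2 exchanging the coordinates. *)
Definition c2free (M : c2module) : Prop :=
  exists (B : Type) (f : {additive M -> dsum (fun _ : B => (int * int)%type)}),
    bijective f /\
    forall x b, dsum_fun (f (c2act M x)) b =
                ((dsum_fun (f x) b).2, (dsum_fun (f x) b).1).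

(* W is a resolution of the trivial module Z by free Z[C_2]-modules, of
   arbitrary rank.  The cellular chain complex of a contractible C_2-free
   C_2-CW-complex is one: W_i is free on one cell per orbit of i-cells, and
   the augmentation is the isomorphism H_0 = Z. *)
Definition c2free_resolution (W : c2chain) : Prop :=
  [/\ forall i : int, i < 0 -> forall x : W i, x = 0,
      forall i, c2free (W i),
      forall (i : int) (x : W i), 0 < i -> bd W (subrK 1 i) x = 0 ->
        exists y : W (i + 1), bd W (erefl (i + 1)) y = x
    & exists aug : {additive W 0 -> int},
      [/\ forall n, exists x, aug x = n,
          forall x, aug (c2act (W 0) x) = aug x
        & forall x, aug x = 0 <->
            exists y : W (0 + 1), bd W (erefl (0 + 1)) y = x]].

Section HomC2.
Variables M N : c2module.

Definition c2linear (f : M -> N) : Prop :=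
  zmod_morphism f /\ forall x, f (c2act M x) = c2act N (f x).

Definition c2linear_pred : {pred (M -> N)} := [pred f | `[< c2linear f >]].

Fact c2linear_closed : zmod_closed c2linear_pred.
Proof.
split=> [|f g]; rewrite !inE.
  by split=> [x y|x]; rewrite /= ?subr0 ?raddf0.
move=> [fB fa] [gB ga]; split=> [x y|x].
  by rewrite -![(f - g) _]/(f _ - g _) fB gB !opprD !opprK addrACA.
by rewrite -![(f - g) _]/(f _ - g _) fa ga raddfB.
Qed.
HB.instance Definition _ :=
  GRing.isZmodClosed.Build (M -> N) c2linear_pred c2linear_closed.

Definition homC2 : zmodType := subzmod c2linear_pred.

Definition hom_fun (f : homC2) : M -> N := subzmod_val f.

Lemma hom_linear (f : homC2) : c2linear (hom_fun f).
Proof. by case: f => f /= /[!inE]. Qed.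

Definition mk_hom (f : M -> N) (h : c2linear f) : homC2 :=
  @SubZmod (M -> N) c2linear_pred f (introT (asboolP _) h).

Lemma homP (f g : homC2) : (forall x, hom_fun f x = hom_fun g x) -> f = g.
Proof. by move=> fg; apply/val_inj/funext. Qed.

Lemma hom_funB (f g : homC2) x : hom_fun (f - g) x = hom_fun f x - hom_fun g x.
Proof. by []. Qed.

Lemma hom_fun0 x : hom_fun 0 x = 0.
Proof. by []. Qed.

Lemma hom_fun_0r (f : homC2) : hom_fun f 0 = 0.
Proof. by rewrite -[X in hom_fun f X](subrr 0) (hom_linear f).1 subrr. Qed.

End HomC2.

Section HomComplex.
Variables (W : c2chain) (M : c2cochain).

Notation H i j := (homC2 (W i) (c2cochain_mod M j)).

Fact precomp_linear (i i' j : int) (h : i + 1 = i') (f : H i j) :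
  @c2linear (W i') (c2cochain_mod M j) (fun x => hom_fun f (bd W h x)).
Proof.
by split=> [x y|x]; rewrite ?raddfB ?bd_act; apply hom_linear.
Qed.

Fact precomp_additive (i i' j : int) (h : i + 1 = i') :
  zmod_morphism (fun f : H i j => mk_hom (precomp_linear h f)).
Proof. by move=> f g; apply: homP. Qed.

Definition precomp (i i' j : int) (h : i + 1 = i') : {additive H i j -> H i' j} :=
  mk_additive (@precomp_additive i i' j h).

Fact postcomp_linear (i j j' : int) (h : j + 1 = j') (f : H i j) :
  @c2linear (W i) (c2cochain_mod M j') (fun x => cdiff M h (hom_fun f x)).
Proof.
split=> [x y|x]; first by rewrite (hom_linear f).1 raddfB.
by rewrite (hom_linear f).2 c2cochain_diff.
Qed.

Fact postcomp_additive (i j j' : int) (h : j + 1 = j') :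
  zmod_morphism (fun f : H i j => mk_hom (postcomp_linear h f)).
Proof. by move=> f g; apply: homP => x; rewrite hom_funB -raddfB. Qed.

Definition postcomp (i j j' : int) (h : j + 1 = j') : {additive H i j -> H i j'} :=
  mk_additive (@postcomp_additive i j j' h).

Fact precompK (i i' i'' j : int) (h : i + 1 = i') (h' : i' + 1 = i'') x :
  precomp j h' (precomp j h x) = 0.
Proof.
by apply: homP => w; rewrite -[LHS]/(hom_fun x (bd W h (bd W h' w))) bdK hom_fun_0r.
Qed.

Fact postcompK (i j j' j'' : int) (h : j + 1 = j') (h' : j' + 1 = j'') x :
  postcomp i h' (postcomp i h x) = 0.
Proof.
by apply: homP => w; rewrite -[LHS]/(cdiff M h' (cdiff M h (hom_fun x w))) cdiffK.
Qed.

Fact pre_postcomp (i i' j j' : int) (hi : i + 1 = i') (hj : j + 1 = j') x :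
  precomp j' hi (postcomp i hj x) = postcomp i' hj (precomp j hi x).
Proof. exact: homP. Qed.

Definition hom_dcochain : dcochain := DCochain precompK postcompK pre_postcomp.

End HomComplex.

Definition bounded_below (C : cochain) : Prop :=
  exists N : int, forall p : int, p < N -> forall x : C p, x = 0.

Definition fg_free (V : zmodType) : Prop := exists r, zmod_iso V 'rV[int]_r.

Definition ideal_gen (s : seq int) : {pred int} :=
  [pred x | `[< exists c : 'I_(size s) -> int, x = \sum_i c i * s`_i >]].

Fact ideal_gen_closed s : zmod_closed (ideal_gen s).
Proof.
split=> [|x y]; rewrite !inE.
  by exists (fun=> 0); rewrite big1 // => i _; rewrite mul0r.
move=> [c ->] [c' ->]; exists (fun i => c i - c' i).
by rewrite -sumrB; apply: eq_bigr => i _; rewrite mulrBl.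
Qed.
HB.instance Definition _ s :=
  GRing.isZmodClosed.Build int (ideal_gen s) (ideal_gen_closed s).

Definition Zquot (s : seq int) : zmodType := Quotient.quot (ideal_gen s).

Section Summands.
Variables (A : choiceType) (d : A -> int) (n : A -> nat).

Record upair := UPair { upair_set : {fset A}; upair_card : #|` upair_set| = 2 }.

(* Labels of the potential summands: Free, OddTorsion and TwoTorsion refer to
   n a = 0, n a odd and n a a power of 2, the suffixes Even and Odd to the parity
   of d a.  The nat argument is the index i of the families indexed by i >= 0.
   A label contributes label_grp in degree label_deg when label_occurs holds. *)
Inductive label :=
| PairTensor of upair | PairTor of upair
| FreeEven0 of A | FreeEven of A & nat
| FreeOdd of A & nat
| OddTorsionEven of A
| OddTorsionOdd of A
| TwoTorsionEven0 of A | TwoTorsionEvenLow of A | TwoTorsionEven of A & nat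
| TwoTorsionOdd0 of A | TwoTorsionOdd of A & nat.

Definition even_deg (a : A) : Prop := (2 %| d a)%Z.

Definition power_of_2 (k : nat) : Prop := exists e, (0 < e)%N /\ k = (2 ^ e)%N.

Definition label_occurs (l : label) : Prop :=
  match l with
  | PairTensor _ => True
  | PairTor P => forall a, a \in upair_set P -> n a <> 0%N
  | FreeEven0 a | FreeEven a _ => n a = 0%N /\ even_deg a
  | FreeOdd a _ => n a = 0%N /\ ~ even_deg a
  | OddTorsionEven a => odd (n a) /\ even_deg a
  | OddTorsionOdd a => odd (n a) /\ ~ even_deg a
  | TwoTorsionEven0 a | TwoTorsionEvenLow a | TwoTorsionEven a _ => power_of_2 (n a) /\ even_deg a
  | TwoTorsionOdd0 a | TwoTorsionOdd a _ => power_of_2 (n a) /\ ~ even_deg a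
  end.

Definition label_deg (l : label) : int :=
  match l with
  | PairTensor P => \sum_(a <- upair_set P) d a
  | PairTor P => \sum_(a <- upair_set P) d a - 1
  | FreeEven0 a => 2 * d a
  | FreeEven a i => 2 * d a + 2 + 2 * i%:Z
  | FreeOdd a i => 2 * d a + 1 + 2 * i%:Z
  | OddTorsionEven a => 2 * d a
  | OddTorsionOdd a => 2 * d a - 1
  | TwoTorsionEven0 a => 2 * d a
  | TwoTorsionEvenLow a => 2 * d a - 1
  | TwoTorsionEven a i => 2 * d a + 1 + i%:Z
  | TwoTorsionOdd0 a => 2 * d a - 1
  | TwoTorsionOdd a i => 2 * d a + i%:Z
  end.

Definition label_grp (l : label) : zmodType :=
  match l with
  | PairTensor P | PairTor P => Zquot [seq (n a)%:Z | a <- upair_set P]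
  | FreeEven0 _ => int
  | FreeEven _ _ | FreeOdd _ _ => Zquot [:: 2]
  | OddTorsionEven a | OddTorsionOdd a => Zquot [:: (n a)%:Z]
  | TwoTorsionEven0 a => Zquot [:: (2 * n a)%:Z]
  | TwoTorsionEvenLow _ | TwoTorsionEven _ _ => Zquot [:: 2]
  | TwoTorsionOdd0 a => Zquot [:: (n a)%:Z]
  | TwoTorsionOdd _ _ => Zquot [:: 2]
  end.

Definition summands (m : int) : zmodType :=
  dsum (fun l : {l : label | label_occurs l /\ label_deg l = m} =>
    label_grp (sval l)).

End Summands.

(* Main.v *)
Require Import Defs.
From HB Require Import structures.
From mathcomp Require Import all_boot all_order all_algebra finmap.
From mathcomp Require Import ring_quotient generic_quotient.
From mathcomp Require Import boolp classical_sets functions cardinality fsbigop.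
From mathcomp.multinomials Require Import freeg.
From mathcomp Require Import zify ring.

Set Implicit Arguments.
Unset Strict Implicit.
Unset Printing Implicit Defensive.

Import Order.TTheory GRing.Theory Num.Theory.
Local Open Scope classical_set_scope.
Local Open Scope quotient_scope.
Local Open Scope ring_scope.

(** The cohomology in question depends on W and C only up to homotopy, so both
   can be replaced by small models, for which it is a computation with integers.

   Any free resolution W is compared with the periodic one, which has a single
   generator e_i in each degree i and boundary e_i |-> e_(i-1) + (-1)^i T e_(i-1).
   Comparison maps in both directions, and the homotopies between their
   composites and the identity, come from freeness and acyclicity.  Hence
   Tot Hom_(C_2)(W, M) has the cohomology of [std_complex M]: its cochains are
   families x_i in M^(m-i) with i >= 0, the differential being
   x |-> x_(i-1) + (-1)^i T x_(i-1) + (-1)^i d x_i  ([resolution_std]).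

   A complex of finitely generated free groups is determined up to homotopy by
   its cohomology, because its cocycles are direct summands: C is homotopy
   equivalent to the elementary complex E with one copy of
   Z --n(a)--> Z in degrees d(a) - 1 and d(a) for each a with n(a) <> 0, and one
   copy of Z in degree d(a) for each a with n(a) = 0
   ([fg_free_split], [cohomology_homotopy_equivalent]).  A homotopy equivalence
   of C with E does not give an equivariant homotopy equivalence of the squares;
   it does give one after passing to [std_complex], where the failure of
   equivariance of the usual homotopy on the square is compensated in the
   neighbouring column ([std_homotopy], [homotopy_equivalent_square]).

   The complex [std_complex] of the square of E splits into blocks, one for each
   a (the products of the generators of a with each other) and one for each
   unordered pair a, a' (the products, in both orders, of a generator of a and
   one of a').  In each degree a block contributes at most one cyclic summand,
   and this summand is detected by an integral linear form in at most two
   coefficients, taken modulo some integers.  Three facts about these forms are verified by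
   explicit formulas: they vanish on coboundaries ([detect_boundary]), a cocycle
   on whose block they vanish is a coboundary there ([block_exact]), and some
   cocycle takes the value 1 ([generator]).  The only form with an unexpected
   shape belongs to Z/2n(a) in degree 2d(a), for n(a) and d(a) even: with F and R
   the generators of a, it is the coefficient of F (x) F minus n(a) times that
   of R (x) F.  Collecting the forms of all blocks gives the isomorphism with the
   asserted direct sum ([elementary_square]). *)

(** * Cohomology computed by an additive map *)

Lemma pi_eq0 (V : zmodType) (S : zmodClosed V) (x : V) :
  (\pi_(Quotient.quot S) x = 0) <-> (x \in S).
Proof.
rewrite -[x in x \in S]subr0 Quotient.idealrBE raddf0.
by split => /eqP.
Qed.

Section SubgroupPredicate.
Variables (V : zmodType) (P : V -> Prop).
Hypotheses (P0 : P 0) (PB : forall u v, P u -> P v -> P (u - v)).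

Lemma subgroupN u : P u -> P (- u).
Proof. by move=> Pu; rewrite -sub0r; apply: PB. Qed.

Lemma subgroupD u v : P u -> P v -> P (u + v).
Proof. by move=> Pu Pv; rewrite -[v]opprK; apply/PB/subgroupN. Qed.

Lemma subgroupMz u (k : int) : P u -> P (u *~ k).
Proof.
move=> Pu; have Pn i : P (u *+ i).
  by elim: i => [|i Pi]; rewrite ?mulr0n // mulrS; apply: subgroupD.
by case: k => k; [apply: Pn | apply/subgroupN/Pn].
Qed.

Lemma subgroup_sum (J : Type) (r : seq J) (F : J -> V) :
  (forall j, P (F j)) -> P (\sum_(j <- r) F j).
Proof. by move=> PF; apply: big_ind => // u v; apply: subgroupD. Qed.
End SubgroupPredicate.

Section DsumMap.
Variables (I J : Type) (V : I -> zmodType) (U : J -> zmodType).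
Variables (s : J -> I) (s_inj : injective s).
Variable (phi : forall j, {additive V (s j) -> U j}).

Fact dsum_map_finite (x : dsum V) :
  finite_set [set j | phi j (dsum_fun x (s j)) <> 0].
Proof.
have : finite_set (s @^-1` [set i | dsum_fun x i <> 0]).
  by apply: finite_preimage (dsum_finite x) => u v _ _; apply: s_inj.
by apply: sub_finite_set => j /= nz e; apply: nz; rewrite e raddf0.
Qed.

Fact dsum_map_additive : zmod_morphism (fun x => mk_dsum (dsum_map_finite x)).
Proof. by move=> x y; apply: dsumP => j; rewrite dsum_funB /= raddfB. Qed.

Definition dsum_map : {additive dsum V -> dsum U} := mk_additive dsum_map_additive.

Lemma dsum_mapE x j : dsum_fun (dsum_map x) j = phi j (dsum_fun x (s j)).
Proof. by []. Qed.
End DsumMap.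
Arguments dsum_map : simpl never.

Lemma dsum_funD (I : Type) (V : I -> zmodType) (x y : dsum V) i :
  dsum_fun (x + y) i = dsum_fun x i + dsum_fun y i.
Proof. by []. Qed.

Section Computes.
Variables (X : cochain) (Q : forall p, X p -> Prop).

(** The predicate Q cuts out a subcomplex of X, whose cohomology is meant; this
   avoids a second complex with its own inclusion. *)
Definition is_cocycle m (z : X m) := Q z /\ cdiff X (erefl (m + 1)) z = 0.
Definition is_cobord m (z : X m) := exists2 y : X (m - 1), Q y & cdiff X (subrK 1 m) y = z.

(** The map is defined on all cochains, although only its values on cocycles
   matter: such maps are easier to write down and to compose than maps out of a
   quotient. *)
Definition computes m (V : zmodType) := exists th : {additive X m -> V},
  [/\ forall z, is_cocycle z -> th z = 0 -> is_cobord z,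
      forall z, is_cobord z -> th z = 0 &
      forall v, exists2 z, is_cocycle z & th z = v].
End Computes.

Section ComputesIso.
Variables (X : cochain) (m : int) (V : zmodType).
Hypothesis XV : computes (fun p (_ : X p) => True) m V.

Lemma computes_iso : zmod_iso (cohomology X m) V.
Proof.
case: XV => th [thK thB thS].
have lift_add : zmod_morphism (fun c : cohomology X m => th (val (repr c))).
  move=> c c'; rewrite -raddfB; apply/eqP; rewrite -subr_eq0 -raddfB; apply/eqP.
  apply: thB.
  have : (repr (c - c') - (repr c - repr c')) \in img (coboundary X m).
    rewrite Quotient.idealrBE; apply/eqP.
    by rewrite reprK raddfB /= !reprK.
  rewrite inE => -[y ye]; exists y => //.
  by have /(congr1 val) := ye.
exists (mk_additive lift_add).
have thE (z : cocycles X m) : th (val (repr (\pi_(cohomology X m) z))) = th (val z).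
  apply/eqP; rewrite -subr_eq0 -raddfB; apply/eqP; apply: thB.
  have : (repr (\pi_(cohomology X m) z) - z) \in img (coboundary X m).
    by rewrite Quotient.idealrBE reprK.
  rewrite inE => -[y ye]; exists y => //.
  by have /(congr1 val) := ye.
have inj : injective (mk_additive lift_add).
  apply: raddf_inj => c.
  rewrite -[c]reprK; move: (repr c) => z.
  rewrite -[LHS]/(th (val (repr (\pi_(cohomology X m) z)))) thE => z0.
  case: (thK (val z)) => //.
    by split => //; case: z {z0} => z /=; rewrite inE => /eqP.
  move=> y _ dy; apply/pi_eq0.
  by rewrite inE; exists y; apply/val_inj.
have surj v : exists c, mk_additive lift_add c = v.
  case: (thS v) => z [_ dz] <-.
  have zK : z \in kernel (cdiff X (erefl (m + 1))) by rewrite inE dz.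
  exists (\pi_(cohomology X m) (SubZmod zK))%qT.
  by rewrite -[LHS]/(th _) thE.
exists (fun v => projT1 (cid (surj v))) => [c | v].
  by apply: inj; case: cid => /= c'.
by case: cid.
Qed.
End ComputesIso.

Section Transfer.
Variables (X Y : cochain) (QX : forall p, X p -> Prop) (QY : forall p, Y p -> Prop).
Arguments QX {p}. Arguments QY {p}.

Definition chain_map (f : forall p, {additive X p -> Y p}) :=
  (forall p (x : X p), QX x -> QY (f p x)) /\
  forall p q (h : p + 1 = q) x, QX x -> cdiff Y h (f p x) = f q (cdiff X h x).

Lemma chain_cocycle f m z : chain_map f -> is_cocycle (@QX) z -> is_cocycle (@QY) (f m z).
Proof. by move=> [fQ fd] [qz dz]; split; [apply: fQ | rewrite fd // dz raddf0]. Qed.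

Lemma chain_cobord f m z : chain_map f -> is_cobord (@QX) z -> is_cobord (@QY) (f m z).
Proof. by move=> [fQ fd] [y qy <-]; exists (f _ y); [apply: fQ | rewrite fd]. Qed.
End Transfer.

Section TransferIso.
Variables (X Y : cochain) (QX : forall p, X p -> Prop) (QY : forall p, Y p -> Prop).
Arguments QX {p}. Arguments QY {p}.
Variables (f : forall p, {additive X p -> Y p}) (g : forall p, {additive Y p -> X p}).
Hypotheses (fC : chain_map (@QX) (@QY) f) (gC : chain_map (@QY) (@QX) g).
Hypothesis QYB : forall p, forall x y : Y p, QY x -> QY y -> QY (x - y).
Variable m : int.
Hypothesis gfH : forall z, is_cocycle (@QX) z -> is_cobord (@QX) (g m (f m z) - z).
Hypothesis fgH : forall z, is_cocycle (@QY) z -> is_cobord (@QY) (f m (g m z) - z).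
Hypothesis QXB : forall p, forall x y : X p, QX x -> QX y -> QX (x - y).

Lemma cobordB (z w : X m) : is_cobord (@QX) z -> is_cobord (@QX) w -> is_cobord (@QX) (z - w).
Proof.
by move=> [y qy <-] [y' qy' <-]; exists (y - y'); [apply: QXB | rewrite raddfB].
Qed.

(** Mutually inverse homotopy equivalences, of which only the effect on cocycles
   in the given degree enters. *)
Lemma computes_transfer V : computes (@QY) m V -> computes (@QX) m V.
Proof.
case=> th [thK thB thS]; exists (th \o f m); split=> [z zc z0|z zb|v].
- have fb := thK _ (chain_cocycle fC zc) z0.
  have := cobordB (chain_cobord gC fb) (gfH zc).
  by rewrite opprB addrC subrK.
- exact: thB _ (chain_cobord fC zb).
- have [z zc <-] := thS v; exists (g m z); first exact: chain_cocycle zc.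
  apply/eqP; rewrite -subr_eq0 /= -raddfB; apply/eqP; apply: thB; exact: fgH.
Qed.
End TransferIso.

(** * Cochains on the periodic resolution *)

Lemma sgnz_add1 (V : zmodType) i i' (x : V) : i + 1 = i' -> sgnz i' x = - sgnz i x.
Proof. by move=> <-; rewrite -{2}[i](addrK 1) sgnz_sub1 opprK. Qed.

(** The indices of the two source components are free up to equations, which
   allows a component to be named by the same indices wherever it occurs. *)
Lemma tot_diff_at (K : dcochain) m m' (h : m + 1 = m') (x : Tot K m) i j (e : i + j = m')
    i0 (h0 : i0 + 1 = i) (e0 : i0 + j = m) j0 (h1 : j0 + 1 = j) (e1 : i + j0 = m) :
  dsum_fun (cdiff (Tot K) h x) (Diag e) =
  dh K j h0 (dsum_fun x (Diag e0)) + sgnz i (dv K i h1 (dsum_fun x (Diag e1))).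
Proof.
have E0 : i - 1 = i0 by rewrite -h0 addrK.
have E1 : j - 1 = j0 by rewrite -h1 addrK.
case: i0 / E0 h0 e0 => h0 e0; case: j0 / E1 h1 e1 => h1 e1.
rewrite (Prop_irrelevance h0 (subrK 1 i)) (Prop_irrelevance h1 (subrK 1 j)).
by rewrite (dsum_fun_diag e0 (diag_leftE h (Diag e))) (dsum_fun_diag e1 (diag_downE h (Diag e))).
Qed.

(** Hom_(C_2) from the periodic resolution to M.  The column i is M for every
   integer i, so that the differential is given by one formula; the periodic
   resolution lives in degrees i >= 0, and correspondingly the complex meant is
   the subcomplex [first_quadrant]. *)
Section StandardComplex.
Variable M : c2cochain.

Definition act j : {additive M j -> M j} := c2cochain_act M j.

Lemma actK j (x : M j) : act j (act j x) = x.
Proof. exact: c2cochain_actK. Qed.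

Lemma act_diff p q (h : p + 1 = q) (x : M p) : cdiff M h (act p x) = act q (cdiff M h x).
Proof. exact: c2cochain_diff. Qed.

Fact std_dh_additive (i' j : int) : zmod_morphism (fun x : M j => x + sgnz i' (act j x)).
Proof. by move=> x y; rewrite !raddfB opprD addrACA. Qed.

Definition std_dh (i i' j : int) (h : i + 1 = i') : {additive M j -> M j} :=
  mk_additive (@std_dh_additive i' j).
Definition std_dv (i j j' : int) (h : j + 1 = j') : {additive M j -> M j'} := cdiff M h.

Fact std_dhK (i i' i'' j : int) (h : i + 1 = i') (h' : i' + 1 = i'') x :
  std_dh j h' (std_dh j h x) = 0.
Proof.
rewrite /= !raddfD (sgnz_raddf (act j)) actK /= !(sgnz_add1 _ h').
by rewrite sgnzK -opprD [sgnz i' _ + x]addrC subrr.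
Qed.

Fact std_dvK (i j j' j'' : int) (h : j + 1 = j') (h' : j' + 1 = j'') x :
  std_dv i h' (std_dv i h x) = 0.
Proof. exact: cdiffK. Qed.

Fact std_dhv (i i' j j' : int) (hi : i + 1 = i') (hj : j + 1 = j') x :
  std_dh j' hi (std_dv i hj x) = std_dv i' hj (std_dh j hi x).
Proof. by rewrite /= !raddfD sgnz_raddf act_diff. Qed.

Definition std_complex : cochain := Tot (DCochain std_dhK std_dvK std_dhv).

Definition first_quadrant m (x : std_complex m) :=
  forall u : diag m, di u < 0 -> dsum_fun x u = 0.

Lemma first_quadrantB m (x y : std_complex m) :
  first_quadrant x -> first_quadrant y -> first_quadrant (x - y).
Proof. by move=> x0 y0 u u0; rewrite dsum_funB x0 // y0 // subrr. Qed.

Lemma std_diffE m m' (h : m + 1 = m') (x : std_complex m) (u : diag m') :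
  dsum_fun (cdiff std_complex h x) u =
  dsum_fun x (diag_left h u) + sgnz (di u) (act (dj u) (dsum_fun x (diag_left h u)))
  + sgnz (di u) (cdiff M (subrK 1 (dj u)) (dsum_fun x (diag_down h u))).
Proof. by []. Qed.

Lemma std_diff_at m m' (h : m + 1 = m') (x : std_complex m) i j (e : i + j = m')
    i0 (h0 : i0 + 1 = i) (e0 : i0 + j = m) j0 (h1 : j0 + 1 = j) (e1 : i + j0 = m) :
  dsum_fun (cdiff std_complex h x) (Diag e) =
  dsum_fun x (Diag e0) + sgnz i (act j (dsum_fun x (Diag e0)))
  + sgnz i (cdiff M h1 (dsum_fun x (Diag e1))).
Proof. exact: tot_diff_at. Qed.
End StandardComplex.

(** * Direct sums, projective groups and free Z[C_2]-modules *)

Section DsumSingle.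
Variables (I : Type) (V : I -> zmodType).

Definition single_fun i (c : V i) j : V j :=
  if pselect (i = j) is left e then eq_rect i V c j e else 0.

Lemma single_fun_id i (c : V i) : single_fun c i = c.
Proof.
by rewrite /single_fun; case: pselect => // e; rewrite (Prop_irrelevance e erefl).
Qed.

Lemma single_fun_neq i (c : V i) j : i <> j -> single_fun c j = 0.
Proof. by rewrite /single_fun; case: pselect. Qed.

Fact single_finite i (c : V i) : finite_set [set j | single_fun c j <> 0].
Proof.
apply: (sub_finite_set _ (finite_set1 i)) => j /= nz.
by apply: contrapT => ji; apply: nz; apply: single_fun_neq => ij; apply: ji.
Qed.

Fact single_additive i : zmod_morphism (fun c : V i => mk_dsum (single_finite c)).
Proof.
move=> c c'; apply: dsumP => j; rewrite dsum_funB /= /single_fun.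
by case: pselect => [e|_]; [case: j / e | rewrite subrr].
Qed.

Definition dsum_single i : {additive V i -> dsum V} := mk_additive (@single_additive i).

Lemma dsum_singleE i (c : V i) : dsum_fun (dsum_single i c) i = c.
Proof. exact: single_fun_id. Qed.

Lemma dsum_single_neq i (c : V i) j : i <> j -> dsum_fun (dsum_single i c) j = 0.
Proof. exact: single_fun_neq. Qed.

End DsumSingle.
Arguments dsum_single {I} V {i} : simpl never.

Section DsumInd.
Variables (I : Type) (V : I -> zmodType).

Lemma dsum_fun_sum (J : Type) (r : seq J) (F : J -> dsum V) i :
  dsum_fun (\sum_(j <- r) F j) i = \sum_(j <- r) dsum_fun (F j) i.
Proof.
by elim: r => [|j r IH]; rewrite ?big_nil // !big_cons dsum_funD IH.
Qed.

(** Direct sums may be indexed by any type, hence the classical equality test on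
   the index type. *)
Lemma dsum_decomp (x : dsum V) : exists s : seq {classic I},
  x = \sum_(i <- s) dsum_single V (dsum_fun x i).
Proof.
have fin : finite_set ([set i | dsum_fun x i <> 0] : set {classic I}) := dsum_finite x.
exists (fset_set ([set i | dsum_fun x i <> 0] : set {classic I})).
apply: dsumP => j; rewrite dsum_fun_sum.
have [xj|xj] := pselect (dsum_fun x j = 0).
  rewrite big_seq big1 // => i; have [->|ij _] := pselect (i = j).
    by rewrite in_fset_set // inE /= xj.
  exact: dsum_single_neq.
rewrite (bigD1_seq (j : {classic I})) ?fset_uniq ?in_fset_set ?inE //.
rewrite dsum_singleE big1 => [|i /eqP ij]; last exact: dsum_single_neq.
by rewrite /= addr0.
Qed.

Section Lift.
Variables (X : zmodType) (phi : forall i, {additive V i -> X}).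

Definition dsum_lift_fun (x : dsum V) : X :=
  \sum_(i \in [set: {classic I}]) phi i (dsum_fun x i).

Lemma dsum_lift_fset (A : {fset {classic I}}) (x : dsum V) :
  (forall i, i \notin A -> dsum_fun x i = 0) ->
  dsum_lift_fun x = \sum_(i <- A) phi i (dsum_fun x i).
Proof. by move=> xA; apply: fsbigTE => i /xA ->; rewrite raddf0. Qed.

Definition dsum_supp (x : dsum V) : {fset {classic I}} :=
  fset_set ([set i | dsum_fun x i <> 0] : set {classic I}).

Lemma dsum_suppP (x : dsum V) (i : {classic I}) : i \notin dsum_supp x -> dsum_fun x i = 0.
Proof.
rewrite in_fset_set; last exact: (dsum_finite x).
by move=> /negP xi; apply: contrapT => nz; apply: xi; rewrite inE.
Qed.

Fact dsum_lift_additive : zmod_morphism dsum_lift_fun.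
Proof.
move=> x y; pose A := (dsum_supp x `|` dsum_supp y)%fset.
have xA i : i \notin A -> dsum_fun x i = 0.
  by rewrite inE negb_or => /andP[xi _]; apply: dsum_suppP.
have yA i : i \notin A -> dsum_fun y i = 0.
  by rewrite inE negb_or => /andP[_ yi]; apply: dsum_suppP.
rewrite !(dsum_lift_fset (A := A)) //.
  by rewrite -sumrB; apply: eq_bigr => i _; rewrite -raddfB.
by move=> i iA; rewrite dsum_funB xA ?yA ?subrr.
Qed.

Definition dsum_lift : {additive dsum V -> X} := mk_additive dsum_lift_additive.

Lemma dsum_lift_single i (c : V i) : dsum_lift (dsum_single V c) = phi i c.
Proof.
rewrite /= (dsum_lift_fset (A := [fset (i : {classic I})]%fset)).
  by rewrite big_seq_fset1 dsum_singleE.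
move=> j; rewrite inE => /eqP ij; apply: dsum_single_neq => e; exact: ij.
Qed.
End Lift.
End DsumInd.
Arguments dsum_lift : simpl never.

Definition projective (P : zmodType) := forall (U V : zmodType)
  (p : {additive U -> V}) (u : {additive P -> V}), (forall x, exists y, p y = u x) ->
  exists v : {additive P -> U}, forall x, p (v x) = u x.

Lemma mulz_additive (U : zmodType) (y : U) : zmod_morphism (fun k : int => y *~ k).
Proof. by move=> k k'; rewrite mulrzBr. Qed.

Lemma projective_int : projective int.
Proof.
move=> U V p u pu; have [y py] := pu 1.
exists (mk_additive (mulz_additive y)) => k /=.
by rewrite raddfMz py -raddfMz intz.
Qed.

Lemma projective_dsum (I : Type) (V : I -> zmodType) :
  (forall i, projective (V i)) -> projective (dsum V).
Proof.
move=> pV U X p u pu.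
have lift i : exists v : {additive V i -> U}, forall c, p (v c) = u (dsum_single V c).
  by apply: (pV i U X p (u \o dsum_single V (i:=i))) => c; apply: pu.
pose phi i := projT1 (cid (lift i)).
have phiE i c : p (phi i c) = u (dsum_single V c) by rewrite /phi; case: cid.
exists (dsum_lift phi) => x; have [s ->] := dsum_decomp x.
rewrite (raddf_sum (dsum_lift phi)) (raddf_sum p) (raddf_sum u); apply: eq_bigr => i _.
by rewrite -phiE -(dsum_lift_single phi).
Qed.

Lemma projective_retract (P Q : zmodType) (f : {additive P -> Q}) (g : {additive Q -> P}) :
  cancel f g -> projective Q -> projective P.
Proof.
move=> fK pQ U V p u pu; have [v ve] := pQ U V p (u \o g) (fun x => pu (g x)).
by exists (v \o f) => x; rewrite /= ve /= fK.
Qed.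

Lemma bij_additive (P Q : zmodType) (f : {additive P -> Q}) : bijective f ->
  exists2 g : {additive Q -> P}, cancel f g & cancel g f.
Proof.
case=> g fK gK; have gB : zmod_morphism g.
  by move=> x y; apply: (can_inj fK); rewrite raddfB !gK.
by exists (mk_additive gB).
Qed.

Lemma projective_prod (P Q : zmodType) :
  projective P -> projective Q -> projective (P * Q)%type.
Proof.
move=> pP pQ U V p u pu.
have iP : zmod_morphism (fun x : P => (x, 0) : P * Q).
  by move=> x y; apply/eqP; rewrite xpair_eqE /= subrr !eqxx.
have iQ : zmod_morphism (fun x : Q => (0, x) : P * Q).
  by move=> x y; apply/eqP; rewrite xpair_eqE /= subrr !eqxx.
have [v ve] := pP U V p (u \o mk_additive iP) (fun x => pu _).
have [w we] := pQ U V p (u \o mk_additive iQ) (fun x => pu _).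
exists ((v \o fst) \+ (w \o snd)) => -[x y] /=.
by rewrite raddfD ve we /= -raddfD; congr (u (_, _)); rewrite ?addr0 ?add0r.
Qed.

Section FreegLift.
Variables (K : choiceType) (U : zmodType) (phi : K -> U).
Fact freeg_lift_additive : zmod_morphism (fglift (M := zmodule U) phi : {freeg K} -> U).
Proof. exact: (@lift_is_additive int K (zmodule U)). Qed.
Definition freeg_lift : {additive {freeg K} -> U} := mk_additive freeg_lift_additive.
Lemma freeg_liftE k : freeg_lift << k >> = phi k.
Proof. by rewrite /= (liftU (M := zmodule U)) scale1r. Qed.
End FreegLift.
Arguments freeg_lift : simpl never.

Lemma freeg_term (K : choiceType) (c : int) (k : K) : << c *g k >> = << k >> *~ c :> {freeg K}.
Proof. by rewrite freegU_mulz intz. Qed.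

Lemma freeg_decomp (K : choiceType) (x : {freeg K}) :
  x = \sum_(k <- dom x) << k >> *~ coeff k x.
Proof. by rewrite -[LHS]freeg_sumE; apply: eq_bigr => k _; rewrite freeg_term. Qed.

Lemma freeg_ext (K : choiceType) (U : zmodType) (f g : {additive {freeg K} -> U}) :
  (forall k, f << k >> = g << k >>) -> f =1 g.
Proof.
move=> fg x; rewrite [x]freeg_decomp !raddf_sum; apply: eq_bigr => k _.
by rewrite !raddfMz fg.
Qed.

Lemma projective_freeg (K : choiceType) : projective {freeg K}.
Proof.
move=> U V p u pu.
have lift k : exists y, p y = u << k >> := pu _.
exists (freeg_lift (fun k => projT1 (cid (lift k)))).
apply: (freeg_ext (f := p \o freeg_lift _)) => k.
by rewrite -[LHS]/(p (freeg_lift _ << k >>)) freeg_liftE; case: cid.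
Qed.

Lemma projective_rV r : projective 'rV[int]_r.
Proof.
move=> U V p u pu.
have lift k : exists y, p y = u (delta_mx 0 k) := pu _.
pose y k : U := projT1 (cid (lift k)).
have vB : zmod_morphism (fun x : 'rV[int]_r => \sum_k y k *~ x 0 k).
  by move=> x x'; rewrite -sumrB; apply: eq_bigr => k _; rewrite !mxE mulrzBr.
exists (mk_additive vB) => x /=; rewrite [x in RHS]row_sum_delta !raddf_sum.
apply: eq_bigr => k _; rewrite raddfMz /y; case: cid => /= z ->.
rewrite -raddfMz; congr (u _).
by rewrite -[in RHS](intz (x 0 k)) scaler_int.
Qed.

Section FreeModule.
Variable M : c2module.
Hypothesis Mfree : c2free M.
Local Notation T := (c2act M).

(** The map pr keeps one of the two coordinates exchanged by T, so that pr and its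
   conjugate add up to the identity.  It plays the part of 1/2 in averaging
   arguments. *)
Lemma c2free_half : exists pr : {additive M -> M}, forall x, pr x + T (pr (T x)) = x.
Proof.
case: Mfree => B [f [/bij_additive[g fK gK] fT]].
have fstB : zmod_morphism (fun x : int * int => (x.1, 0) : int * int).
  by move=> x y; apply/eqP; rewrite xpair_eqE /= subrr !eqxx.
pose k := dsum_map (I := B) (V := fun=> (int * int)%type) (U := fun=> (int * int)%type)
  (@inj_id B) (fun=> mk_additive fstB).
exists (g \o k \o f) => x; apply: (can_inj fK).
apply: dsumP => b; rewrite raddfD.
rewrite -[LHS]/(dsum_fun (f (g (k (f x)))) b + dsum_fun (f (T (g (k (f (T x)))))) b).
rewrite fT !gK !dsum_mapE fT /=.
by case: (dsum_fun _ b) => u v; congr (_, _); rewrite ?addr0 ?add0r.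
Qed.

Lemma projective_c2free : projective M.
Proof.
case: Mfree => B [f [/bij_additive[g fK gK] fT]].
apply: (projective_retract fK); apply: projective_dsum => b.
by apply: projective_prod; apply: projective_int.
Qed.

(** An additive lift is made equivariant by averaging with [c2free_half]. *)
Lemma c2free_lift (N X : c2module) (p : {additive N -> X}) (u : {additive M -> X}) :
  (forall y, p (c2act N y) = c2act X (p y)) ->
  (forall x, u (T x) = c2act X (u x)) ->
  (forall x, exists y, p y = u x) ->
  exists v : {additive M -> N}, (forall x, p (v x) = u x) /\
    forall x, v (T x) = c2act N (v x).
Proof.
move=> pT uT pu; have [l le] := projective_c2free pu.
have [pr prE] := c2free_half.
exists ((l \o pr) \+ (c2act N \o l \o pr \o T)); split=> x /=.
  by rewrite raddfD /= pT !le -uT -raddfD prE.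
by rewrite c2actK raddfD c2actK addrC.
Qed.
End FreeModule.

(** * Linear identities in abelian groups *)

(** A sum of elements of an abelian group and their opposites is determined by
   the integral coefficient of each element, so an identity between two such sums
   reduces to a comparison of coefficients. *)
Inductive zexpr := ZVar of nat | ZZero | ZAdd of zexpr & zexpr | ZOpp of zexpr.

Fixpoint zeval (V : zmodType) (env : seq V) (e : zexpr) : V :=
  match e with
  | ZVar i => nth 0 env i
  | ZZero => 0
  | ZAdd a b => zeval env a + zeval env b
  | ZOpp a => - zeval env a
  end.

Fixpoint zcoef (e : zexpr) (i : nat) : int :=
  match e with
  | ZVar j => (j == i)%:Z
  | ZZero => 0
  | ZAdd a b => zcoef a i + zcoef b i
  | ZOpp a => - zcoef a i
  end.

Lemma zevalE (V : zmodType) (env : seq V) e :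
  zeval env e = \sum_(i < size env) env`_i *~ zcoef e i.
Proof.
elim: e => [j||a IHa b IHb|a IHa] /=.
- have [js|sj] := ltnP j (size env).
    rewrite (bigD1 (Ordinal js)) //= eqxx mulr1z big1 ?addr0 // => i.
    by rewrite -val_eqE eq_sym /= => /negPf ->; rewrite mulr0z.
  rewrite nth_default // big1 // => i _.
  by rewrite (_ : (j == i) = false) ?mulr0z //; apply/eqP; have := ltn_ord i; lia.
- by rewrite big1 // => i _; rewrite mulr0z.
- by rewrite IHa IHb -big_split; apply: eq_bigr => i _; rewrite mulrzDr.
- by rewrite IHa -sumrN; apply: eq_bigr => i _; rewrite mulrNz.
Qed.

Lemma zeval_eq (V : zmodType) (env : seq V) e f :
  all (fun i => zcoef e i == zcoef f i) (iota 0 (size env)) -> zeval env e = zeval env f.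
Proof.
move=> /allP ef; rewrite !zevalE; apply: eq_bigr => i _; congr (_ *~ _).
by apply/eqP; apply: ef; rewrite mem_iota add0n /=.
Qed.

Ltac zmod_index x env :=
  lazymatch env with
  | ?y :: ?r => match constr:(Set) with
                | _ => let _ := constr:(erefl x : x = y) in constr:(0%N)
                | _ => let n := zmod_index x r in constr:(n.+1)
                end
  end.
Ltac zmod_mem x env :=
  lazymatch env with
  | ?y :: ?r => match constr:(Set) with
                | _ => let _ := constr:(erefl x : x = y) in constr:(true)
                | _ => zmod_mem x r
                end
  | _ => constr:(false)
  end.
Ltac zmod_atoms V t env :=
  lazymatch t with
  | Algebra.add ?a ?b => let env := zmod_atoms V a env in zmod_atoms V b env
  | Algebra.opp ?a => zmod_atoms V a env
  | Algebra.zero => env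
  | _ => match zmod_mem t env with
         | true => env
         | false => constr:(@cons (Algebra.Zmodule.sort V) t env)
         end
  end.
Ltac zmod_reify t env :=
  lazymatch t with
  | Algebra.add ?a ?b =>
      let a := zmod_reify a env in let b := zmod_reify b env in constr:(ZAdd a b)
  | Algebra.opp ?a => let a := zmod_reify a env in constr:(ZOpp a)
  | Algebra.zero => constr:(ZZero)
  | _ => let i := zmod_index t env in constr:(ZVar i)
  end.
Ltac zmod V :=
  lazymatch goal with
  | |- ?a = ?b =>
      let env := zmod_atoms V a (@nil (Algebra.Zmodule.sort V)) in
      let env := zmod_atoms V b env in
      let ea := zmod_reify a env in
      let eb := zmod_reify b env in
      exact (@zeval_eq V env ea eb isT)
  end.

(** * Functoriality and homotopies for the periodic resolution *)

Fact diag_rightE (m m' : int) (h : m + 1 = m') (u : diag m) : di u + 1 + dj u = m'.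
Proof. by rewrite addrAC diagE. Qed.
Definition diag_right (m m' : int) (h : m + 1 = m') (u : diag m) : diag m' :=
  Diag (diag_rightE h u).
Lemma diag_right_inj (m m' : int) (h : m + 1 = m') : injective (diag_right h).
Proof.
move=> u v e; apply: diag_inj; last exact: (congr1 (@dj m') e).
by apply: (@addIr _ 1); apply: (congr1 (@di m') e).
Qed.

Fact diag_upE (m m' : int) (h : m + 1 = m') (u : diag m) : di u + (dj u + 1) = m'.
Proof. by rewrite addrA diagE. Qed.
Definition diag_up (m m' : int) (h : m + 1 = m') (u : diag m) : diag m' := Diag (diag_upE h u).
Lemma diag_up_inj (m m' : int) (h : m + 1 = m') : injective (diag_up h).
Proof.
move=> u v e; apply: diag_inj; first exact: (congr1 (@di m') e).
by apply: (@addIr _ 1); apply: (congr1 (@dj m') e).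
Qed.

Section StdMap.
Variables (M N : c2cochain) (a : forall j, {additive M j -> N j}).
Hypothesis aT : forall j x, a j (act M j x) = act N j (a j x).
Hypothesis aD : forall p q (h : p + 1 = q) x, cdiff N h (a p x) = a q (cdiff M h x).

Definition std_map m : {additive std_complex M m -> std_complex N m} :=
  @dsum_map (diag m) (diag m) (fun u => M (dj u)) (fun u => N (dj u)) id (@inj_id _)
    (fun u => a (dj u)).

Lemma std_mapE m (x : std_complex M m) u : dsum_fun (std_map m x) u = a (dj u) (dsum_fun x u).
Proof. by []. Qed.

Lemma std_map_chain : chain_map (@first_quadrant M) (@first_quadrant N) std_map.
Proof.
split=> [m x qx u u0|m m' h x _]; first by rewrite std_mapE qx ?raddf0.
apply: dsumP => u; rewrite std_mapE !std_diffE !std_mapE !raddfD.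
by rewrite !(sgnz_raddf (a (dj u))) aT aD.
Qed.
End StdMap.

(** Let h0 be a homotopy between the equivariant chain maps a and b.  If h0 is not
   equivariant, applying it columnwise fails to be a homotopy of [std_complex] by
   terms in T h0 T - h0.  When T h0 T - h0 is in turn the coboundary of some
   h1 with T h1 T = - h1, feeding h1 the component of the preceding column cancels
   these terms: the homotopy is
   x |-> ((-1)^i (h0 x_i + h1 T x_(i-1)))_i. *)
Section StdHomotopy.
Variables (M N : c2cochain) (a b : forall j, {additive M j -> N j}).
Variable h0 : forall p q : int, q + 1 = p -> {additive M p -> N q}.
Variable h1 : forall p q : int, q + 2 = p -> {additive M p -> N q}.
Hypothesis h0E : forall (p q r : int) (hq : q + 1 = p) (hr : p + 1 = r) (x : M p),
  cdiff N hq (h0 hq x) + h0 hr (cdiff M hr x) = a p x - b p x.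
Hypothesis h1E : forall (p r q q' : int) (hr : p + 1 = r) (h : q + 1 = q') (h' : q' + 1 = p)
    (hp : q + 2 = p) (hr' : q' + 2 = r) (x : M p),
  cdiff N h (h1 hp x) - h1 hr' (cdiff M hr x) = act N q' (h0 h' (act M p x)) - h0 h' x.
Hypothesis h1T : forall (p q : int) (hp : q + 2 = p) (x : M p),
  act N q (h1 hp (act M p x)) = - h1 hp x.

Section Def.
Variables (m m' : int) (h : m + 1 = m').

Fact diag_up2E (u : diag m) : di u - 1 + (dj u + 2) = m'.
Proof. by rewrite addrACA diagE. Qed.
Definition diag_up2 (u : diag m) : diag m' := Diag (diag_up2E u).
Lemma diag_up2_inj : injective diag_up2.
Proof.
move=> u v e; apply: diag_inj; last by apply: (@addIr _ 2); apply: (congr1 (@dj m') e).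
by apply: (@subIr _ 1); apply: (congr1 (@di m') e).
Qed.

Definition std_h0 : {additive std_complex M m' -> std_complex N m} :=
  @dsum_map (diag m') (diag m) (fun u => M (dj u)) (fun u => N (dj u)) (diag_up h) (@diag_up_inj _ _ h)
    (fun u => @sgnz (N (dj u)) (di u) \o h0 (erefl (dj u + 1))).
Definition std_h1 : {additive std_complex M m' -> std_complex N m} :=
  @dsum_map (diag m') (diag m) (fun u => M (dj u)) (fun u => N (dj u)) diag_up2 diag_up2_inj
    (fun u => @sgnz (N (dj u)) (di u) \o h1 (erefl (dj u + 2)) \o act M _).
Definition std_h : {additive std_complex M m' -> std_complex N m} := std_h0 \+ std_h1.

Lemma std_hE (x : std_complex M m') (u : diag m) j1 (e1 : dj u + 1 = j1) (d1 : di u + j1 = m')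
   i0 (e0 : i0 + 1 = di u) j2 (e2 : dj u + 2 = j2) (d2 : i0 + j2 = m') :
  dsum_fun (std_h x) u = sgnz (di u) (h0 e1 (dsum_fun x (Diag d1)) +
                          h1 e2 (act M _ (dsum_fun x (Diag d2)))).
Proof.
have E0 : di u - 1 = i0 by rewrite -e0 addrK.
case: j1 / e1 d1 => d1; case: j2 / e2 d2 => d2; case: i0 / E0 e0 d2 => _ d2.
rewrite (Prop_irrelevance d1 (diag_upE h u)) (Prop_irrelevance d2 (diag_up2E u)).
by rewrite sgnz_add.
Qed.
End Def.

Lemma std_h_quadrant m m' (h : m + 1 = m') x : first_quadrant x -> first_quadrant (std_h h x).
Proof.
move=> qx u u0; have d1 := diag_upE h u; have d2 := diag_up2E h u.
rewrite (std_hE h x erefl d1 (subrK 1 _) erefl d2) !qx ?raddf0 ?addr0 ?raddf0 //.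
by rewrite /= subr_lt0 (lt_trans u0).
Qed.

Lemma std_homotopy m (x : std_complex M m) :
  cdiff (std_complex M) (erefl (m + 1)) x = 0 ->
  cdiff (std_complex N) (subrK 1 m) (std_h (subrK 1 m) x) = std_map a m x - std_map b m x.
Proof.
move=> dx; apply: dsumP => -[i j e].
have e0 : i - 1 + j = m - 1 by rewrite addrAC e.
have e1 : i + (j - 1) = m - 1 by rewrite addrA e.
rewrite (std_diff_at _ _ _ (subrK 1 i) e0 (subrK 1 j) e1).
have f0 : (i - 1) + (j + 1) = m by rewrite addrACA addNr addr0.
have f1 : (i - 1 - 1) + (j + 2) = m by rewrite -e; ring.
have j1 : j - 1 + 2 = j + 1 by ring.
rewrite (@std_hE _ _ (subrK 1 m) x (Diag e0) (j + 1) erefl f0 _ (subrK 1 (i - 1)) _ erefl f1).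
rewrite (@std_hE _ _ (subrK 1 m) x (Diag e1) j (subrK 1 j) e _ (subrK 1 i) _ j1 f0) /=.
set u := dsum_fun x (Diag f1); set y := dsum_fun x (Diag f0); set z := dsum_fun x (Diag e).
have g0 : i + (j + 1) = m + 1 by rewrite addrA e.
have := std_diff_at (erefl (m + 1)) x g0 (subrK 1 i) f0 (erefl (j + 1)) e.
rewrite dx dsum_fun0 -/y -/z => dz.
have g1 : i - 1 + (j + 2) = m + 1 by rewrite -e; ring.
have j2 : j + 1 + 1 = j + 2 by ring.
have := std_diff_at (erefl (m + 1)) x g1 (subrK 1 (i - 1)) f1 j2 f0.
rewrite dx dsum_fun0 -/y -/u => dy.
have s1 : sgnz (i - 1) y = - sgnz i y by rewrite sgnz_sub1.
have dz' : cdiff M (erefl (j + 1)) z = - sgnz i y - act M _ y.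
  apply: (can_inj (@sgnzK _ i)); rewrite raddfB raddfN /= sgnzK.
  by apply/eqP; rewrite -subr_eq0 dz; apply/eqP; zmod (M (j + 1)).
have dy' : cdiff M j2 y = sgnz i u - act M _ u.
  apply: (can_inj (@sgnzK _ (i - 1))); rewrite raddfB /= !sgnz_sub1 sgnzK.
  apply/eqP; rewrite -subr_eq0 dy !sgnz_sub1; apply/eqP; zmod (M (j + 2)).
rewrite !sgnz_sub1 !(raddfN (act N _), sgnz_raddf (act N _)) /= !raddfN /= !sgnzK.
have E0 := h0E (subrK 1 j) (erefl (j + 1)) z.
rewrite dz' raddfB raddfN (sgnz_raddf (h0 _)) in E0.
have E1 := h1E j2 (subrK 1 j) (erefl (j + 1)) j1 (erefl (j + 2)) (act M _ y).
rewrite act_diff dy' raddfB (sgnz_raddf (act M _)) !actK raddfB (sgnz_raddf (h1 _)) in E1.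
rewrite (sgnz_raddf (cdiff N _)) sgnzK !(raddfD (act N _)) h1T (raddfD (cdiff N _)).
rewrite /= in E0 E1; rewrite -[RHS]/(a j z - b j z) -E0.
move/eqP: E1; rewrite subr_eq => /eqP ->.
rewrite sgnz_add; zmod (N j).
Qed.
End StdHomotopy.

(** * Comparison of a free resolution with the periodic one *)

Lemma dependent_choice (T : nat -> Type) (R : forall n, T n -> T n.+1 -> Prop) (x0 : T 0%N) :
  (forall n (x : T n), exists y, R n x y) ->
  exists f : forall n, T n, f 0%N = x0 /\ forall n, R n (f n) (f n.+1).
Proof.
move=> tot; pose f := fix f n : T n := if n is m.+1 then projT1 (cid (tot m (f m))) else x0.
by exists f; split=> // n; rewrite /=; case: cid.
Qed.

Lemma natS (n : nat) : n%:Z + 1 = n.+1%:Z.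
Proof. by rewrite -addn1 PoszD. Qed.

(** Statements about consecutive degrees reduce to nonnegative degrees, where the
   data are built by recursion on natural numbers. *)
Lemma int_succ_ind (P : forall k i : int, k + 1 = i -> Prop) :
  (forall n, P n%:Z n.+1%:Z (natS n)) -> (forall (k i : int) (h : k + 1 = i), k < 0 -> P k i h) ->
  forall (k i : int) (h : k + 1 = i), P k i h.
Proof.
move=> Pn Pneg [n|n] i h; last exact: Pneg.
have e : n.+1%:Z = i by rewrite -natS.
by case: i / e h => h; rewrite (Prop_irrelevance h (natS n)).
Qed.

Section Resolution.
Variables (W : c2chain) (hW : c2free_resolution W).
Local Notation T := (c2act _).

Lemma res_neg i (x y : W i) : i < 0 -> x = y.
Proof. by case: hW => W0 _ _ _ i0; rewrite (W0 _ i0 x) (W0 _ i0 y). Qed.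

Lemma res_exact (k i j : int) (hk : k + 1 = i) (hj : i + 1 = j) (x : W i) :
  0 < i -> bd W hk x = 0 -> exists y : W j, bd W hj y = x.
Proof.
case: hW => _ _ ex _ i0; case: j / hj; have e : i - 1 = k by rewrite -hk addrK.
case: k / e hk => hk; rewrite (Prop_irrelevance hk (subrK 1 i)); exact: ex.
Qed.

Lemma res_aug : exists aug : {additive W 0 -> int},
  [/\ exists x, aug x = 1, forall x, aug (T x) = aug x,
      forall x, aug x = 0 -> exists y : W 1, bd W (natS 0) y = x &
      forall y : W 1, aug (bd W (natS 0) y) = 0].
Proof.
case: hW => _ _ _ [aug [sur inv ex]]; exists aug; split=> // [x /ex[] | y].
  rewrite (_ : natS 0 = erefl (0 + 1)) => [y <-|]; first by exists y.
  exact: Prop_irrelevance.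
by apply/ex; exists y; congr (bd W _ y); apply: Prop_irrelevance.
Qed.

Lemma act_sgn (N : c2module) i (x : N) : T (sgnz i x) = sgnz i (T x).
Proof. exact: sgnz_raddf. Qed.
Lemma bd_sgn k i (h : k + 1 = i) e (x : W i) : bd W h (sgnz e x) = sgnz e (bd W h x).
Proof. exact: sgnz_raddf. Qed.

Lemma one_sgnK (N : c2module) i j (x : N) : i + 1 = j ->
  (x + sgnz i (T x)) + sgnz j (T (x + sgnz i (T x))) = 0.
Proof.
move=> h; rewrite raddfD act_sgn c2actK !(sgnz_add1 _ h) raddfD /= sgnzK opprD.
by rewrite -opprD [sgnz i _ + x]addrC subrr.
Qed.

(** The image w_i of the generator e_i under a chain map from the periodic
   resolution to W, built by lifting cycles. *)
Lemma res_basis : exists w : forall i, W i,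
  (forall (k i : int) (h : k + 1 = i), bd W h (w i) = w k + sgnz i (T (w k))) /\
  exists aug : {additive W 0 -> int},
    [/\ aug (w 0) = 1, forall x, aug (T x) = aug x,
      forall x, aug x = 0 -> exists y : W 1, bd W (natS 0) y = x &
      forall y : W 1, aug (bd W (natS 0) y) = 0].
Proof.
have [aug [[x0 x01] augT augE augB]] := res_aug.
pose good n (x : W n%:Z) := exists y, bd W (natS n) y = x + sgnz n.+1%:Z (T x).
have good0 : @good 0%N x0.
  by apply: augE; rewrite /sgnz expr1z mulrN1z raddfB augT subrr.
pose R n (x : {x | good n x}) (y : {y | good n.+1 y}) :=
  bd W (natS n) (sval y) = sval x + sgnz n.+1%:Z (T (sval x)).
have [|f [f0 fR]] := @dependent_choice (fun n => {x | good n x}) R (exist _ x0 good0).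
  move=> n [x gx]; have [y yx] := gx.
  suff gy : good n.+1 y by exists (exist _ y gy).
  apply: (res_exact (hk := natS n)) => //.
  rewrite raddfD bd_sgn bd_act yx.
  by apply: one_sgnK; rewrite natS.
exists (fun i => match i with Posz n => sval (f n) | Negz n => 0 end); split.
  by apply: int_succ_ind => [n|k i h k0]; [apply: fR | apply: res_neg].
by exists aug; split => //; rewrite -[LHS]/(aug (sval (f 0%N))) f0.
Qed.

(** The coefficient g_i of e_i in an equivariant chain map from W to the periodic
   resolution is an integral functional; the coefficient of T e_i is then
   x |-> g_i (T x).  It is built from [c2free_half], which solves
   g_(i-1) (bd x) = g_i x + (-1)^i g_i (T x) for g_i as soon as the left hand side
   has the right symmetry. *)
Lemma res_functional (aug : {additive W 0 -> int}) :
  (forall x, aug (T x) = aug x) -> (forall y : W 1, aug (bd W (natS 0) y) = 0) ->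
  exists g : forall i, {additive W i -> int},
  (forall (k i : int) (h : k + 1 = i) x, 0 <= k -> g k (bd W h x) = g i x + sgnz i (g i (T x))) /\
  forall x, g 0 x + g 0 (T x) = aug x.
Proof.
move=> augT augB; have Wfree i : c2free (W i) by case: hW.
have half i := c2free_half (Wfree i).
have [pr0 pr0E] := half 0; pose g0 : {additive W 0 -> int} := aug \o pr0.
have g0E x : g0 x + g0 (T x) = aug x.
  by rewrite -[in RHS](pr0E x) raddfD augT.
pose good n (g : {additive W n%:Z -> int}) := forall z : W n.+1%:Z,
  g (T (bd W (natS n) z)) = sgnz n.+1%:Z (g (bd W (natS n) z)).
have good0 : @good 0%N g0.
  move=> z; rewrite /sgnz expr1z mulrN1z; apply/eqP.
  by rewrite -addr_eq0 addrC g0E augB.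
pose R n (g : {g | good n g}) (g' : {g' | good n.+1 g'}) := forall x : W n.+1%:Z,
  sval g (bd W (natS n) x) = sval g' x + sgnz n.+1%:Z (sval g' (T x)).
have [|f [f0 fR]] := @dependent_choice (fun n => {g | good n g}) R (exist _ g0 good0).
  move=> n [g gg]; have [pr prE] := half n.+1%:Z.
  pose g' : {additive W n.+1%:Z -> int} := g \o bd W (natS n) \o pr.
  have g'E x : g (bd W (natS n) x) = g' x + sgnz n.+1%:Z (g' (T x)).
    by rewrite -[in LHS](prE x) !raddfD bd_act gg.
  suff gg' : good n.+1 g' by exists (exist _ g' gg').
  move=> z; have := g'E (bd W (natS n.+1) z); rewrite bdK raddf0.
  move/esym/eqP; rewrite addrC addr_eq0 (sgnz_add1 _ (natS n.+1)) => /eqP e.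
  by rewrite -[LHS](sgnzK n.+1%:Z) e raddfN.
exists (fun i => match i with Posz n => sval (f n) | Negz n => \0 end); split.
  by apply: int_succ_ind => [n|k i h k0] x; [move=> _; apply: fR | rewrite leNgt k0].
by move=> x; rewrite -(g0E x) -[LHS]/(sval (f 0%N) x + sval (f 0%N) (T x)) f0.
Qed.

Section Comparison.
Variables (w : forall i, W i) (g : forall i, {additive W i -> int}).
Variable aug : {additive W 0 -> int}.
Hypothesis wE : forall (k i : int) (h : k + 1 = i), bd W h (w i) = w k + sgnz i (T (w k)).
Hypothesis gE : forall (k i : int) (h : k + 1 = i) x,
  0 <= k -> g k (bd W h x) = g i x + sgnz i (g i (T x)).
Hypothesis g0E : forall x, g 0 x + g 0 (T x) = aug x.
Hypothesis augw : aug (w 0) = 1.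
Hypothesis augT : forall x, aug (T x) = aug x.
Hypothesis augE : forall x, aug x = 0 -> exists y : W 1, bd W (natS 0) y = x.

(** The composite of W -> periodic resolution -> W. *)
Definition retr_fun i (x : W i) := w i *~ g i x + T (w i) *~ g i (T x).
Fact retr_additive i : zmod_morphism (@retr_fun i).
Proof. by move=> x y; rewrite /retr_fun !raddfB /= opprD addrACA. Qed.
Definition retr i : {additive W i -> W i} := mk_additive (@retr_additive i).

Lemma retr_act i x : retr i (T x) = T (retr i x).
Proof. by rewrite /= /retr_fun raddfD !raddfMz !c2actK addrC. Qed.

Lemma sgnz_mulz (V : zmodType) i (x : V) k : sgnz i x *~ k = x *~ sgnz i k.
Proof.
by rewrite /sgnz -mulrzA mulrzz [_ * k]mulrC.
Qed.

Lemma retr_bd k i (h : k + 1 = i) x : 0 <= k -> bd W h (retr i x) = retr k (bd W h x).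
Proof.
move=> k0; rewrite /= /retr_fun raddfD !raddfMz bd_act wE -!bd_act !gE // c2actK.
rewrite raddfD act_sgn c2actK !mulrzDl !mulrzDr !sgnz_mulz.
by rewrite addrACA [RHS]addrACA; congr (_ + _); apply: addrC.
Qed.

(** Both [retr] and the identity cover the identity of Z, hence they are
   equivariantly homotopic. *)
Lemma res_homotopy : exists s : forall (i j : int) (h : i + 1 = j), {additive W i -> W j},
  (forall (i j : int) (h : i + 1 = j) x, s i j h (T x) = T (s i j h x)) /\
  forall (k i j : int) (h : k + 1 = i) (h' : i + 1 = j) x,
    bd W h' (s i j h' x) + s k i h (bd W h x) = retr i x - x.
Proof.
have Wfree i : c2free (W i) by case: hW.
pose good n (s : {additive W n%:Z -> W n.+1%:Z}) := (forall x, s (T x) = T (s x)) /\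
  forall x, (forall k (h : k + 1 = n%:Z), bd W h x = 0) -> bd W (natS n) (s x) = retr n%:Z x - x.
have [s0 [s0E s0T]] : exists s0 : {additive W 0 -> W 1},
    (forall x, bd W (natS 0) (s0 x) = (retr 0 \- idfun) x) /\ forall x, s0 (T x) = T (s0 x).
  apply: c2free_lift => // [y|x|x]; first exact: bd_act.
    by rewrite /= -[retr_fun _]/(retr 0 _) retr_act raddfB.
  apply: augE; rewrite /= /retr_fun raddfB raddfD !raddfMz augT augw -raddfD g0E.
  by rewrite /= intz subrr.
have good0 : good 0%N s0 by split=> // x _; rewrite s0E.
pose R n (s : {s | good n s}) (s' : {s' | good n.+1 s'}) := forall x : W n.+1%:Z,
  bd W (natS n.+1) (sval s' x) + sval s (bd W (natS n) x) = retr n.+1%:Z x - x.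
have [|f [f0 fR]] := @dependent_choice (fun n => {s | good n s}) R (exist _ s0 good0).
  move=> n [s [sT sE]].
  have [s' [s'E s'T]] : exists s' : {additive W n.+1%:Z -> W n.+2%:Z},
    (forall x, bd W (natS n.+1) (s' x) = ((retr n.+1%:Z \- idfun) \- (s \o bd W (natS n))) x) /\
    forall x, s' (T x) = T (s' x).
    apply: c2free_lift => // [y|x|x]; first exact: bd_act.
      rewrite -[LHS]/(retr _ (T x) - T x - s (bd W (natS n) (T x))).
      by rewrite -[RHS]/(T (retr _ x - x - s (bd W (natS n) x))) retr_act bd_act sT !raddfB.
    apply: (res_exact (hk := natS n)) => //.
    rewrite -[X in bd W _ X]/(retr _ x - x - s (bd W (natS n) x)) !raddfB retr_bd //.
    rewrite sE ?subrr //.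
    by move=> k h; rewrite bdK.
  have gs' : good n.+1 s'.
    by split=> // x xc; rewrite s'E /= xc raddf0 subr0.
  by exists (exist _ s' gs') => x; rewrite /= s'E /= subrK.
pose S i : forall (j : int) (h : i + 1 = j), {additive W i -> W j} :=
  match i with
  | Posz n => fun j h => eq_rect _ (fun j => {additive W n%:Z -> W j}) (sval (f n)) j
                           (etrans (esym (natS n)) h)
  | Negz n => fun j h => \0
  end.
have SE n h : S n%:Z n.+1%:Z h = sval (f n).
  by rewrite /S; rewrite (Prop_irrelevance (etrans _ _) erefl).
exists S; split.
  apply: int_succ_ind => [n x | k i h k0 x]; last by rewrite !(res_neg (T x) 0, res_neg x 0, raddf0).
  by rewrite SE; case: (f n) => s [].
move=> k i j h h' x; move: i j h' k h x; apply: int_succ_ind => [[|n] k h x|i j h' i0 k h x].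
- rewrite SE f0 /= s0E; have k0 : k < 0 by lia.
  by rewrite (res_neg (bd W h x) 0 k0) raddf0 addr0.
- have e : n%:Z = k by lia.
  by case: k / e h => h; rewrite (Prop_irrelevance h (natS n)) !SE fR.
- by rewrite (res_neg x 0 i0) !raddf0 addr0.
Qed.

(** The other composite is an endomorphism of the periodic resolution, multiplying
   e_i by g_i (w_i) + g_i (T w_i) T.  It is homotopic to the identity through
   e_i |-> kap_i e_(i+1); the recursion is the coefficient of e_i in the
   homotopy equation. *)
Definition kap_nat := fix kap n : int :=
  if n is n'.+1 then g n (w n) - 1 - kap n' else g 0 (w 0) - 1.
Definition kap (i : int) : int := if i is Posz n then kap_nat n else 0.

Lemma kap_neg i : i < 0 -> kap i = 0.
Proof. by case: i. Qed.

Lemma kapE k i : k + 1 = i -> 0 <= i ->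
  g i (w i) - 1 = kap k + kap i /\ g i (T (w i)) = sgnz i (kap k - kap i).
Proof.
move=> h; move: k i h; apply: int_succ_ind => [n _|k i h k0 i0]; last first.
  have i00 : 0 = i by lia.
  case: i / i00 h i0 => h _; rewrite kap_neg // add0r sub0r /=; split=> //.
  by rewrite /sgnz expr0z mulr1z opprB -augw -g0E [X in _ = X - _]addrC addrK.
split; first by rewrite /= [RHS]addrC subrK.
have rec n' : g n'.+1%:Z (w n'.+1%:Z) + sgnz n'.+1%:Z (g n'.+1%:Z (T (w n'.+1%:Z))) =
    g n'%:Z (w n'%:Z) + sgnz n'.+1%:Z (g n'%:Z (T (w n'%:Z))).
  by rewrite -(gE (natS n')) // wE raddfD (sgnz_raddf (g n')).
have IH : sgnz n%:Z (g n%:Z (T (w n%:Z))) = g n%:Z (w n%:Z) - 1 - kap n%:Z - kap n%:Z.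
  elim: n => [|n IHn].
    rewrite /sgnz expr0z mulr1z /=.
    by rewrite subrr sub0r opprB -augw -g0E [X in _ = X - _]addrC addrK.
  have := rec n; rewrite [X in _ = _ + X](sgnz_add1 _ (natS n)) IHn /= => e.
  apply: (addrI (g n.+1%:Z (w n.+1%:Z))); rewrite e; ring.
apply: (can_inj (@sgnzK int n.+1%:Z)); rewrite sgnzK.
have := rec n; rewrite [X in _ = _ + X](sgnz_add1 _ (natS n)) IH => e.
apply: (addrI (g n.+1%:Z (w n.+1%:Z))); rewrite e /=; ring.
Qed.
End Comparison.
End Resolution.

(** * Independence of the resolution *)

Section Evaluation.
Variables (W : c2chain) (hW : c2free_resolution W) (M : c2cochain).
Local Notation X := (Tot (hom_dcochain W M)).
Local Notation Y := (std_complex M).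
Local Notation T := (c2act _).
Local Notation H i j := (homC2 (W i) (c2cochain_mod M j)).

Lemma hom_funD i j (f : H i j) x y : hom_fun f (x + y) = hom_fun f x + hom_fun f y.
Proof. exact: (raddfD (mk_additive (hom_linear f).1)). Qed.
Lemma hom_fun_sgn i j (f : H i j) e x : hom_fun f (sgnz e x) = sgnz e (hom_fun f x).
Proof. exact: (sgnz_raddf (mk_additive (hom_linear f).1)). Qed.
Lemma hom_fun_mulz i j (f : H i j) x k : hom_fun f (x *~ k) = hom_fun f x *~ k.
Proof. exact: (raddfMz (mk_additive (hom_linear f).1)). Qed.

Lemma hom_sgnz i j (f : H i j) e x : hom_fun (sgnz e f) x = sgnz e (hom_fun f x).
Proof.
have evB : zmod_morphism (fun f : H i j => hom_fun f x) by [].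
exact: (sgnz_raddf (mk_additive evB)).
Qed.

Section Eval.
Variable w : forall i, W i.
Hypothesis wE : forall (k i : int) (h : k + 1 = i), bd W h (w i) = w k + sgnz i (T (w k)).

Fact ev_additive i j : zmod_morphism (fun f : H i j => hom_fun f (w i) : M j).
Proof. by move=> f f'; rewrite hom_funB. Qed.

Definition ev m : {additive X m -> Y m} :=
  @dsum_map (diag m) (diag m) (fun u => H (di u) (dj u)) (fun u => M (dj u)) id (@inj_id _)
    (fun u => mk_additive (@ev_additive (di u) (dj u))).

Lemma evE m (f : X m) u : dsum_fun (ev m f) u = hom_fun (dsum_fun f u) (w (di u)).
Proof. by []. Qed.

(** Evaluation at the w_i lands in the first quadrant because W vanishes in
   negative degrees. *)
Lemma ev_chain : chain_map (fun m (_ : X m) => True) (@first_quadrant M) ev.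
Proof.
split=> [m f _ u u0|m m' h f _].
  by rewrite evE (res_neg hW (w (di u)) 0 u0) hom_fun_0r.
apply: dsumP => u; rewrite evE std_diffE !evE.
rewrite -[RHS]/(hom_fun (dsum_fun f (diag_left h u)) (bd W (subrK 1 (di u)) (w (di u))) +
  hom_fun (sgnz (di u) (@postcomp W M (di u) _ _ (subrK 1 (dj u)) (dsum_fun f (diag_down h u)))) (w (di u))).
rewrite wE hom_funD hom_fun_sgn (hom_linear _).2; congr (_ + _).
by rewrite hom_sgnz.
Qed.
End Eval.

Section Coeval.
Variable g : forall i, {additive W i -> int}.
Hypothesis gE : forall (k i : int) (h : k + 1 = i) x,
  0 <= k -> g k (bd W h x) = g i x + sgnz i (g i (T x)).

(** Composition with W -> periodic resolution, for the cochain e_i |-> x. *)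
Definition coev_fun i j (x : M j) (v : W i) : M j := x *~ g i v + act M j x *~ g i (T v).

Lemma coev_sgn i j e (x : M j) (v : W i) : coev_fun (sgnz e x) v = sgnz e (coev_fun x v).
Proof.
rewrite /coev_fun (sgnz_raddf (act M j)) /sgnz mulrzDl.
by congr (_ + _); rewrite mulrzAC.
Qed.

Lemma coevD i j (x y : M j) (v : W i) : coev_fun (x + y) v = coev_fun x v + coev_fun y v.
Proof. by rewrite /coev_fun raddfD !mulrzDl addrACA. Qed.

Lemma coev_diff i j j' (h : j + 1 = j') (x : M j) (v : W i) :
  cdiff M h (coev_fun x v) = coev_fun (cdiff M h x) v.
Proof. by rewrite /coev_fun raddfD !raddfMz act_diff. Qed.

Fact coev_linear i j (x : M j) : @c2linear (W i) (c2cochain_mod M j) (@coev_fun i j x).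
Proof.
split=> [v v'|v]; first by rewrite /coev_fun !raddfB /= opprD addrACA.
rewrite /coev_fun /= raddfD !raddfMz c2actK addrC.
by rewrite -[c2cochain_act M j (act M j x)]/(act M j (act M j x)) actK.
Qed.

Fact coev_additive i j : zmod_morphism (fun x : M j => mk_hom (@coev_linear i j x)).
Proof.
move=> x y; apply: homP => v; rewrite hom_funB /= /coev_fun raddfB !mulrzBl.
by rewrite opprD addrACA.
Qed.

Definition coev m : {additive Y m -> X m} :=
  @dsum_map (diag m) (diag m) (fun u => M (dj u)) (fun u => H (di u) (dj u)) id (@inj_id _)
    (fun u => mk_additive (@coev_additive (di u) (dj u))).

Lemma coevE m (f : Y m) u v : hom_fun (dsum_fun (coev m f) u) v = coev_fun (dsum_fun f u) v.
Proof. by []. Qed.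

Lemma coev_chain : chain_map (@first_quadrant M) (fun m (_ : X m) => True) coev.
Proof.
split=> // m m' h f fq; apply: dsumP => u; apply: homP => v.
rewrite coevE std_diffE.
rewrite -[LHS]/(coev_fun (dsum_fun f (diag_left h u)) (bd W (subrK 1 (di u)) v) +
  hom_fun (sgnz (di u) (@postcomp W M (di u) _ _ (subrK 1 (dj u)) (dsum_fun (coev m f) (diag_down h u)))) v).
rewrite hom_sgnz.
rewrite -[hom_fun _ v]/(cdiff M (subrK 1 (dj u)) (coev_fun (dsum_fun f (diag_down h u)) v)).
rewrite coev_diff coevD coev_sgn; congr (_ + _); set x := dsum_fun f _.
have [i0|i0] := ltP (di u) 1.
  have -> : x = 0 by apply: fq; rewrite /= subr_lt0.
  by rewrite /coev_fun /sgnz !(raddf0 (act M _), mul0rz, addr0).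
rewrite coevD coev_sgn /coev_fun -bd_act !gE ?subr_ge0 // c2actK actK.
rewrite sgnz_add !mulrzDr -!sgnz_mulz addrACA [X in _ = _ + X]addrC.
by rewrite /sgnz; congr (_ + (_ + _)); rewrite mulrzAC.
Qed.
End Coeval.

Section Homotopies.
Variables (w : forall i, W i) (g : forall i, {additive W i -> int}).
Hypothesis wE : forall (k i : int) (h : k + 1 = i), bd W h (w i) = w k + sgnz i (T (w k)).
Hypothesis gE : forall (k i : int) (h : k + 1 = i) x,
  0 <= k -> g k (bd W h x) = g i x + sgnz i (g i (T x)).
Variable s : forall (i j : int) (h : i + 1 = j), {additive W i -> W j}.
Hypothesis sT : forall (i j : int) (h : i + 1 = j) x, s h (T x) = T (s h x).
Hypothesis sE : forall (k i j : int) (h : k + 1 = i) (h' : i + 1 = j) x,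
  bd W h' (s h' x) + s h (bd W h x) = retr w g i x - x.
Variable kap : int -> int.
Hypothesis kap_neg : forall i, i < 0 -> kap i = 0.
Hypothesis kapE : forall k i : int, k + 1 = i -> 0 <= i ->
  g i (w i) - 1 = kap k + kap i /\ g i (T (w i)) = sgnz i (kap k - kap i).

Section Shift.
Variables (m m' : int) (h : m + 1 = m').

Fact shift_linear i i' j (hi : i + 1 = i') (f : H i' j) :
  @c2linear (W i) (c2cochain_mod M j) (fun x => hom_fun f (s hi x)).
Proof.
split=> [x y|x]; first by rewrite raddfB (hom_linear f).1.
by rewrite sT (hom_linear f).2.
Qed.

Fact shift_additive i i' j (hi : i + 1 = i') :
  zmod_morphism (fun f : H i' j => mk_hom (shift_linear hi f)).
Proof. by move=> f f'; apply: homP. Qed.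

Definition hom_shift : {additive X m' -> X m} :=
  @dsum_map (diag m') (diag m) (fun u => H (di u) (dj u)) (fun u => H (di u) (dj u))
    (diag_right h) (@diag_right_inj _ _ h)
    (fun u => mk_additive (@shift_additive (di u) (di u + 1) (dj u) erefl)).

Lemma hom_shiftE (f : X m') (u : diag m) i' (hi : di u + 1 = i') (e : i' + dj u = m') x :
  hom_fun (dsum_fun (hom_shift f) u) x = hom_fun (dsum_fun f (Diag e)) (s hi x).
Proof. by case: i' / hi e => e; rewrite (Prop_irrelevance e (diag_rightE h u)). Qed.

Fact kap_additive i j : zmod_morphism (fun x : M j => x *~ kap i).
Proof. by move=> x y; rewrite mulrzBl. Qed.

Definition std_shift : {additive Y m' -> Y m} :=
  @dsum_map (diag m') (diag m) (fun u => M (dj u)) (fun u => M (dj u))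
    (diag_right h) (@diag_right_inj _ _ h)
    (fun u => mk_additive (@kap_additive (di u) (dj u))).

Lemma std_shiftE (f : Y m') (u : diag m) i' (hi : di u + 1 = i') (e : i' + dj u = m') :
  dsum_fun (std_shift f) u = dsum_fun f (Diag e) *~ kap (di u).
Proof. by case: i' / hi e => e; rewrite (Prop_irrelevance e (diag_rightE h u)). Qed.
End Shift.

Lemma hom_diff_at m m' (h : m + 1 = m') (f : X m) i j (e : i + j = m') x
    i0 (h0 : i0 + 1 = i) (e0 : i0 + j = m) j0 (h1 : j0 + 1 = j) (e1 : i + j0 = m) :
  hom_fun (dsum_fun (cdiff X h f) (Diag e)) x =
  hom_fun (dsum_fun f (Diag e0)) (bd W h0 x) +
  sgnz i (cdiff M h1 (hom_fun (dsum_fun f (Diag e1)) x)).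
Proof.
rewrite (tot_diff_at _ _ _ h0 e0 h1 e1).
transitivity (hom_fun (@precomp W M _ _ j h0 (dsum_fun f (Diag e0))) x +
  hom_fun (sgnz i (@postcomp W M i _ _ h1 (dsum_fun f (Diag e1)))) x); first by [].
by rewrite hom_sgnz.
Qed.

Lemma hom_fun_act i j (F : H i j) v : act M j (hom_fun F v) = hom_fun F (T v).
Proof. exact: (esym ((hom_linear F).2 v)). Qed.

Lemma coev_ev_fun i j (F : H i j) x :
  coev_fun g (hom_fun F (w i)) x = hom_fun F (retr w g i x).
Proof. by rewrite /coev_fun hom_fun_act -!hom_fun_mulz -hom_funD. Qed.

Lemma coev_ev m (z : X m) : cdiff X (erefl (m + 1)) z = 0 ->
  cdiff X (subrK 1 m) (hom_shift (subrK 1 m) z) = coev g m (ev w m z) - z.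
Proof.
move=> dz; apply: dsumP => -[i j e]; apply: homP => x.
rewrite dsum_funB hom_funB coevE evE coev_ev_fun.
transitivity (hom_fun (dsum_fun z (Diag e)) (retr w g i x - x)); last exact: (hom_linear _).1.
have e0 : i - 1 + j = m - 1 by rewrite addrAC e.
have e1 : i + (j - 1) = m - 1 by rewrite addrA e.
rewrite (hom_diff_at _ _ _ (subrK 1 i) e0 (subrK 1 j) e1).
rewrite -(sE (subrK 1 i) (erefl (i + 1))) hom_funD.
rewrite (@hom_shiftE _ _ (subrK 1 m) z (Diag e0) i (subrK 1 i) e) [RHS]addrC; congr (_ + _).
have e2 : i + 1 + (j - 1) = m by rewrite addrACA subrr addr0.
rewrite (@hom_shiftE _ _ (subrK 1 m) z (Diag e1) _ (erefl (i + 1)) e2).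
have e3 : i + 1 + j = m + 1 by rewrite addrAC e.
have := @hom_diff_at _ _ (erefl (m + 1)) z _ _ e3 (s (erefl (i + 1)) x) _ (erefl (i + 1)) e _ (subrK 1 j) e2.
rewrite dz hom_fun0 (sgnz_add1 _ (erefl (i + 1))) => /esym/eqP.
by rewrite subr_eq0 => /eqP.
Qed.

Lemma ev_coev m (z : Y m) : first_quadrant z -> cdiff Y (erefl (m + 1)) z = 0 ->
  cdiff Y (subrK 1 m) (std_shift (subrK 1 m) z) = ev w m (coev g m z) - z.
Proof.
move=> qz dz; apply: dsumP => -[i j e].
rewrite dsum_funB evE coevE.
have e0 : i - 1 + j = m - 1 by rewrite addrAC e.
have e1 : i + (j - 1) = m - 1 by rewrite addrA e.
rewrite (std_diff_at _ _ _ (subrK 1 i) e0 (subrK 1 j) e1).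
rewrite (@std_shiftE _ _ (subrK 1 m) z (Diag e0) i (subrK 1 i) e).
have e2 : i + 1 + (j - 1) = m by rewrite addrACA subrr addr0.
rewrite (@std_shiftE _ _ (subrK 1 m) z (Diag e1) _ (erefl (i + 1)) e2) /=.
have [i0|i0] := ltP i 0.
  have -> : dsum_fun z (Diag e) = 0 by apply: qz.
  rewrite (kap_neg i0) /coev_fun /sgnz !(raddf0 (act M _), mul0rz, mulr0z, addr0, subrr).
  by rewrite (raddf0 (cdiff M _)) mul0rz addr0.
have e3 : i + 1 + j = m + 1 by rewrite addrAC e.
have := std_diff_at (erefl (m + 1)) z e3 (erefl (i + 1)) e (subrK 1 j) e2.
rewrite dz dsum_fun0 !(sgnz_add1 _ (erefl (i + 1))) => /esym/eqP.
rewrite subr_eq0 => /eqP dE; rewrite (raddfMz (act M j)) (raddfMz (cdiff M _)).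
set y := dsum_fun z _ in dE *; set v := cdiff _ _ _ in dE *.
have mz k (t : M j) : sgnz i (t *~ k) = sgnz i t *~ k by rewrite /sgnz mulrzAC.
rewrite !mz -dE; have [k1 k2] := kapE (subrK 1 i) i0.
rewrite /coev_fun k2 -sgnz_mulz.
have -> : g i (w i) = kap (i - 1) + kap i + 1 by rewrite -k1 subrK.
set t := sgnz i _.
rewrite !mulrzDr !mulrzDl !mulNrz !mulrNz mulr1z.
move: (y *~ _) (y *~ _) (t *~ _) (t *~ _) => a b c d.
by rewrite [RHS]addrAC addrK addrACA.
Qed.

Lemma std_shift_quadrant m (z : Y m) : first_quadrant z ->
  first_quadrant (std_shift (subrK 1 m) z).
Proof.
move=> qz [i j e] i0.
have e1 : i + 1 + j = m by rewrite addrAC e subrK.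
rewrite (@std_shiftE _ _ (subrK 1 m) z (Diag e) _ (erefl (i + 1)) e1) /=.
by rewrite kap_neg ?mulr0z.
Qed.

Lemma eval_transfer m V :
  computes (@first_quadrant M) m V -> computes (fun p (_ : X p) => True) m V.
Proof.
apply: (computes_transfer (f := ev w) (g := coev g)) => //.
- exact: ev_chain.
- exact: coev_chain.
- by move=> z [_ dz]; exists (hom_shift (subrK 1 m) z); rewrite ?coev_ev.
- move=> z [qz dz]; exists (std_shift (subrK 1 m) z); rewrite ?ev_coev //.
  exact: std_shift_quadrant.
Qed.
End Homotopies.

(** Evaluation at the w_i and composition with the g_i are inverse to each other up
   to the homotopies induced by s and by kap. *)
Theorem resolution_std m V :
  computes (@first_quadrant M) m V -> computes (fun p (_ : X p) => True) m V.
Proof.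
have [w [wE [aug [augw augT augE augB]]]] := res_basis hW.
have [g [gE g0E]] := res_functional hW augT augB.
have [s [sT sE]] := res_homotopy hW wE gE g0E augw augT augE.
apply: (@eval_transfer w g wE gE s sT sE (kap w g)).
  by move=> i; apply: kap_neg.
by move=> k i; apply: (kapE wE gE g0E).
Qed.
End Evaluation.

(** * From homotopies of complexes to homotopies of squares *)

Lemma sq_diff_at (C : cochain) m m' (h : m + 1 = m') (x : tensor_square C m) i j (e : i + j = m')
    i0 (h0 : i0 + 1 = i) (e0 : i0 + j = m) j0 (h1 : j0 + 1 = j) (e1 : i + j0 = m) :
  dsum_fun (cdiff (tensor_square C) h x) (Diag e) =
  tensor_map (cdiff C h0) idfun (dsum_fun x (Diag e0)) +
  sgnz i (tensor_map idfun (cdiff C h1) (dsum_fun x (Diag e1))).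
Proof. exact: tot_diff_at. Qed.

Lemma sgnz_opp (V : zmodType) i (x : V) : sgnz i (- x) = - sgnz i x.
Proof. exact: raddfN. Qed.

Lemma sgnz_parity (V : zmodType) (e e' k : int) (x : V) : e = e' + 2 * k -> sgnz e x = sgnz e' x.
Proof.
move=> ->; rewrite sgnzD; congr sgnz.
by rewrite (_ : 2 * k = k + k) ?sgnzD ?sgnzK //; ring.
Qed.

Lemma swapE (C : cochain) m (x : tensor_square C m) i j (e : i + j = m) (e' : j + i = m) :
  dsum_fun (swap C m x) (Diag e) = sgnz (i * j) (tensor_swap _ _ (dsum_fun x (Diag e'))).
Proof. by rewrite (Prop_irrelevance e' (diagE (diag_swap (Diag e)))). Qed.

(** The maps F and G need not be packaged as additive, so that the lemma applies to
   sums of composites as they stand. *)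
Lemma tensor_eq (X Y V : zmodType) (F G : tensor X Y -> V) :
  zmod_morphism F -> zmod_morphism G -> (forall x y, F (tens x y) = G (tens x y)) ->
  forall t, F t = G t.
Proof.
by move=> FB GB FG t; apply: (tensor_ext (f := mk_additive FB) (g := mk_additive GB)).
Qed.

Section SquareHomotopy.
Variables (X Y : cochain).
Variables (f g : forall p, {additive X p -> Y p}).
Hypothesis fD : forall p q (h : p + 1 = q) x, cdiff Y h (f p x) = f q (cdiff X h x).
Hypothesis gD : forall p q (h : p + 1 = q) x, cdiff Y h (g p x) = g q (cdiff X h x).
Variable k : forall p q : int, q + 1 = p -> {additive X p -> Y q}.
Hypothesis kE : forall (p q r : int) (hq : q + 1 = p) (hr : p + 1 = r) (x : X p),
  cdiff Y hq (k hq x) + k hr (cdiff X hr x) = f p x - g p x.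

Definition sq_map (f : forall p, {additive X p -> Y p}) m :
    {additive tensor_square X m -> tensor_square Y m} :=
  @dsum_map (diag m) (diag m) (fun u => tensor (X (di u)) (X (dj u)))
   (fun u => tensor (Y (di u)) (Y (dj u))) id (@inj_id _)
   (fun u => tensor_map (f (di u)) (f (dj u))).

Lemma sq_mapE (f' : forall p, {additive X p -> Y p}) m (x : tensor_square X m) u :
  dsum_fun (sq_map f' m x) u = tensor_map (f' (di u)) (f' (dj u)) (dsum_fun x u).
Proof. by []. Qed.

Lemma tensor_map_swap (A A' B B' : zmodType) (u : {additive A -> A'}) (v : {additive B -> B'}) t :
  tensor_swap _ _ (tensor_map u v t) = tensor_map v u (tensor_swap _ _ t).
Proof.
move: t; apply: tensor_eq => [x y|x y|x y]; rewrite ?raddfB //.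
by rewrite tensor_mapE !tensor_swapE tensor_mapE.
Qed.


Lemma sq_map_act (f' : forall p, {additive X p -> Y p}) m (x : tensor_square X m) :
  sq_map f' m (swap X m x) = swap Y m (sq_map f' m x).
Proof.
apply: dsumP => -[i j e]; have e' : j + i = m by rewrite addrC.
rewrite sq_mapE (swapE x e e') (swapE (sq_map f' m x) e e') sq_mapE.
by rewrite (sgnz_raddf (tensor_map _ _)) tensor_map_swap.
Qed.

Lemma tensor_map_comp (A A' A'' B B' B'' : zmodType) (f1 : {additive A -> A'})
    (f2 : {additive A' -> A''}) (g1 : {additive B -> B'}) (g2 : {additive B' -> B''}) t :
  tensor_map f2 g2 (tensor_map f1 g1 t) = tensor_map (f2 \o f1) (g2 \o g1) t.
Proof.
move: t; apply: tensor_eq => [x y|x y|x y]; rewrite ?raddfB //.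
by rewrite !tensor_mapE.
Qed.

Lemma tensor_map_eq (A A' B B' : zmodType) (f1 f2 : {additive A -> A'})
    (g1 g2 : {additive B -> B'}) t : f1 =1 f2 -> g1 =1 g2 ->
  tensor_map f1 g1 t = tensor_map f2 g2 t.
Proof.
move=> ef eg; move: t; apply: tensor_eq => [x y|x y|x y]; rewrite ?raddfB //.
by rewrite !tensor_mapE ef eg.
Qed.

Lemma sq_map_diff (f' : forall p, {additive X p -> Y p}) m m' (h : m + 1 = m') x :
  (forall p q (h : p + 1 = q) x, cdiff Y h (f' p x) = f' q (cdiff X h x)) ->
  cdiff (tensor_square Y) h (sq_map f' m x) = sq_map f' m' (cdiff (tensor_square X) h x).
Proof.
move=> f'D; apply: dsumP => -[i j e].
have e0 : i - 1 + j = m by rewrite addrAC e -h addrK.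
have e1 : i + (j - 1) = m by rewrite addrA e -h addrK.
rewrite sq_mapE !(sq_diff_at _ _ _ (subrK 1 i) e0 (subrK 1 j) e1) !sq_mapE raddfD.
rewrite (sgnz_raddf (tensor_map _ _)) !tensor_map_comp.
by congr (_ + sgnz _ _); apply: tensor_map_eq => y /=; rewrite ?f'D.
Qed.

Lemma tensor_homotopyl p0 p r (hp : p0 + 1 = p) (hr : p + 1 = r) (B B' : zmodType)
    (v : {additive B -> B'}) (t : tensor (X p) B) :
  tensor_map (cdiff Y hp) idfun (tensor_map (k hp) v t) +
  tensor_map (k hr) v (tensor_map (cdiff X hr) idfun t) =
  tensor_map (f p) v t - tensor_map (g p) v t.
Proof.
move: t; apply: tensor_eq => [x y|x y|x y].
- by rewrite !(raddfB (tensor_map _ _)); zmod (tensor (Y p) B').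
- by rewrite !(raddfB (tensor_map _ _)); zmod (tensor (Y p) B').
rewrite !tensor_mapE -tensDl kE; apply: (canRL (addrK _)).
by rewrite -tensDl subrK.
Qed.

Lemma tensor_homotopyr p0 p r (hp : p0 + 1 = p) (hr : p + 1 = r) (B B' : zmodType)
    (v : {additive B -> B'}) (t : tensor B (X p)) :
  tensor_map idfun (cdiff Y hp) (tensor_map v (k hp) t) +
  tensor_map v (k hr) (tensor_map idfun (cdiff X hr) t) =
  tensor_map v (f p) t - tensor_map v (g p) t.
Proof.
move: t; apply: tensor_eq => [x y|x y|x y].
- by rewrite !(raddfB (tensor_map _ _)); zmod (tensor B' (Y p)).
- by rewrite !(raddfB (tensor_map _ _)); zmod (tensor B' (Y p)).
rewrite !tensor_mapE -tensDr kE; apply: (canRL (addrK _)).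
by rewrite -tensDr subrK.
Qed.

Lemma tensor_chainl (f' : forall p, {additive X p -> Y p}) p q (h : p + 1 = q)
    (B B' : zmodType) (v : {additive B -> B'}) (t : tensor (X p) B) :
  (forall p q (h : p + 1 = q) x, cdiff Y h (f' p x) = f' q (cdiff X h x)) ->
  tensor_map (cdiff Y h) idfun (tensor_map (f' p) v t) =
  tensor_map (f' q) v (tensor_map (cdiff X h) idfun t).
Proof. by move=> f'D; rewrite !tensor_map_comp; apply: tensor_map_eq => y /=; rewrite ?f'D. Qed.

Lemma tensor_chainr (f' : forall p, {additive X p -> Y p}) p q (h : p + 1 = q)
    (B B' : zmodType) (v : {additive B -> B'}) (t : tensor B (X p)) :
  (forall p q (h : p + 1 = q) x, cdiff Y h (f' p x) = f' q (cdiff X h x)) ->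
  tensor_map idfun (cdiff Y h) (tensor_map v (f' p) t) =
  tensor_map v (f' q) (tensor_map idfun (cdiff X h) t).
Proof. by move=> f'D; rewrite !tensor_map_comp; apply: tensor_map_eq => y /=; rewrite ?f'D. Qed.

Section Degree.
Variables (m m' : int).

Section H0.
Variable h : m + 1 = m'.
Definition sq_h0l : {additive tensor_square X m' -> tensor_square Y m} :=
  @dsum_map (diag m') (diag m) (fun u => tensor (X (di u)) (X (dj u)))
   (fun u => tensor (Y (di u)) (Y (dj u))) (diag_right h) (@diag_right_inj _ _ h)
   (fun u => tensor_map (k (erefl (di u + 1))) (f (dj u))).
Definition sq_h0r : {additive tensor_square X m' -> tensor_square Y m} :=
  @dsum_map (diag m') (diag m) (fun u => tensor (X (di u)) (X (dj u)))
   (fun u => tensor (Y (di u)) (Y (dj u))) (diag_up h) (@diag_up_inj _ _ h)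
   (fun u => @sgnz (tensor (Y (di u)) (Y (dj u))) (di u)
      \o tensor_map (g (di u)) (k (erefl (dj u + 1)))).
(** The usual homotopy k (x) f + g (x) k between f (x) f and g (x) g. *)
Definition sq_h0 : {additive tensor_square X m' -> tensor_square Y m} := sq_h0l \+ sq_h0r.

Lemma sq_h0E (x : tensor_square X m') i j (e : i + j = m) i1 (h1 : i + 1 = i1) (e1 : i1 + j = m')
    j1 (h2 : j + 1 = j1) (e2 : i + j1 = m') :
  dsum_fun (sq_h0 x) (Diag e) = tensor_map (k h1) (f j) (dsum_fun x (Diag e1)) +
    sgnz i (tensor_map (g i) (k h2) (dsum_fun x (Diag e2))).
Proof.
case: i1 / h1 e1 => e1; case: j1 / h2 e2 => e2.
rewrite (Prop_irrelevance e1 (diag_rightE h (Diag e))).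
by rewrite (Prop_irrelevance e2 (diag_upE h (Diag e))).
Qed.
End H0.

Section H1.
Variable h : m + 2 = m'.
Fact diag_diag_proof (u : diag m) : (di u + 1) + (dj u + 1) = m'.
Proof. by rewrite addrACA diagE. Qed.
Definition diag_diag (u : diag m) : diag m' := Diag (diag_diag_proof u).
Lemma diag_diag_inj : injective diag_diag.
Proof.
move=> u v e; apply: diag_inj; apply: (@addIr _ 1).
  exact: (congr1 (@di m') e).
exact: (congr1 (@dj m') e).
Qed.
(** Conjugating the homotopy [sq_h0] with the swap gives f (x) k + k (x) g up to
   signs; the two are themselves homotopic through k (x) k. *)
Definition sq_h1 : {additive tensor_square X m' -> tensor_square Y m} :=
  @dsum_map (diag m') (diag m) (fun u => tensor (X (di u)) (X (dj u)))
   (fun u => tensor (Y (di u)) (Y (dj u))) diag_diag diag_diag_inj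
   (fun u => @sgnz (tensor (Y (di u)) (Y (dj u))) (di u + 1)
      \o tensor_map (k (erefl (di u + 1))) (k (erefl (dj u + 1)))).
Lemma sq_h1E (x : tensor_square X m') i j (e : i + j = m) i1 (h1 : i + 1 = i1)
    j1 (h2 : j + 1 = j1) (e2 : i1 + j1 = m') :
  dsum_fun (sq_h1 x) (Diag e) =
    - sgnz i (tensor_map (k h1) (k h2) (dsum_fun x (Diag e2))).
Proof.
case: i1 / h1 e2; case: j1 / h2 => e2; rewrite -(sgnz_add1 _ (erefl (i + 1))).
by rewrite (Prop_irrelevance e2 (diag_diag_proof (Diag e))).
Qed.
End H1.
End Degree.

Lemma sq_h0_homotopy (p q r : int) (hq : q + 1 = p) (hr : p + 1 = r) (x : tensor_square X p) :
  cdiff (tensor_square Y) hq (sq_h0 hq x) + sq_h0 hr (cdiff (tensor_square X) hr x) =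
  sq_map f p x - sq_map g p x.
Proof.
apply: dsumP => -[i j e].
have d0 : i - 1 + j = q by rewrite addrAC e -hq addrK.
have d1 : i + (j - 1) = q by rewrite addrA e -hq addrK.
have c0 : i + 1 + (j - 1) = p by rewrite addrACA subrr addr0.
have c1 : i - 1 + (j + 1) = p by rewrite addrACA addNr addr0.
have b0 : i + 1 + j = r by rewrite addrAC e.
have b1 : i + (j + 1) = r by rewrite addrA e.
rewrite dsum_funD (sq_diff_at _ _ _ (subrK 1 i) d0 (subrK 1 j) d1).
rewrite (sq_h0E _ x d0 (subrK 1 i) e (erefl (j + 1)) c1).
rewrite (sq_h0E _ x d1 (erefl (i + 1)) c0 (subrK 1 j) e).
rewrite (sq_h0E _ _ e (erefl (i + 1)) b0 (erefl (j + 1)) b1).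
rewrite (sq_diff_at _ _ _ (erefl (i + 1)) e (subrK 1 j) c0).
rewrite (sq_diff_at _ _ _ (subrK 1 i) c1 (erefl (j + 1)) e).
rewrite dsum_funB !sq_mapE.
rewrite -[RHS]/(tensor_map (f i) (f j) (dsum_fun x (Diag e)) -
  tensor_map (g i) (g j) (dsum_fun x (Diag e))).
set z := dsum_fun x (Diag e); set y := dsum_fun x (Diag c1); set w := dsum_fun x (Diag c0).
have E1 := tensor_homotopyl (subrK 1 i) (erefl (i + 1)) (f j) z.
have E2 := tensor_homotopyr (subrK 1 j) (erefl (j + 1)) (g i) z.
have E3 := tensor_chainr (subrK 1 j) (k (erefl (i + 1))) w fD.
have E4 := tensor_chainl (subrK 1 i) (k (erefl (j + 1))) y gD.
rewrite !(raddfD (tensor_map _ _)) !(sgnz_raddf (tensor_map _ _)) !sgnz_add !sgnzK.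
rewrite sgnz_sub1 (sgnz_add1 _ (erefl (i + 1))) -E3 -E4.
transitivity ((tensor_map (f i) (f j) z - tensor_map (g i) (f j) z) +
  (tensor_map (g i) (f j) z - tensor_map (g i) (g j) z)).
  rewrite -E1 -E2; zmod (tensor (Y i) (Y j)).
zmod (tensor (Y i) (Y j)).
Qed.

Lemma sq_h1_homotopy (p r q q' : int) (hr : p + 1 = r) (h : q + 1 = q') (h' : q' + 1 = p)
    (hp : q + 2 = p) (hr' : q' + 2 = r) (x : tensor_square X p) :
  cdiff (tensor_square Y) h (sq_h1 hp x) - sq_h1 hr' (cdiff (tensor_square X) hr x) =
  swap Y q' (sq_h0 h' (swap X p x)) - sq_h0 h' x.
Proof.
apply: dsumP => -[i j e].
have e' : j + i = q' by rewrite addrC.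
have d0 : i - 1 + j = q by rewrite addrAC e -h addrK.
have d1 : i + (j - 1) = q by rewrite addrA e -h addrK.
have c0 : i + (j + 1) = p by rewrite addrA e.
have c1 : i + 1 + j = p by rewrite addrAC e.
have c0' : j + 1 + i = p by rewrite addrC.
have c1' : j + (i + 1) = p by rewrite addrC.
have b : i + 1 + (j + 1) = r by rewrite -hr -c0; ring.
rewrite !dsum_funB (sq_diff_at _ _ _ (subrK 1 i) d0 (subrK 1 j) d1).
rewrite (sq_h1E hp x d0 (subrK 1 i) (erefl (j + 1)) c0).
rewrite (sq_h1E hp x d1 (erefl (i + 1)) (subrK 1 j) c1).
rewrite (sq_h1E hr' _ e (erefl (i + 1)) (erefl (j + 1)) b).
rewrite (sq_diff_at _ _ _ (erefl (i + 1)) c0 (erefl (j + 1)) c1).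
rewrite (swapE _ e e') (sq_h0E _ _ e' (erefl (j + 1)) c0' (erefl (i + 1)) c1').
rewrite (sq_h0E _ _ e (erefl (i + 1)) c1 (erefl (j + 1)) c0).
rewrite (swapE x c0' c0) (swapE x c1' c1).
set y := dsum_fun x (Diag c0); set w := dsum_fun x (Diag c1).
have E1 := tensor_homotopyl (subrK 1 i) (erefl (i + 1)) (k (erefl (j + 1))) y.
have E2 := tensor_homotopyr (subrK 1 j) (erefl (j + 1)) (k (erefl (i + 1))) w.
rewrite !(raddfN (tensor_map _ _)) !(raddfD (tensor_map _ _)) !(raddfD (tensor_swap _ _)).
rewrite !(sgnz_raddf (tensor_map _ _)) !(sgnz_raddf (tensor_swap _ _)).
rewrite !tensor_map_swap !tensor_swapK !sgnz_add.
rewrite sgnz_sub1 !sgnz_opp !(sgnz_add1 _ (erefl (i + 1))) !sgnz_opp !sgnzK -!sgnzD.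
rewrite (@sgnz_parity _ (i * j + (j + 1) * i) i (i * j)); last by ring.
rewrite (@sgnz_parity _ (i * j + j + j * (i + 1)) 0 (i * j + j)); last by ring.
rewrite [sgnz 0 _]/sgnz expr0z mulr1z.
have {}E1 := congr1 (sgnz i) E1; rewrite !sgnz_add sgnz_opp in E1.
transitivity ((sgnz i (tensor_map (f i) (k (erefl (j + 1))) y) -
  sgnz i (tensor_map (g i) (k (erefl (j + 1))) y)) -
  (tensor_map (k (erefl (i + 1))) (f j) w - tensor_map (k (erefl (i + 1))) (g j) w)).
  rewrite -E1 -E2; zmod (tensor (Y i) (Y j)).
zmod (tensor (Y i) (Y j)).
Qed.

Lemma sq_h1_act (p q : int) (hp : q + 2 = p) (x : tensor_square X p) :
  swap Y q (sq_h1 hp (swap X p x)) = - sq_h1 hp x.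
Proof.
apply: dsumP => -[i j e]; have e' : j + i = q by rewrite addrC.
have c : i + 1 + (j + 1) = p by rewrite -hp -e; ring.
have c' : j + 1 + (i + 1) = p by rewrite -hp -e; ring.
rewrite (swapE _ e e') (sq_h1E hp _ e' (erefl (j + 1)) (erefl (i + 1)) c').
rewrite (swapE x c' c) -[RHS]/(- dsum_fun (sq_h1 hp x) (Diag e)).
rewrite (sq_h1E hp x e (erefl (i + 1)) (erefl (j + 1)) c) opprK.
rewrite (sgnz_raddf (tensor_map _ _)) (raddfN (tensor_swap _ _)) sgnz_opp.
rewrite !(sgnz_raddf (tensor_swap _ _)) tensor_map_swap tensor_swapK -!sgnzD.
by rewrite -sgnz_sub1; apply: (@sgnz_parity _ _ _ (i * j + j)); ring.
Qed.

Lemma sq_homotopy m (x : std_complex (c2tensor_square X) m) :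
  cdiff (std_complex (c2tensor_square X)) (erefl (m + 1)) x = 0 ->
  first_quadrant x ->
  is_cobord (@first_quadrant (c2tensor_square Y))
    (@std_map (c2tensor_square X) (c2tensor_square Y) (sq_map f) m x -
     @std_map (c2tensor_square X) (c2tensor_square Y) (sq_map g) m x).
Proof.
move=> dx qx.
pose h0 p q (h : q + 1 = p) : {additive c2tensor_square X p -> c2tensor_square Y q} := sq_h0 h.
pose h1 p q (h : q + 2 = p) : {additive c2tensor_square X p -> c2tensor_square Y q} := sq_h1 h.
exists (@std_h (c2tensor_square X) (c2tensor_square Y) h0 h1 _ _ (subrK 1 m) x).
  exact: std_h_quadrant.
apply: std_homotopy => //.
- exact: sq_h0_homotopy.
- exact: sq_h1_homotopy.
- exact: sq_h1_act.
Qed.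
End SquareHomotopy.

(** * Squares of homotopy equivalent complexes *)

Definition cochain_map (X Y : cochain) (f : forall p, {additive X p -> Y p}) :=
  forall (p q : int) (h : p + 1 = q) x, cdiff Y h (f p x) = f q (cdiff X h x).

Definition homotopic (X Y : cochain) (f g : forall p, {additive X p -> Y p}) :=
  exists k : forall p q : int, q + 1 = p -> {additive X p -> Y q},
  forall (p q r : int) (hq : q + 1 = p) (hr : p + 1 = r) (x : X p),
  cdiff Y hq (k p q hq x) + k r p hr (cdiff X hr x) = f p x - g p x.

Definition idmap (X : cochain) p : {additive X p -> X p} := idfun.
Definition compmap (X Y Z : cochain) (g : forall p, {additive Y p -> Z p})
  (f : forall p, {additive X p -> Y p}) p : {additive X p -> Z p} := g p \o f p.

Definition homotopy_equivalent (X Y : cochain) :=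
  exists (f : forall p, {additive X p -> Y p}) (g : forall p, {additive Y p -> X p}),
  [/\ cochain_map f, cochain_map g, homotopic (compmap g f) (@idmap X)
    & homotopic (compmap f g) (@idmap Y)].

Lemma tensor_map_id (X Y : zmodType) (t : tensor X Y) : tensor_map idfun idfun t = t.
Proof.
by move: t; apply: tensor_eq => [x y|x y|x y]; rewrite ?(raddfB (tensor_map _ _)) ?tensor_mapE.
Qed.

Section SquareEquivalence.
Variables X Y : cochain.
Local Notation S X := (std_complex (c2tensor_square X)).

Definition std_sq (Z Z' : cochain) (f : forall p, {additive Z p -> Z' p}) m :
    {additive S Z m -> S Z' m} :=
  @std_map (c2tensor_square Z) (c2tensor_square Z') (sq_map f) m.

Lemma std_sq_comp (X' Y' Z' : cochain) (g : forall p, {additive Y' p -> Z' p})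
    (f : forall p, {additive X' p -> Y' p}) m (x : S X' m) :
  std_sq (compmap g f) m x = std_sq g m (std_sq f m x).
Proof.
by apply: dsumP => u; apply: dsumP => v; symmetry; apply: tensor_map_comp.
Qed.

Lemma std_sq_id (Z : cochain) m (x : S Z m) : std_sq (@idmap Z) m x = x.
Proof. by apply: dsumP => u; apply: dsumP => v; apply: tensor_map_id. Qed.

Lemma std_sq_chain (Z Z' : cochain) (f : forall p, {additive Z p -> Z' p}) :
  cochain_map f ->
  chain_map (@first_quadrant (c2tensor_square Z)) (@first_quadrant (c2tensor_square Z'))
    (std_sq f).
Proof.
move=> fD; apply: std_map_chain => [j x | p q h x]; first exact: sq_map_act.
exact: sq_map_diff.
Qed.

Lemma std_sq_homotopic (Z : cochain) (f : forall p, {additive Z p -> Z p}) m (z : S Z m) :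
  cochain_map f -> homotopic f (@idmap Z) ->
  is_cocycle (@first_quadrant (c2tensor_square Z)) z ->
  is_cobord (@first_quadrant (c2tensor_square Z)) (std_sq f m z - z).
Proof.
move=> fD [k kE] [qz dz].
have := sq_homotopy fD _ kE dz qz.
by rewrite -/(std_sq f m z) -/(std_sq (@idmap Z) m z) std_sq_id; apply.
Qed.

Lemma cochain_map_comp (X' Y' Z' : cochain) (g : forall p, {additive Y' p -> Z' p})
    (f : forall p, {additive X' p -> Y' p}) :
  cochain_map g -> cochain_map f -> cochain_map (compmap g f).
Proof. by move=> gD fD p q h x; rewrite /= gD fD. Qed.

Theorem homotopy_equivalent_square m V : homotopy_equivalent X Y ->
  computes (@first_quadrant (c2tensor_square Y)) m V ->
  computes (@first_quadrant (c2tensor_square X)) m V.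
Proof.
case=> f [g [fD gD gf fg]].
apply: (computes_transfer (std_sq_chain fD) (std_sq_chain gD)) => [z zc|z zc|p x y].
- by rewrite -std_sq_comp; apply: std_sq_homotopic => //; apply: cochain_map_comp.
- by rewrite -std_sq_comp; apply: std_sq_homotopic => //; apply: cochain_map_comp.
- exact: first_quadrantB.
Qed.
End SquareEquivalence.

(** * Complexes with isomorphic cohomology *)

Section Split.
Variable X : cochain.

(** The endomorphism s is a projection along the cocycles; thus x - s x is the
   component of x in the cocycles. *)
Definition splits_cocycles (p : int) (s : {additive X p -> X p}) :=
  forall (q : int) (h : p + 1 = q),
    (forall x, cdiff X h (s x) = cdiff X h x) /\ (forall x, cdiff X h x = 0 -> s x = 0).

Definition full_computes p V := computes (fun p (_ : X p) => True) p V.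

Lemma split_eq p (s : {additive X p -> X p}) q (h : p + 1 = q) x y : splits_cocycles s ->
  cdiff X h x = cdiff X h y -> s x = s y.
Proof.
move=> /(_ q h) [_ s0] xy; apply/eqP; rewrite -subr_eq0 -raddfB; apply/eqP.
by apply: s0; rewrite raddfB xy subrr.
Qed.

Lemma split_idem p (s : {additive X p -> X p}) x : splits_cocycles s -> s (s x) = s x.
Proof. by move=> sS; apply: (split_eq (h := erefl (p + 1)) sS); case: (sS _ (erefl (p + 1))). Qed.

Lemma split_cocycle p (s : {additive X p -> X p}) q (h : p + 1 = q) x : splits_cocycles s ->
  cdiff X h (x - s x) = 0.
Proof. by move=> sS; rewrite raddfB (sS q h).1 subrr. Qed.

(** The splitting extends the class of a cocycle to an additive map on all
   cochains. *)
Lemma split_computes p (s : {additive X p -> X p}) : splits_cocycles s ->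
  full_computes p (cohomology X p).
Proof.
move=> sS.
have rK x : x - s x \in kernel (cdiff X (erefl (p + 1))) by rewrite inE split_cocycle.
have rB : zmod_morphism (fun x => SubZmod (rK x) : cocycles X p).
  by move=> x y; apply/val_inj; rewrite /= raddfB opprB addrACA -opprB opprB addrC; zmod (X p).
exists (\pi_(cohomology X p) \o mk_additive rB); split=> [z [_ dz]|z [y _ yz]|v].
- move=> /pi_eq0; rewrite inE => -[y /(congr1 val) /= yE]; exists y => //.
  by rewrite yE (sS _ (erefl (p + 1))).2 ?subr0.
- apply/pi_eq0; rewrite inE; exists y; apply/val_inj => /=.
  by rewrite yz (sS _ (erefl (p + 1))).2 ?subr0 // -yz cdiffK.
- have dv : cdiff X (erefl (p + 1)) (val (repr v)) = 0.
    by case: (repr v) => z /=; rewrite inE => /eqP.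
  exists (val (repr v)); first by [].
  rewrite -[RHS]reprK /=; congr (\pi_(cohomology X p) _); apply/val_inj => /=.
  by rewrite (sS _ (erefl (p + 1))).2 ?subr0.
Qed.
End Split.

Lemma computes_isoV X Q p U V : zmod_iso U V -> @computes X Q p U -> @computes X Q p V.
Proof.
move=> [f [g fK gK]] [th [thK thB thS]]; exists (f \o th); split=> [z zc /= z0|z zb /=|v].
- by apply: thK => //; apply: (can_inj fK); rewrite z0 raddf0.
- by rewrite thB ?raddf0.
- by have [z zc ze] := thS (g v); exists z; rewrite //= ze gK.
Qed.

(** A map X -> Y with prescribed effect on cohomology.  On the cocycles of X it is a
   lift f0 of the prescribed map to the cocycles of Y, precomposed with the
   projection onto the cocycles; on the complement it is mu, where mu x is a
   primitive of the coboundary f0 (d x). *)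
Section Build.
Variables (X Y : cochain) (V : int -> zmodType).
Variables (sX : forall p, {additive X p -> X p}) (sY : forall p, {additive Y p -> Y p}).
Hypotheses (sXS : forall p, splits_cocycles (sX p)) (sYS : forall p, splits_cocycles (sY p)).
Hypothesis Xproj : forall p, projective (X p).
Variables (tX : forall p, {additive X p -> V p}) (tY : forall p, {additive Y p -> V p}).
Hypothesis tXB : forall (q p : int) (h : q + 1 = p) x, tX p (cdiff X h x) = 0.
Hypothesis tYK : forall (q p r : int) (h : q + 1 = p) (h' : p + 1 = r) z,
  cdiff Y h' z = 0 -> tY p z = 0 -> exists y, cdiff Y h y = z.
Hypothesis tYS : forall (p r : int) (h' : p + 1 = r) v, exists2 z, cdiff Y h' z = 0 & tY p z = v.

Lemma build_map : exists (f0 mu : forall p, {additive X p -> Y p}),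
  [/\ forall (p q : int) (h : p + 1 = q) x, cdiff Y h (f0 p x) = 0,
      forall (p q : int) (h : p + 1 = q) z, cdiff X h z = 0 -> tY p (f0 p z) = tX p z,
      forall (p q : int) (h : p + 1 = q) x, cdiff Y h (mu p x) = f0 q (cdiff X h x) &
      forall p x, sY p (mu p x) = mu p x].
Proof.
have ex0 p : exists f0 : {additive X p -> Y p},
    (forall x, cdiff Y (erefl (p + 1)) (f0 x) = 0) /\
    forall z, cdiff X (erefl (p + 1)) z = 0 -> tY p (f0 z) = tX p z.
  pose vl : {additive cocycles Y p -> Y p} := val.
  have [|v vE] := @Xproj p _ _ (tY p \o vl) (tX p \o (idfun \- sX p)).
    move=> x; have [z dz ze] := tYS (erefl (p + 1)) (tX p (x - sX p x)).
    have zK : z \in kernel (cdiff Y (erefl (p + 1))) by rewrite inE dz.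
    by exists (SubZmod zK).
  exists (vl \o v); split=> [x|z dz] /=.
    by case: (v x) => y /=; rewrite inE => /eqP.
  by have /= -> := vE z; rewrite (sXS (erefl (p + 1))).2 ?subr0.
pose f0 p := projT1 (cid (ex0 p)).
have f0d p q (h : p + 1 = q) x : cdiff Y h (f0 p x) = 0.
  by case: q / h; rewrite /f0; case: cid => /= f0' [].
have f0t p q (h : p + 1 = q) z : cdiff X h z = 0 -> tY p (f0 p z) = tX p z.
  by case: q / h; rewrite /f0; case: cid => /= f0' [_]; apply.
have exmu p : exists v : {additive X p -> Y p},
    forall x, cdiff Y (erefl (p + 1)) (v x) = f0 (p + 1) (cdiff X (erefl (p + 1)) x).
  have [|v vE] := @Xproj p _ _ (cdiff Y (erefl (p + 1))) (f0 (p + 1) \o cdiff X (erefl (p + 1))).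
    move=> x; apply: (@tYK _ _ _ _ (erefl (p + 1 + 1))) => /=; first exact: f0d.
    by rewrite /= (f0t _ _ (erefl _)) ?cdiffK // tXB.
  by exists v.
exists f0, (fun p => sY p \o projT1 (cid (exmu p))); split=> // [p q h x|p x].
  by case: q / h; case: cid => v vE /=; rewrite (sYS (erefl (p + 1))).1 vE.
exact: split_idem.
Qed.

Variables (f0 mu : forall p, {additive X p -> Y p}).
Hypothesis f0d : forall (p q : int) (h : p + 1 = q) x, cdiff Y h (f0 p x) = 0.
Hypothesis f0t : forall (p q : int) (h : p + 1 = q) z, cdiff X h z = 0 -> tY p (f0 p z) = tX p z.
Hypothesis muE : forall (p q : int) (h : p + 1 = q) x, cdiff Y h (mu p x) = f0 q (cdiff X h x).
Hypothesis smu : forall p x, sY p (mu p x) = mu p x.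

Definition built p : {additive X p -> Y p} := (f0 p \o (idfun \- sX p)) \+ mu p.

Lemma builtE p x : built p x = f0 p (x - sX p x) + mu p x.
Proof. by []. Qed.

Lemma mu_cocycle p q (h : p + 1 = q) x : cdiff X h x = 0 -> mu p x = 0.
Proof.
by move=> dx; rewrite -smu (sYS h).2 // muE dx raddf0.
Qed.

Lemma built_map : cochain_map built.
Proof.
move=> p q h x; rewrite !builtE raddfD f0d muE add0r.
rewrite (mu_cocycle (h := erefl (q + 1))) ?cdiffK // addr0.
by rewrite (sXS (erefl (q + 1))).2 ?cdiffK ?subr0.
Qed.
End Build.

(** On the cocycles of X the composite of the maps built from f0 and g0 differs
   from the identity by coboundaries, which have primitives w depending additively
   on the cocycle.  Projecting w to the complement of the cocycles gives the
   homotopy on all of X. *)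
Section BuildHomotopy.
Variables (X Y : cochain) (V : int -> zmodType).
Variables (sX : forall p, {additive X p -> X p}) (sY : forall p, {additive Y p -> Y p}).
Hypotheses (sXS : forall p, splits_cocycles (sX p)) (sYS : forall p, splits_cocycles (sY p)).
Hypothesis Xproj : forall p, projective (X p).
Variables (tX : forall p, {additive X p -> V p}) (tY : forall p, {additive Y p -> V p}).
Hypothesis tXK : forall (q p r : int) (h : q + 1 = p) (h' : p + 1 = r) z,
  cdiff X h' z = 0 -> tX p z = 0 -> exists y, cdiff X h y = z.
Variables (f0 mu : forall p, {additive X p -> Y p}) (g0 nu : forall p, {additive Y p -> X p}).
Hypothesis f0d : forall (p q : int) (h : p + 1 = q) x, cdiff Y h (f0 p x) = 0.
Hypothesis f0t : forall (p q : int) (h : p + 1 = q) z, cdiff X h z = 0 -> tY p (f0 p z) = tX p z.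
Hypothesis muE : forall (p q : int) (h : p + 1 = q) x, cdiff Y h (mu p x) = f0 q (cdiff X h x).
Hypothesis smu : forall p x, sY p (mu p x) = mu p x.
Hypothesis g0d : forall (p q : int) (h : p + 1 = q) x, cdiff X h (g0 p x) = 0.
Hypothesis g0t : forall (p q : int) (h : p + 1 = q) z, cdiff Y h z = 0 -> tX p (g0 p z) = tY p z.
Hypothesis nuE : forall (p q : int) (h : p + 1 = q) x, cdiff X h (nu p x) = g0 q (cdiff Y h x).
Hypothesis snu : forall p x, sX p (nu p x) = nu p x.

Lemma built_homotopic :
  homotopic (compmap (built sY g0 nu) (built sX f0 mu)) (@idmap X).
Proof.
have exw p q (h : q + 1 = p) : exists w : {additive X p -> X q},
    forall x, cdiff X h (w x) = g0 p (f0 p (x - sX p x)) - (x - sX p x).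
  pose u : {additive X p -> X p} := (g0 p \o f0 p \o (idfun \- sX p)) \- (idfun \- sX p).
  have [|w wE] := @Xproj p _ _ (cdiff X h) u; last by exists w.
  move=> x; have dr := split_cocycle (erefl (p + 1)) x (sXS (p := p)).
  apply: (@tXK _ _ _ _ (erefl (p + 1))); rewrite -[u x]/(g0 p (f0 p (x - sX p x)) - (x - sX p x)).
    by rewrite raddfB g0d dr subrr.
  by rewrite raddfB (g0t (f0d (erefl (p + 1)) _)) (f0t dr) subrr.
exists (fun p q h => sX q \o projT1 (cid (exw p q h))) => p q r hq hr x.
case: cid => w wE; case: cid => w' w'E.
rewrite -[LHS]/(cdiff X hq (sX q (w x)) + sX p (w' (cdiff X hr x))).
rewrite -[RHS]/(built sY g0 nu p (built sX f0 mu p x) - x).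
rewrite (sXS hq).1 wE !builtE; set y := x - sX p x.
have -> : sX p (w' (cdiff X hr x)) = nu p (mu p x) - sX p x.
  rewrite -snu -raddfB; apply: (split_eq (h := hr)) => //.
  by rewrite w'E (raddfB (cdiff X hr)) nuE muE (sXS (erefl (r + 1))).2 ?cdiffK ?subr0.
have sf : sY p (f0 p y + mu p x) = mu p x.
  by rewrite raddfD /= smu (sYS hr).2 ?add0r.
rewrite sf.
rewrite addrK (raddfD (nu p)) (_ : nu p (f0 p y) = 0) ?add0r; last first.
  by rewrite -snu (sXS hr).2 // nuE f0d raddf0.
rewrite /y; zmod (X p).
Qed.
End BuildHomotopy.

Definition degreewise_split (X : cochain) :=
  forall p, projective (X p) /\ exists s : {additive X p -> X p}, splits_cocycles s.

(** The isomorphism of cohomology need not be given by a chain map: it is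
   expressed by the common family V of groups. *)
Theorem cohomology_homotopy_equivalent (X Y : cochain) (V : int -> zmodType) :
  degreewise_split X -> degreewise_split Y ->
  (forall p, full_computes X p (V p)) -> (forall p, full_computes Y p (V p)) ->
  homotopy_equivalent X Y.
Proof.
move=> Xs Ys XV YV.
pose sX p := projT1 (cid (Xs p).2); pose sY p := projT1 (cid (Ys p).2).
have sXS p : splits_cocycles (sX p) by rewrite /sX; case: cid.
have sYS p : splits_cocycles (sY p) by rewrite /sY; case: cid.
have flex (Z : cochain) p : full_computes Z p (V p) -> exists t : {additive Z p -> V p},
    [/\ forall (q : int) (h : q + 1 = p) x, t (cdiff Z h x) = 0,
        forall (q r : int) (h : q + 1 = p) (h' : p + 1 = r) z,
          cdiff Z h' z = 0 -> t z = 0 -> exists y, cdiff Z h y = z &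
        forall (r : int) (h' : p + 1 = r) v, exists2 z, cdiff Z h' z = 0 & t z = v].
  case=> t [tK tB tS]; exists t.
  have deg q (h : q + 1 = p) : p - 1 = q by rewrite -h addrK.
  split=> [q h x|q r h h' z dz tz|r h' v].
  - have e := deg q h; case: q / e h x => h x; apply: tB; exists x => //.
    by rewrite (Prop_irrelevance h (subrK 1 p)).
  - have e := deg q h; case: q / e h => h; case: r / h' dz => dz.
    by have [y _ yz] := tK z (conj I dz) tz; exists y; rewrite (Prop_irrelevance h (subrK 1 p)).
  - by case: r / h'; have [z [_ dz] zv] := tS v; exists z.
pose tX p := projT1 (cid (flex _ _ (XV p))); pose tY p := projT1 (cid (flex _ _ (YV p))).
have tXP p : _ := projT2 (cid (flex _ _ (XV p))); have tYP p : _ := projT2 (cid (flex _ _ (YV p))).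
have [f0 [mu [f0d f0t muE smu]]] : _ := @build_map X Y V sX sY sXS sYS (fun p => (Xs p).1) tX tY
  (fun q p => let: And3 B _ _ := tXP p in B q)
  (fun q p => let: And3 _ K _ := tYP p in K q)
  (fun p => let: And3 _ _ onto := tYP p in onto).
have [g0 [nu [g0d g0t nuE snu]]] : _ := @build_map Y X V sY sX sYS sXS (fun p => (Ys p).1) tY tX
  (fun q p => let: And3 B _ _ := tYP p in B q)
  (fun q p => let: And3 _ K _ := tXP p in K q)
  (fun p => let: And3 _ _ onto := tXP p in onto).
exists (built sX f0 mu), (built sY g0 nu); split.
- exact: (built_map sXS sYS f0d muE smu).
- exact: (built_map sYS sXS g0d nuE snu).
- apply: (@built_homotopic X Y V sX sY sXS sYS (fun p => (Xs p).1) tX tY) => //.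
  by move=> q p; case: (tXP p) => _ K _; apply: K.
- apply: (@built_homotopic Y X V sY sX sYS sXS (fun p => (Ys p).1) tY tX) => //.
  by move=> q p; case: (tYP p) => _ K _; apply: K.
Qed.

(** * Splitting off the cocycles of a free complex *)

(** The image of phi is generated by its least positive element, and a preimage of
   this generator spans a complement of the kernel of phi.  In this way
   kernels split off without any appeal to the structure of subgroups of free
   groups. *)
Lemma split_functional (X : zmodType) (phi : {additive X -> int}) :
  exists t : {additive X -> X}, (forall x, phi (t x) = phi x) /\ forall x, phi x = 0 -> t x = 0.
Proof.
have [phi0|] := pselect (forall x, phi x = 0).
  by exists \0; split=> x; rewrite /= ?raddf0 ?phi0.
move=> /existsNP[x0 /eqP x00].
pose P k := `[< exists2 x, phi x = k.+1%:Z & True >].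
have exP : exists k, P k.
  exists (absz (phi x0)).-1; apply/asboolP.
  rewrite prednK ?absz_gt0 //; have [p0|p0] := leP 0 (phi x0).
    by exists x0 => //; rewrite gez0_abs.
  by exists (- x0) => //; rewrite raddfN ltz0_abs.
case: (ex_minnP exP) => k /asboolP[x1 x1k _] kmin.
have dvd x : phi x = (phi x %/ k.+1)%Z * k.+1.
  suff m0 : (phi x %% k.+1)%Z = 0 by rewrite [LHS](divz_eq _ k.+1) m0 addr0.
  have r0 := modz_ge0 (phi x) (isT : k.+1%:Z != 0).
  have rk := ltz_pmod (phi x) (isT : 0 < k.+1%:Z).
  case E : (phi x %% k.+1)%Z r0 rk => [[|r]|r] // _ rk.
  have /kmin : P r.
    apply/asboolP; exists (x - x1 *~ (phi x %/ k.+1)%Z) => //.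
    by rewrite raddfB raddfMz x1k -E /modz mulrzz mulrC.
  by move=> kr; move: rk; rewrite ltz_nat ltnS ltnNge kr.
have tB : zmod_morphism (fun x => x1 *~ (phi x %/ k.+1)%Z).
  move=> x y; rewrite -mulrzBr; congr (_ *~ _).
  by apply: (@mulIf _ k.+1%:Z) => //; rewrite -dvd mulrBl -!dvd raddfB.
exists (mk_additive tB); split=> x /=.
  by rewrite raddfMz x1k mulrzz mulrC -dvd.
by move=> ->; rewrite div0z mulr0z.
Qed.

(** After splitting off phi_n, the other functionals are considered on the kernel of
   phi_n, onto which r projects. *)
Lemma split_functionals (X : zmodType) n (phi : nat -> {additive X -> int}) :
  exists s : {additive X -> X}, (forall i x, (i < n)%N -> phi i (s x) = phi i x) /\
    forall x, (forall i, (i < n)%N -> phi i x = 0) -> s x = 0.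
Proof.
elim: n phi => [|n IH] phi; first by exists \0.
have [t [tE t0]] := split_functional (phi n).
pose r : {additive X -> X} := idfun \- t.
have rE x : r x = x - t x by [].
have [s [sE s0]] := IH (fun i => phi i \o r).
have phir x : phi n (r x) = 0 by rewrite rE raddfB tE subrr.
have rr x : r (r x) = r x by rewrite [LHS]rE t0 ?subr0.
exists (t \+ (r \o s \o r)); split=> [i x ilt|x x0].
  rewrite -[X in phi i X]/(t x + r (s (r x))) raddfD.
  move: ilt; rewrite ltnS leq_eqVlt => /orP[/eqP ->|ilt].
    by rewrite tE phir addr0.
  have E : phi i (r (s (r x))) = phi i (r (r x)) := sE i (r x) ilt.
  by rewrite E rr -raddfD rE addrC subrK.
rewrite -[LHS]/(t x + r (s (r x))) t0 ?x0 // add0r.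
rewrite s0 ?raddf0 // => i ilt.
rewrite -[LHS]/(phi i (r (r x))) rr.
by rewrite rE raddfB t0 ?x0 // ?raddf0 ?subr0 // ltnS ltnW.
Qed.

Lemma split_rV (X : zmodType) r (g : {additive X -> 'rV[int]_r}) :
  exists s : {additive X -> X}, (forall x, g (s x) = g x) /\ forall x, g x = 0 -> s x = 0.
Proof.
have cB i : zmod_morphism (fun x => if insub i is Some j then g x 0 (j : 'I_r) else 0 : int).
  by move=> x y; case: insubP => [j _ _|_]; rewrite ?subrr // raddfB !mxE.
have [s [sE s0]] := split_functionals r (fun i => mk_additive (cB i)).
exists s; split=> x.
  by apply/rowP => j; have := sE j x (ltn_ord j); rewrite /= valK.
move=> gx0; apply: s0 => i ilt /=; rewrite insubT /= gx0 mxE //.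
Qed.

Lemma fg_free_split (C : cochain) : (forall p, fg_free (C p)) -> degreewise_split C.
Proof.
move=> Cf p; split.
  have [r [f /bij_additive[g fK gK]]] := Cf p.
  by apply: (projective_retract fK); apply: projective_rV.
have [r [f /bij_additive[g fK gK]]] := Cf (p + 1).
have [s [sE s0]] := split_rV (f \o cdiff C (erefl (p + 1))).
exists s => q h; case: q / h; split=> x.
  by apply: (can_inj fK); apply: sE.
by move=> dx; apply: s0; rewrite /= dx raddf0.
Qed.

(** * The elementary complex *)

Lemma zquot1 (r : int) : exists c : {additive int -> Zquot [:: r]},
  (forall v, exists k, c k = v) /\ forall k, c k = 0 <-> exists q, k = r * q.
Proof.
exists (\pi_(Zquot [:: r]) : {additive int -> _}); split=> [v|k].
  by exists (repr v); apply: reprK.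
split=> [/pi_eq0|[q ->]]; last first.
  by apply/pi_eq0; rewrite inE; exists (fun=> q); rewrite big_ord1 mulrC.
by rewrite inE => -[c ->]; exists (c ord0); rewrite big_ord1 mulrC.
Qed.

Section Elementary.
Variables (A : choiceType) (d : A -> int) (n : A -> nat).

(** The generators are F_a = (a, true) in degree d a and R_a = (a, false) in degree
   d a - 1, with d R_a = n a * F_a.  If n a = 0 then R_a is left out
   ([cvalid]), since it would contribute to the cohomology. *)
Definition cell : choiceType := (A * bool)%type.
Definition cdeg (e : cell) : int := if e.2 then d e.1 else d e.1 - 1.
Definition cvalid (e : cell) := e.2 || (n e.1 != 0%N).
Definition cell_in p : pred cell := fun e => (cdeg e == p) && cvalid e.
Definition cells p : choiceType := {e : cell | cell_in p e}.
Definition egrp p : zmodType := {freeg (cells p)}.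

(** Cells that are invalid or of another degree are sent to 0, so that formulas
   for the differential have no side conditions. *)
Definition gen p (e : cell) : egrp p := if insub e : option (cells p) is Some b then << b >> else 0.

Lemma gen_cell p (b : cells p) : gen p (val b) = << b >>.
Proof. by rewrite /gen valK. Qed.

Lemma gen_out p e : ~~ cell_in p e -> gen p e = 0.
Proof. by move=> h; rewrite /gen insubN. Qed.

Definition ediff_cell p q (b : cells p) : egrp q :=
  if (val b).2 then 0 else gen q ((val b).1, true) *~ n (val b).1.

Definition ediff p q (h : p + 1 = q) : {additive egrp p -> egrp q} := freeg_lift (@ediff_cell p q).

Lemma ediff_gen p q (h : p + 1 = q) e :
  ediff h (gen p e) = if e.2 then 0 else gen q (e.1, true) *~ n e.1.
Proof.
rewrite /gen; case: insubP => [b _ <-|]; first exact: freeg_liftE.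
rewrite raddf0 negb_and /cdeg /cvalid; case: e => a [] //=.
rewrite negbK => /orP[ep|/eqP ->]; last by rewrite mulr0z.
case: insubP => [b /andP[/eqP h1 _] _|]; last by rewrite mul0rz.
by case/negP: ep; rewrite (h1 : d a = q) -h addrK.
Qed.

Fact ediffK p q r (h : p + 1 = q) (h' : q + 1 = r) x : ediff h' (ediff h x) = 0.
Proof.
apply: (freeg_ext (f := ediff h' \o ediff h) (g := \0)) => b.
rewrite -[LHS]/(ediff h' (ediff h << b >>)) -[RHS]/0.
by rewrite -gen_cell !ediff_gen; case: ifP => _; rewrite ?raddf0 // raddfMz ediff_gen mul0rz.
Qed.

Definition elementary : cochain := Cochain ediffK.

Definition ecoeff p (e : cell) : {additive egrp p -> int} :=
  freeg_lift (fun b : cells p => (val b == e)%:Z).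

Lemma ecoeff_gen p e e' : ecoeff p e (gen p e') = ((e' == e) && cell_in p e')%:Z.
Proof.
rewrite /gen; case: insubP => [b be <-|/negPf ->]; last by rewrite raddf0 andbF.
by rewrite freeg_liftE (valP b) andbT.
Qed.

Lemma ecoeff_out p e x : ~~ cell_in p e -> ecoeff p e x = 0.
Proof.
move=> eN; apply: (freeg_ext (g := \0)) => b; rewrite freeg_liftE /=.
by case: eqP => // be; move: (valP b); rewrite /= be (negPf eN).
Qed.

Lemma ecoeff_diff p q (h : p + 1 = q) e x :
  ecoeff q e (ediff h x) = if e.2 then ecoeff p (e.1, false) x * n e.1 else 0.
Proof.
have FB : zmod_morphism (fun x => if e.2 then ecoeff p (e.1, false) x * n e.1 else 0 : int).
  by move=> u v; case: ifP => _; rewrite ?subrr // raddfB mulrBl.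
apply: (freeg_ext (f := ecoeff q e \o ediff h) (g := mk_additive FB)) => b.
rewrite -[LHS]/(ecoeff q e (ediff h << b >>)) -[RHS]/(if e.2 then _ else 0).
rewrite -gen_cell ediff_gen ecoeff_gen (valP b) andbT.
move: (val b) (valP b) => [a [|]] /andP[/eqP bd _]; rewrite [(a, _).2]/=.
  by rewrite (raddf0 (ecoeff q e)); case: e {FB} => a' [|] //=; rewrite xpair_eqE andbF mul0r.
rewrite (raddfMz (ecoeff q e)) ecoeff_gen /cell_in /cvalid /= andbT.
have -> : cdeg (a, true) == q by rewrite -h -bd /cdeg /= subrK.
case: e {FB} => a' [|] /=; rewrite !xpair_eqE ?andbT ?andbF ?mul0rz //=.
by case: eqP => [->|_]; rewrite ?mul0rz ?mul0r // mulrzz.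
Qed.

Lemma ecoeff_cell p (b : cells p) x : ecoeff p (val b) x = coeff b x.
Proof.
apply: (freeg_ext (g := coeff b)) => b'.
rewrite freeg_liftE -[RHS]/(coeff b << b' >>) coeffU mul1r (inj_eq val_inj).
by case: eqP.
Qed.

Lemma ecoeff_eq0 p (x : egrp p) : (forall e, ecoeff p e x = 0) -> x = 0.
Proof.
move=> x0; rewrite [x]freeg_decomp big1 // => b _.
by rewrite -ecoeff_cell x0 mulr0z.
Qed.

(** The projection onto the span of the cells R_a, which is a complement of the
   cocycles because n a <> 0 for every valid R_a. *)
Definition ebot p : {additive egrp p -> egrp p} :=
  freeg_lift (fun b : cells p => if (val b).2 then 0 else << b >> : egrp p).

Lemma ecoeff_ebot p e x : ecoeff p e (ebot p x) = if e.2 then 0 else ecoeff p e x.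
Proof.
have FB : zmod_morphism (fun x => if e.2 then 0 else ecoeff p e x : int).
  by move=> u v; case: ifP => _; rewrite ?subrr // raddfB.
apply: (freeg_ext (f := ecoeff p e \o ebot p) (g := mk_additive FB)) => b.
rewrite -[LHS]/(ecoeff p e (ebot p << b >>)) -[RHS]/(if e.2 then 0 else _).
rewrite [ebot p _]freeg_liftE; case: ifP => b2; last first.
  by rewrite freeg_liftE; case: eqP => [<-|_]; rewrite ?b2 // if_same.
rewrite (raddf0 (ecoeff p e)) freeg_liftE.
by case: eqP => [<-|_]; rewrite ?b2 // if_same.
Qed.

Lemma elementary_split : degreewise_split elementary.
Proof.
move=> p; split; first exact: projective_freeg.
exists (ebot p) => q h; split=> x.
  apply/eqP; rewrite -subr_eq0; apply/eqP; apply: ecoeff_eq0 => e.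
  rewrite raddfB !ecoeff_diff ecoeff_ebot /=; case: ifP => _; rewrite subrr //.
move=> dx; apply: ecoeff_eq0 => -[a b]; rewrite ecoeff_ebot; case: b => //=.
have := congr1 (ecoeff q (a, true)) dx; rewrite raddf0 ecoeff_diff /= => /eqP.
rewrite mulf_eq0 => /orP[/eqP //|/eqP n0].
apply: ecoeff_out; rewrite /cell_in /cvalid /= negb_and.
by rewrite negbK -eqz_nat n0 eqxx orbT.
Qed.

Section Cohomology.
Variables (H : A -> zmodType) (hH : forall a, zmod_iso (H a) (Zquot [:: (n a)%:Z])).
Variable p : int.

Lemma cyclic_lift a : exists c : {additive int -> H a},
  (forall v, exists k, c k = v) /\ forall k, c k = 0 <-> (n a %| k)%Z.
Proof.
have [f /bij_additive[g fK gK]] := hH a; have [pr [prS pr0]] := zquot1 (n a).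
exists (g \o pr); split=> [v|k] /=.
  by have [k kE] := prS (f v); exists k; rewrite kE fK.
rewrite -(raddf0 g); split=> [/(can_inj gK)/pr0[q ->]|/dvdzP[q ->]].
  by rewrite dvdz_mulr.
by congr (g _); apply/pr0; exists q; rewrite mulrC.
Qed.

Definition cyc a := projT1 (cid (cyclic_lift a)).
Lemma cyc_surj a v : exists k, cyc a k = v.
Proof. exact: (projT2 (cid (cyclic_lift a))).1. Qed.
Lemma cyc_eq0 a k : cyc a k = 0 <-> (n a %| k)%Z.
Proof. exact: (projT2 (cid (cyclic_lift a))).2. Qed.

Local Notation V := (fun a : {a : A | d a = p} => H (sval a)).

Definition eclass_fun (x : egrp p) : forall a, V a :=
  fun a => cyc (sval a) (ecoeff p (sval a, true) x).

Fact eclass_finite x : finite_set [set a | eclass_fun x a <> 0].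
Proof.
have inj : {in setT &, injective (fun a : {a : A | d a = p} => (sval a, true) : cell)}.
  by move=> [a ha] [b hb] _ _ /= [] ab; subst b; rewrite (Prop_irrelevance ha hb).
have fin : finite_set ((fun a : {a : A | d a = p} => (sval a, true) : cell) @^-1`
    [set` [seq val b | b <- dom x]]).
  by apply: finite_preimage (finite_seq _) => a b _ _; apply: inj; rewrite inE.
apply: sub_finite_set fin => a /= xa; apply: contrapT => /negP aN; apply: xa.
rewrite /eclass_fun (_ : ecoeff _ _ _ = 0) ?raddf0 //.
have [ac|aN'] := boolP (cell_in p (sval a, true)); last exact: ecoeff_out.
have -> : (sval a, true) = val (exist _ (sval a, true) ac : cells p) by [].
rewrite ecoeff_cell coeff_outdom //.
by apply: contra aN => b; apply/mapP; exists (exist _ (sval a, true) ac).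
Qed.

Fact eclass_additive : zmod_morphism (fun x => mk_dsum (eclass_finite x) : dsum V).
Proof. by move=> x y; apply: dsumP => a; rewrite dsum_funB /= /eclass_fun !raddfB. Qed.
Definition eclass : {additive egrp p -> dsum V} := mk_additive eclass_additive.

(** The cocycles are spanned by the F_a, and n a * F_a generates the coboundaries
   among the multiples of F_a. *)
Lemma elementary_cohomology : full_computes elementary p (dsum V).
Proof.
exists eclass; split=> [x [_ dx] x0|x [y _ <-]|v].
- pose P x := @is_cobord elementary (fun _ _ => True) p x.
  have PB x1 x2 : P x1 -> P x2 -> P (x1 - x2).
    by move=> [y1 _ <-] [y2 _ <-]; exists (y1 - y2); rewrite ?raddfB.
  have P0 : P 0 by exists 0; rewrite ?raddf0.
  rewrite -/(P x) [x]freeg_decomp; apply: subgroup_sum => // b.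
  rewrite -ecoeff_cell -gen_cell; move: (val b) (valP b) => [a [|]] /andP[/eqP bd bv].
    have /cyc_eq0/dvdzP[k ->] : cyc a (ecoeff p (a, true) x) = 0.
      by have := congr1 (fun u => dsum_fun u (exist _ a bd)) x0.
    exists (gen (p - 1) (a, false) *~ k) => //.
    rewrite raddfMz -[cdiff _ _ _]/(ediff (subrK 1 p) _) ediff_gen /=.
    by rewrite -mulrzA mulrC.
  have := congr1 (ecoeff (p + 1) (a, true)) dx; rewrite raddf0 ecoeff_diff /= => /eqP.
  rewrite mulf_eq0 => /orP[/eqP -> //|/eqP n0].
  by move: bv; rewrite /cvalid /= -eqz_nat n0 eqxx.
- apply: dsumP => -[a ad].
  rewrite -[LHS]/(cyc a (ecoeff p (a, true) (ediff (subrK 1 p) y))) ecoeff_diff.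
  by apply/cyc_eq0; rewrite dvdz_mull.
- pose Q v := exists2 z, is_cocycle (X := elementary) (fun _ _ => True) z & eclass z = v.
  have QB v1 v2 : Q v1 -> Q v2 -> Q (v1 - v2).
    move=> [z1 [_ dz1] <-] [z2 [_ dz2] <-]; exists (z1 - z2); last by rewrite raddfB.
    by split=> //; rewrite raddfB dz1 dz2 subrr.
  have Q0 : Q 0 by exists 0; rewrite ?raddf0 //; split=> //; rewrite raddf0.
  rewrite -/(Q v); have [s ->] := dsum_decomp v; apply: subgroup_sum => // -[a ad].
  have [k <-] := cyc_surj (dsum_fun v (exist _ a ad)).
  exists (gen p (a, true) *~ k).
    split=> //; rewrite raddfMz -[cdiff _ _ _]/(ediff (erefl (p + 1)) _) ediff_gen /=.
    by rewrite mul0rz.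
  apply: dsumP => -[a' ad'].
  rewrite -[LHS]/(cyc a' (ecoeff p (a', true) (gen p (a, true) *~ k))) raddfMz ecoeff_gen.
  have -> : cell_in p (a, true) by rewrite /cell_in /cvalid /cdeg /= ad eqxx.
  rewrite xpair_eqE eqxx !andbT; case: eqP => [aa'|aa'].
    subst a'; rewrite (Prop_irrelevance ad' ad) dsum_singleE.
    by congr (cyc a _); rewrite intz.
  rewrite mul0rz raddf0 dsum_single_neq // => -[] //.
Qed.
End Cohomology.
End Elementary.

(** * Signs and the arithmetic of a diagonal block *)

Definition sg (i : int) : int := (-1) ^ i.

Lemma sgD i j : sg (i + j) = sg i * sg j.
Proof. exact: exprzDr. Qed.
Lemma sg_sq i : sg i * sg i = 1.
Proof. by rewrite /sg expN1r -expr2 sqrr_sign. Qed.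
Lemma sg1 : sg 1 = -1.
Proof. by []. Qed.

(** The parity of i comes with its witness, a form in which linear arithmetic over the
   integers can use it. *)
Definition is_sign (i s : int) :=
  (exists k, i = 2 * k) /\ s = 1 \/ (exists k, i = 2 * k + 1) /\ s = -1.

Lemma sgP i : is_sign i (sg i).
Proof.
have [k ik] : exists k, i = 2 * k \/ i = 2 * k + 1.
  by exists (i %/ 2)%Z; have := divz_eq i 2; lia.
have k2 : sg (2 * k) = 1 by rewrite (_ : 2 * k = k + k) ?sgD ?sg_sq //; ring.
case: ik => ->; [left|right]; split; try by exists k.
  exact: k2.
by rewrite sgD k2.
Qed.

(** A cocycle of degree m in the block of a single element, of degree d and
   order n, has four coefficients: ff, fr, rf, rr at F (x) F, F (x) R, R (x) F
   and R (x) R; here s and e are the signs of m and d.  After the sign conditions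
   come the degrees in which each coefficient can be nonzero, the cocycle equations,
   and the vanishing of the form which detects the summand in degree m, in the case
   at hand; the conclusion is the system of equations for a primitive of degree
   m - 1.  For odd n in high degrees nothing has to vanish, because 2 is invertible
   modulo n: the primitive then absorbs a parity. *)
Lemma single_exact (n d m s e ff fr rf rr : int) :
  is_sign m s -> is_sign d e ->
  (ff <> 0 -> 2 * d <= m) ->
  (fr <> 0 -> n <> 0 /\ 2 * d - 1 <= m) ->
  (rf <> 0 -> n <> 0 /\ 2 * d - 1 <= m) ->
  (rr <> 0 -> n <> 0 /\ 2 * d - 2 <= m) ->
  ff * (1 - s * e) - s * n * (rf + e * fr) = 0 ->
  rf + s * fr - s * e * n * rr = 0 ->
  fr + s * rf + s * n * rr = 0 ->
  rr * (1 + s * e) = 0 ->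
  (m = 2 * d -> s = e -> n = 0 -> ff = 0) ->
  (m = 2 * d -> s = e -> forall h, n = 2 * h -> exists q, ff - n * rf = 2 * n * q) ->
  (m = 2 * d -> s = e -> forall h, n = 2 * h + 1 -> exists q, ff = n * q) ->
  (2 * d < m -> s = e -> forall h, n = 2 * h -> exists q, ff = 2 * q) ->
  (m = 2 * d - 1 -> e = -1 -> n <> 0 -> exists q, rf = n * q) ->
  (2 * d - 1 <= m -> s = - e -> n <> 0 -> forall h, n = 2 * h -> exists q, rr = 2 * q) ->
  exists yff yfr yrf yrr,
  [/\ [/\ yff <> 0 -> 2 * d <= m - 1,
      yfr <> 0 -> n <> 0 /\ 2 * d - 1 <= m - 1,
      yrf <> 0 -> n <> 0 /\ 2 * d - 1 <= m - 1 &
      yrr <> 0 -> n <> 0 /\ 2 * d - 2 <= m - 1],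
  yff * (1 + s * e) + s * n * (yrf + e * yfr) = ff,
  yrf - s * yfr + s * e * n * yrr = rf,
  yfr - s * yrf - s * n * yrr = fr &
  yrr * (1 - s * e) = rr].
Proof.
rewrite /is_sign => hs he vff vfr vrf vrr D1 D2 D3 D4 F1 F2 F3 F4 F5 F6.
have [se|se] : s = e \/ s = - e by lia.
- have s2 : s * s = 1 by lia.
  rewrite se in s2 D1 D2 D3 D4 F1 F2 F3 F4 *; rewrite s2 in D2 D4 *.
  have rr0 : rr = 0 by lia.
  have fr_rf : fr = - e * rf by case: he => -[_ e1]; rewrite e1 in D3 *; lia.
  have [mlt|[meq|[meq1|mlt]]] : 2 * d < m \/ m = 2 * d \/ m = 2 * d - 1 \/ m < 2 * d - 1 by lia.
  + have [n00|nn] : n = 0 \/ n <> 0 by lia.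
      have [q ffq] := F4 mlt erefl 0 n00.
      have rf0 : rf = 0 by lia.
      by exists q, 0, 0, 0; rewrite fr_rf rf0 rr0 n00 ffq; split; [split|..]; lia.
    have [h [nh|nh]] : exists h, n = 2 * h \/ n = 2 * h + 1.
      by exists (n %/ 2)%Z; have := divz_eq n 2; lia.
    + have [q ffq] := F4 mlt erefl h nh.
      exists (q - e * h * rf), 0, rf, 0; rewrite rr0 fr_rf; split; [split; lia|..]; rewrite ?ffq ?nh; ring.
    (* n is odd: a correction r at R (x) R makes the remaining coefficient even. *)
    + have [r [r' [rE r01]]] : exists r r', ff - e * n * (rf - n * r) = 2 * r' /\ (r = 0 \/ r = 1).
        have [z [zE|zE]] : exists z, ff - e * n * rf = 2 * z \/ ff - e * n * rf = 2 * z + 1.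
          exists ((ff - e * n * rf) %/ 2)%Z; have := divz_eq (ff - e * n * rf) 2; lia.
        - exists 0, z; split; [lia | by left].
        - exists 1; case: he => -[_ e1]; rewrite e1 nh in zE *.
            exists (z + 2 * h * h + 2 * h + 1); split; [lia | by right].
          exists (z - 2 * h * h - 2 * h); split; [lia | by right].
      exists r', 0, (rf - n * r), r; rewrite rr0 fr_rf; split; [split; lia|..].
      * case: he => -[_ e1]; rewrite e1 in rE *; lia.
      * lia.
      * case: he => -[_ e1]; rewrite e1 in rE *; lia.
      * lia.
  + have e1 : e = 1 by case: hs => -[[k mk] s1]; lia.
    rewrite e1 in fr_rf *; have [n00|nn] : n = 0 \/ n <> 0 by lia.
      have ff0 := F1 meq erefl n00; have rf0 : rf = 0 by lia.
      by exists 0, 0, 0, 0; rewrite fr_rf rf0 rr0 n00 ff0; split; [split|..]; lia.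
    have [h [nh|nh]] : exists h, n = 2 * h \/ n = 2 * h + 1.
      by exists (n %/ 2)%Z; have := divz_eq n 2; lia.
    + have [q ffq] := F2 meq erefl h nh.
      exists 0, q, (rf + q), 0; rewrite rr0 fr_rf; split; [split; lia|..]; lia.
    + have [q ffq] := F3 meq erefl h nh.
      have [z [zE|zE]] : exists z, q + rf = 2 * z \/ q + rf = 2 * z + 1.
        by exists ((q + rf) %/ 2)%Z; have := divz_eq (q + rf) 2; lia.
      * exists 0, (q - z), z, 0; rewrite rr0 fr_rf ffq; split; [split; lia|..]; lia.
      (* n = 2 h + 1 turns the odd number q + rf into the even number q + rf - n. *)
      * exists 0, (q - z + h), (z - h), 1; rewrite rr0 fr_rf ffq; split; [split; lia|..]; lia.
  + have e1 : e = -1 by case: hs => -[[k mk] s1]; lia.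
    rewrite e1 in fr_rf *; have ff0 : ff = 0 by lia.
    have [n00|nn] : n = 0 \/ n <> 0 by lia.
      have rf0 : rf = 0 by lia.
      by exists 0, 0, 0, 0; rewrite fr_rf rf0 rr0 n00 ff0; split; [split|..]; lia.
    have [q rfq] := F5 meq1 e1 nn.
    exists 0, 0, 0, q; rewrite rr0 fr_rf ff0 rfq; split; [split; lia|..]; lia.
  + have ff0 : ff = 0 by lia.
    have rf0 : rf = 0 by lia.
    by exists 0, 0, 0, 0; rewrite fr_rf rf0 rr0 ff0; split; [split|..]; lia.
- have s2 : s * s = 1 by lia.
  have es : e = - s by lia.
  rewrite es in D1 D2 D4 *.
  have [n00|nn] : n = 0 \/ n <> 0 by lia.
    have [rf0 fr0 rr0] : [/\ rf = 0, fr = 0 & rr = 0] by split; lia.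
    have ff0 : ff = 0 by move: D1; rewrite n00; lia.
    by exists 0, 0, 0, 0; rewrite fr0 rf0 rr0 ff0 n00; split; [split|..]; lia.
  have D2' : rf = - s * fr - n * rr.
    by move: D2; rewrite mulrN mulNr s2; lia.
  have D1' : 2 * ff = 2 * s * n * rf + s * n * n * rr.
    by case: hs => -[_ s1]; rewrite s1 in D1 D2' *; lia.
  have [mlt|mge] : m < 2 * d - 1 \/ 2 * d - 1 <= m by lia.
    have [rf0 fr0 ff0] : [/\ rf = 0, fr = 0 & ff = 0] by split; lia.
    have /eqP : n * rr = 0 by lia.
    rewrite mulf_eq0 => /orP[/eqP|/eqP rr0] //.
    by exists 0, 0, 0, 0; rewrite fr0 rf0 rr0 ff0; split; [split|..]; lia.
  have [q rrq] : exists q, rr = 2 * q.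
    have [h [nh|nh]] : exists h, n = 2 * h \/ n = 2 * h + 1.
      by exists (n %/ 2)%Z; have := divz_eq n 2; lia.
    + by apply: (F6 mge _ nn h nh); lia.
    + exists (s * (ff - s * n * rf) - (2 * h * h + 2 * h) * rr).
      by case: hs => -[_ s1]; rewrite s1 nh in D1' *; lia.
  have ffE : ff = s * n * (rf + n * q) by move: D1'; rewrite rrq; lia.
  exists 0, 0, (rf + n * q), q; split; [split|..].
  + by [].
  + by [].
  + move=> nz; split=> //; have [|meq] : 2 * d <= m \/ m = 2 * d - 1 by lia.
      by lia.
    have ff0 : ff = 0 by lia.
    case: nz; move: ffE; rewrite ff0 => /esym/eqP; rewrite !mulf_eq0 => /orP[/orP[|]|] /eqP //.
      by lia.
  + by move=> _; split=> //; lia.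
  + by rewrite ffE; ring.
  + have -> : s * - s = -1 by lia.
    by ring.
  + rewrite rrq in D2'; case: hs => -[_ s1]; rewrite s1 in D2' *; lia.
  + have -> : s * - s = -1 by lia.
    by rewrite rrq; ring.
Qed.

(** * The arithmetic of a block of two elements *)

(** The block of two elements of orders n and n' with degrees adding up to D: v
   collects the coefficients at the products of a generator of the first element
   with one of the second, and w those at the products in the opposite order,
   carried over by the action of C_2.  In these coordinates C_2 exchanges v and w,
   so the block is coinduced and has no cohomology in degrees m > D: the
   primitive has p = 0 and q equal to v up to signs.  In lower degrees some of the
   coefficients of a primitive lie outside the first quadrant, and the
   cohomology is that of the tensor product of the two elementary complexes. *)
Lemma pair_exact (n n' D m s g : int) (vff vrf vfr vrr wff wrf wfr wrr : int) :
  is_sign (m - D) s -> g * g = 1 ->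
  (vff <> 0 -> D <= m) -> (wff <> 0 -> D <= m) ->
  (vrf <> 0 -> n <> 0 /\ D - 1 <= m) -> (wrf <> 0 -> n <> 0 /\ D - 1 <= m) ->
  (vfr <> 0 -> n' <> 0 /\ D - 1 <= m) -> (wfr <> 0 -> n' <> 0 /\ D - 1 <= m) ->
  (vrr <> 0 -> n <> 0 /\ n' <> 0 /\ D - 2 <= m) ->
  (wrr <> 0 -> n <> 0 /\ n' <> 0 /\ D - 2 <= m) ->
  vff - s * wff - s * (n * vrf + g * n' * vfr) = 0 ->
  wff - s * vff - s * (n * wrf + g * n' * wfr) = 0 ->
  vrf + s * wrf - s * g * n' * vrr = 0 ->
  wrf + s * vrf - s * g * n' * wrr = 0 ->
  vfr + s * wfr + s * n * vrr = 0 ->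
  wfr + s * vfr + s * n * wrr = 0 ->
  vrr - s * wrr = 0 ->
  (m = D -> exists a b, vff = n * a + n' * b) ->
  (m = D - 1 -> n <> 0 -> n' <> 0 -> exists t, vrf = n' * t /\ vfr = - g * n * t) ->
  exists pff prf pfr prr qff qrf qfr qrr,
  [/\ [/\ pff <> 0 -> D <= m - 1, qff <> 0 -> D <= m - 1,
      prf <> 0 -> n <> 0 /\ D - 1 <= m - 1 & qrf <> 0 -> n <> 0 /\ D - 1 <= m - 1],
    [/\ pfr <> 0 -> n' <> 0 /\ D - 1 <= m - 1, qfr <> 0 -> n' <> 0 /\ D - 1 <= m - 1,
      prr <> 0 -> n <> 0 /\ n' <> 0 /\ D - 2 <= m - 1 &
      qrr <> 0 -> n <> 0 /\ n' <> 0 /\ D - 2 <= m - 1],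
    [/\ pff + s * qff + s * (n * prf + g * n' * pfr) = vff,
      qff + s * pff + s * (n * qrf + g * n' * qfr) = wff,
      prf - s * qrf + s * g * n' * prr = vrf &
      qrf - s * prf + s * g * n' * qrr = wrf] &
    [/\ pfr - s * qfr - s * n * prr = vfr,
      qfr - s * pfr - s * n * qrr = wfr,
      prr + s * qrr = vrr & qrr + s * prr = wrr]].
Proof.
rewrite /is_sign => hs gg vff0 wff0 vrf0 wrf0 vfr0 wfr0 vrr0 wrr0 D1 D2 D3 D4 D5 D6 D7 F1 F2.
have s1 : s = 1 \/ s = -1 by lia.
have ss : s * s = 1 by lia.
have [mlt|[meq|[meq1|[meq2|mlt]]]] : D < m \/ m = D \/ m = D - 1 \/ m = D - 2 \/ m < D - 2 by lia.
{ exists 0, 0, 0, 0, (s * vff), (- s * vrf), (- s * vfr), (s * vrr).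
  split; split; try by [].
  + lia.
  + by move=> h; have /vrf0[] : vrf <> 0 by [move=> v0; apply: h; rewrite v0 mulr0]; lia.
  + by move=> h; have /vfr0[] : vfr <> 0 by [move=> v0; apply: h; rewrite v0 mulr0]; lia.
  + move=> h; have /vrr0[] : vrr <> 0 by move=> v0; apply: h; rewrite v0 mulr0.
    by lia.
  all: case: s1 => s1; rewrite s1 in D1 D2 D3 D4 D5 D6 D7 *; lia. }
{ have {}s1 : s = 1 by case: hs => -[[k mk] ?] //; lia.
  rewrite s1 in D1 D2 D3 D4 D5 D6 D7 *.
  have [a [b [ab [a0 b0]]]] : exists a b, vff = n * a + n' * b /\
     (a <> 0 -> n <> 0) /\ (b <> 0 -> n' <> 0).
    have [a [b ab]] := F1 meq.
    exists (if n == 0 then 0 else a), (if n' == 0 then 0 else b).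
    rewrite ab; case: eqP => [->|n0]; case: eqP => [->|n0']; split; try split; lia.
  exists 0, a, (g * b), 0, 0, (a - vrf), (g * b - vfr), vrr; split; split; try by [].
  + by move=> h; split; [apply: a0|lia].
  + move=> h; split; last by lia.
    have [az|az] : a <> 0 \/ a = 0 by lia.
      exact: a0.
    by have /vrf0[] : vrf <> 0 by lia.
  + move=> h; split; last by lia.
    by apply: b0 => b00; apply: h; rewrite b00 mulr0.
  + move=> h; split; last by lia.
    have [bz|bz] : b <> 0 \/ b = 0 by lia.
      exact: b0.
    by have /vfr0[] : vfr <> 0 by move=> v0; apply: h; rewrite bz v0; lia.
  + by move=> /vrr0; lia.
  + by rewrite ab; have -> : g * n' * (g * b) = n' * b * (g * g) by [ring]; rewrite gg; ring.
  + have : g * n' * (g * b) = n' * b * (g * g) by ring.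
    by rewrite gg; lia.
  all: lia. }
{ have {}s1 : s = -1 by case: hs => -[[k mk] ?] //; lia.
  rewrite s1 in D1 D2 D3 D4 D5 D6 D7 *.
  have [vf wf] : vff = 0 /\ wff = 0 by lia.
  have [n0|n0] : n = 0 \/ n <> 0 by lia.
    have [vr vr'] : vrf = 0 /\ vrr = 0 by split; lia.
    have vf' : vfr = 0.
      have [] : n' = 0 \/ n' <> 0 by [lia]; first by lia.
      move=> n0'; have /eqP : g * n' * vfr = 0 by lia.
      by rewrite !mulf_eq0; lia.
    by exists 0, 0, 0, 0, 0, 0, 0, 0; split; split; lia.
  have [n0'|n0'] : n' = 0 \/ n' <> 0 by lia.
    have [vr vr'] : vfr = 0 /\ vrr = 0 by split; lia.
    have vf' : vrf = 0.
      have /eqP : n * vrf = 0 by lia.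
      by rewrite !mulf_eq0; lia.
    by exists 0, 0, 0, 0, 0, 0, 0, 0; split; split; lia.
  have [t [t1 t2]] := F2 meq1 n0 n0'.
  exists 0, 0, 0, (- g * t), 0, 0, 0, (- vrr - g * t); split; split; try by [].
  + lia.
  + lia.
  + by rewrite vf; ring.
  + by rewrite wf; ring.
  + rewrite t1; have -> : -1 * g * n' * (- g * t) = n' * t * (g * g) by ring.
    by rewrite gg; ring.
  + have : -1 * g * n' * (- vrr - g * t) = g * n' * vrr + n' * t * (g * g) by ring.
    by rewrite gg; lia.
  + by rewrite t2; ring.
  + by rewrite t2 in D5; lia.
  + by ring.
  + lia.
}
{ have [[vf wf] [vr wr]] : (vff = 0 /\ wff = 0) /\ (vrf = 0 /\ wrf = 0) by split; lia.
  have [vf' wf'] : vfr = 0 /\ wfr = 0 by lia.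
  have s2 : s = 1 by case: hs => -[[k mk] ?] //; lia.
  rewrite s2 in D5 D7.
  have r0 : vrr = 0.
    have [] : n = 0 \/ n <> 0 by [lia]; first by lia.
    by move=> n0; have /eqP : n * vrr = 0 by [lia]; rewrite mulf_eq0; lia.
  by exists 0, 0, 0, 0, 0, 0, 0, 0; split; split; lia. }
have [[vf wf] [vr wr]] : (vff = 0 /\ wff = 0) /\ (vrf = 0 /\ wrf = 0) by split; lia.
have [[vf' wf'] [vr' wr']] : (vfr = 0 /\ wfr = 0) /\ (vrr = 0 /\ wrr = 0) by split; lia.
by exists 0, 0, 0, 0, 0, 0, 0, 0; split; split; lia.
Qed.

(** * Coordinates on the square of the elementary complex *)

Section Coefficients.
Variables (A : choiceType) (d : A -> int) (n : A -> nat).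
Local Notation E := (elementary d n).
Local Notation S := (std_complex (c2tensor_square E)).
Local Notation cell := (cell A).
Local Notation ecoeff := (ecoeff d n).
Local Notation cdeg := (cdeg d).
Implicit Types e f : cell.

Fact tcoef_Dl p q e f (x x' : E p) (y : E q) :
  ecoeff p e (x + x') * ecoeff q f y = ecoeff p e x * ecoeff q f y + ecoeff p e x' * ecoeff q f y.
Proof. by rewrite raddfD mulrDl. Qed.
Fact tcoef_Dr p q e f (x : E p) (y y' : E q) :
  ecoeff p e x * ecoeff q f (y + y') = ecoeff p e x * ecoeff q f y + ecoeff p e x * ecoeff q f y'.
Proof. by rewrite raddfD mulrDr. Qed.

Definition tcoef p q e f : {additive tensor (E p) (E q) -> int} :=
  tensor_lift (@tcoef_Dl p q e f) (@tcoef_Dr p q e f).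

Lemma tcoefE p q e f x y : tcoef p q e f (tens x y) = ecoeff p e x * ecoeff q f y.
Proof. exact: tensor_liftE. Qed.

Lemma tcoef_swap p q e f (t : tensor (E q) (E p)) :
  tcoef p q e f (tensor_swap _ _ t) = tcoef q p f e t.
Proof.
move: t; apply: tensor_eq => [x y|x y|x y]; rewrite ?raddfB //.
by rewrite tensor_swapE !tcoefE mulrC.
Qed.

Lemma tcoef_dl p q r (h : p + 1 = r) e f (t : tensor (E p) (E q)) :
  tcoef r q e f (tensor_map (cdiff E h) idfun t) =
  if e.2 then tcoef p q (e.1, false) f t * n e.1 else 0.
Proof.
move: t; apply: tensor_eq => [x y|x y|x y].
- by rewrite (raddfB (tensor_map _ _)) (raddfB (tcoef _ _ _ _)).
- by case: ifP => _; rewrite ?subrr // (raddfB (tcoef _ _ _ _)) mulrBl.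
rewrite tensor_mapE !tcoefE [ecoeff r e _](ecoeff_diff h e x).
by case: ifP => _; rewrite ?mul0r // mulrAC.
Qed.

Lemma tcoef_dr p q r (h : q + 1 = r) e f (t : tensor (E p) (E q)) :
  tcoef p r e f (tensor_map idfun (cdiff E h) t) =
  if f.2 then tcoef p q e (f.1, false) t * n f.1 else 0.
Proof.
move: t; apply: tensor_eq => [x y|x y|x y].
- by rewrite (raddfB (tensor_map _ _)) (raddfB (tcoef _ _ _ _)).
- by case: ifP => _; rewrite ?subrr // (raddfB (tcoef _ _ _ _)) mulrBl.
rewrite tensor_mapE !tcoefE [ecoeff r f _](ecoeff_diff h f y).
by case: ifP => _; rewrite ?mulr0 // mulrA.
Qed.

Lemma dsum_fun_sgnz (I : Type) (V : I -> zmodType) i (x : dsum V) u :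
  dsum_fun (sgnz i x) u = sgnz i (dsum_fun x u).
Proof.
have B : zmod_morphism (fun x : dsum V => dsum_fun x u) by [].
exact: (sgnz_raddf (mk_additive B)).
Qed.

(** In total degree m, the product e (x) f occurs in the single column
   m - deg e - deg f, so a cochain is described by one integer for every pair of
   cells. *)
Definition coef m e f (x : S m) : int :=
  tcoef (cdeg e) (cdeg f) e f
   (dsum_fun (dsum_fun x (Diag (subrK (cdeg e + cdeg f) m)) : tensor_square E _)
     (Diag (erefl (cdeg e + cdeg f)))).

Lemma coef_additive m e f : zmod_morphism (@coef m e f).
Proof. by move=> x y; rewrite /coef !dsum_funB raddfB. Qed.
HB.instance Definition _ m e f := GRing.isZmodMorphism.Build (S m) int (@coef m e f) (@coef_additive m e f).

Lemma coefE m e f (x : S m) i j (h1 : i + j = m) (h2 : cdeg e + cdeg f = j) :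
  coef e f x = tcoef (cdeg e) (cdeg f) e f
    (dsum_fun (dsum_fun x (Diag h1) : tensor_square E _) (Diag h2)).
Proof.
case: j / h2 h1 => h1; have Ei : m - (cdeg e + cdeg f) = i by rewrite -h1 addrK.
by case: i / Ei h1 => h1; rewrite /coef (Prop_irrelevance h1 (subrK _ m)).
Qed.

Lemma coefE_deg m e f (x : S m) i j p q (h1 : i + j = m) (h2 : p + q = j) :
  cdeg e = p -> cdeg f = q ->
  coef e f x = tcoef p q e f (dsum_fun (dsum_fun x (Diag h1) : tensor_square E _) (Diag h2)).
Proof. by move=> ep fq; subst p q; apply: coefE. Qed.

(** The differential of [std_complex] in coordinates; the column of e (x) f in
   degree m gives the sign s. *)
Definition dcoef (c : cell -> cell -> int) m e f : int :=
  let s := sg (m - (cdeg e + cdeg f)) in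
  c e f + s * sg (cdeg e * cdeg f) * c f e +
  s * ((if e.2 then c (e.1, false) f * n e.1 else 0) +
       sg (cdeg e) * (if f.2 then c e (f.1, false) * n f.1 else 0)).

Lemma sgnz_int i (k : int) : sgnz i k = sg i * k.
Proof. by rewrite /sgnz /sg mulrzz mulrC. Qed.

Lemma coef_diff m m' (h : m + 1 = m') (x : S m) e f :
  coef e f (cdiff S h x) = dcoef (fun e f => coef e f x) m' e f.
Proof.
set p := cdeg e; set q := cdeg f.
have h1 : m' - (p + q) + (p + q) = m' by rewrite subrK.
rewrite (coefE_deg _ h1 erefl erefl erefl) -/p -/q.
have d0 : (m' - (p + q) - 1) + (p + q) = m by rewrite -h; ring.
have d1 : m' - (p + q) + (p + q - 1) = m by rewrite -h; ring.
rewrite (std_diff_at _ _ _ (subrK 1 _) d0 (subrK 1 _) d1).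
set x0 := dsum_fun x _; set x1 := dsum_fun x _.
have hs : q + p = p + q by rewrite addrC.
rewrite (_ : dsum_fun (x0 + sgnz (m' - (p + q)) (act _ (p + q) x0) +
     sgnz (m' - (p + q)) (cdiff _ (subrK 1 (p + q)) x1)) (Diag erefl) =
   dsum_fun x0 (Diag erefl) + sgnz (m' - (p + q)) (dsum_fun (swap E _ x0) (Diag erefl)) +
     sgnz (m' - (p + q)) (dsum_fun (cdiff (tensor_square E) (subrK 1 (p + q)) x1) (Diag erefl))).
  have e0 : p - 1 + q = p + q - 1 by rewrite addrAC.
  have e1 : p + (q - 1) = p + q - 1 by rewrite addrA.
  rewrite (swapE x0 erefl hs) (sq_diff_at _ x1 _ (subrK 1 p) e0 (subrK 1 q) e1).
  rewrite !(raddfD (tcoef _ _ _ _)) !(sgnz_raddf (tcoef _ _ _ _)) tcoef_swap.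
  rewrite (raddfD (tcoef _ _ _ _)) !(sgnz_raddf (tcoef _ _ _ _)).
  rewrite !(@tcoef_dl _ _ _ (subrK 1 p)) !(@tcoef_dr _ _ _ (subrK 1 q)) !sgnz_int.
  rewrite /dcoef -/p -/q (coefE_deg x d0 erefl) // (coefE_deg x d0 hs) //.
  rewrite mulrA; congr (_ + _ * (_ + _ * _)).
  - case: ifP => // e2; rewrite (coefE_deg x d1 e0) //.
    by rewrite /p; case: (e) e2 => a [].
  - case: ifP => // f2; rewrite (coefE_deg x d1 e1) //.
    by rewrite /q; case: (f) f2 => a [].
transitivity (dsum_fun x0 (Diag erefl) +
  dsum_fun (sgnz (m' - (p + q)) (swap E _ x0)) (Diag (erefl (p + q))) +
  dsum_fun (sgnz (m' - (p + q)) (cdiff (tensor_square E) (subrK 1 (p + q)) x1)) (Diag erefl)).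
  by [].
by congr (_ + _ + _);
  exact: (@dsum_fun_sgnz (diag (p + q)) (fun u => tensor (E (di u)) (E (dj u)))).
Qed.

Lemma tcoef_out p q e f (t : tensor (E p) (E q)) :
  (cell_in d n p e && cell_in d n q f) = false -> tcoef p q e f t = 0.
Proof.
move=> /negbT; rewrite negb_and => out; move: t; apply: tensor_eq => [x y|x y|x y].
- exact: raddfB.
- by rewrite subrr.
rewrite tcoefE; case/orP: out => h; first by rewrite (ecoeff_out _ h) mul0r.
by rewrite (ecoeff_out _ h) mulr0.
Qed.

Lemma coef_valid m e f (x : S m) : coef e f x != 0 -> cvalid n e && cvalid n f.
Proof.
by apply: contraR => h; rewrite /coef tcoef_out // /cell_in !eqxx; apply: negbTE.
Qed.

Lemma coef_quadrant m e f (x : S m) : first_quadrant x -> coef e f x != 0 ->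
  cdeg e + cdeg f <= m.
Proof.
move=> qx; apply: contraR; rewrite -ltNge => lt.
by rewrite /coef qx ?dsum_fun0 ?raddf0 //= subr_lt0.
Qed.

Local Notation sq_family j := (fun u : diag j => tensor (E (di u)) (E (dj u))).
Local Notation S_family m := (fun u : diag m => c2tensor_square E (dj u) : zmodType).

Definition place m i j (h1 : i + j = m) p q (h2 : p + q = j) :
    {additive tensor (E p) (E q) -> S m} :=
  @dsum_single (diag m) (S_family m) (Diag h1) \o
  @dsum_single (diag j) (sq_family j) (Diag h2).

Lemma coef_place m i j (h1 : i + j = m) p q (h2 : p + q = j) t e f :
  coef e f (place h1 h2 t) = tcoef p q e f t.
Proof.
have [ep|ep] := eqVneq (cdeg e) p; last first.
  rewrite tcoef_out; last by rewrite /cell_in (negPf ep).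
  have [ej|ej] := eqVneq (cdeg e + cdeg f) j.
    rewrite (coefE _ h1 ej) [dsum_fun (place _ _ _) _]dsum_singleE.
    by rewrite dsum_single_neq ?raddf0 // => -[] e1 _; rewrite -e1 eqxx in ep.
  rewrite /coef [dsum_fun (place _ _ _) _]dsum_single_neq ?dsum_fun0 ?raddf0 //.
  by case=> _ e2; rewrite -e2 eqxx in ej.
have [fq|fq] := eqVneq (cdeg f) q; last first.
  rewrite tcoef_out; last by rewrite /cell_in (negPf fq) andbF.
  have nj : cdeg e + cdeg f != j by rewrite ep -h2 (inj_eq (addrI _)).
  rewrite /coef [dsum_fun (place _ _ _) _]dsum_single_neq ?dsum_fun0 ?raddf0 //.
  by case=> _ e2; rewrite -e2 eqxx in nj.
rewrite (coefE_deg _ h1 h2) // [dsum_fun (place _ _ _) _]dsum_singleE.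
by rewrite dsum_singleE.
Qed.

Definition tgen m e f : S m :=
  place (subrK (cdeg e + cdeg f) m) (erefl (cdeg e + cdeg f))
    (tens (gen d n (cdeg e) e) (gen d n (cdeg f) f)).

Lemma coef_tgen m e f e' f' :
  coef e' f' (tgen m e f) = ((e == e') && (f == f') && (cvalid n e && cvalid n f))%:Z.
Proof.
rewrite /tgen coef_place tcoefE !ecoeff_gen /cell_in !eqxx /= -PoszM mulnb.
by congr Posz; congr nat_of_bool; rewrite andbACA.
Qed.

Lemma tgen_quadrant m e f : cdeg e + cdeg f <= m -> first_quadrant (tgen m e f).
Proof.
move=> le u u0; rewrite /tgen [dsum_fun _ _]dsum_single_neq // => uE.
by move: u0; rewrite -uE /= subr_lt0 ltNge le.
Qed.

Lemma tensor_generated (X Y : zmodType) (P : tensor X Y -> Prop) :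
  P 0 -> (forall s t, P s -> P t -> P (s - t)) -> (forall x y, P (tens x y)) -> forall t, P t.
Proof.
move=> P0 PB Pt; apply: quotW => v; rewrite -[v]freeg_sumE raddf_sum; apply: subgroup_sum => // -[x y].
by rewrite freeg_term raddfMz; apply/(subgroupMz P0 PB)/Pt.
Qed.

Lemma tgen_place m i j (h1 : i + j = m) p q (h2 : p + q = j) e f : cdeg e = p -> cdeg f = q ->
  place h1 h2 (tens (gen d n p e) (gen d n q f)) = tgen m e f.
Proof.
move=> ep fq; subst p q; case: j / h2 h1 => h1.
have Ei : m - (cdeg e + cdeg f) = i by rewrite -h1 addrK.
by case: i / Ei h1 => h1; rewrite (Prop_irrelevance h1 (subrK _ m)).
Qed.

Fact tens_Bl (X Y : zmodType) (y : Y) : zmod_morphism (fun x : X => tens x y).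
Proof. by move=> x x'; apply/eqP; rewrite eq_sym subr_eq -tensDl subrK. Qed.
Fact tens_Br (X Y : zmodType) (x : X) : zmod_morphism (fun y : Y => tens x y).
Proof. by move=> y y'; apply/eqP; rewrite eq_sym subr_eq -tensDr subrK. Qed.

Definition tgens m : {additive {freeg (cell * cell)} -> S m} :=
  freeg_lift (fun ef => tgen m ef.1 ef.2).

Lemma tgens_surj m (x : S m) : exists b, tgens m b = x.
Proof.
pose P x := exists b, tgens m b = x.
have PB x1 x2 : P x1 -> P x2 -> P (x1 - x2).
  by move=> [b1 <-] [b2 <-]; exists (b1 - b2); rewrite raddfB.
have P0 : P 0 by exists 0; rewrite raddf0.
rewrite -/(P x); have [s ->] := dsum_decomp x; apply: (@subgroup_sum _ P) => // -[i j h1].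
have [s' ->] := dsum_decomp (dsum_fun x (Diag h1) : tensor_square E j).
rewrite raddf_sum; apply: (@subgroup_sum _ P) => // -[p q h2].
set t := dsum_fun _ (Diag h2); rewrite -[dsum_single _ _]/(place h1 h2 t).
move: t; apply: tensor_generated => [|t1 t2 P1 P2|u v].
- by rewrite raddf0.
- by rewrite raddfB; apply: PB.
rewrite -[tens u v]/(mk_additive (tens_Bl v) u) [u]freeg_decomp !raddf_sum.
apply: (@subgroup_sum _ P) => // k; rewrite !raddfMz; apply: (subgroupMz P0 PB).
rewrite -[mk_additive _ _]/(mk_additive (tens_Br (<< k >> : E p)) v) [v]freeg_decomp !raddf_sum.
apply: (@subgroup_sum _ P) => // l; rewrite !raddfMz; apply: (subgroupMz P0 PB).
rewrite -[mk_additive _ _]/(tens (<< k >> : E p) (<< l >> : E q)) -!gen_cell tgen_place.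
- by exists << (val k, val l) >>; rewrite freeg_liftE.
- by case/andP: (valP k) => /eqP.
- by case/andP: (valP l) => /eqP.
Qed.

Lemma coef_tgens m b e f :
  coef e f (tgens m b) = if cvalid n e && cvalid n f then coeff (e, f) b else 0.
Proof.
have FB : zmod_morphism (fun b : {freeg (cell * cell)} =>
    if cvalid n e && cvalid n f then coeff (e, f) b else 0 : int).
  by move=> b1 b2; case: ifP => _; rewrite ?subrr // raddfB.
apply: (freeg_ext (f := coef e f \o tgens m) (g := mk_additive FB)) => -[e' f'].
rewrite -[LHS]/(coef e f (tgens m << (e', f') >>)) -[RHS]/(if _ then _ else 0).
rewrite freeg_liftE coef_tgen coeffU mul1r -[(e', f') == _]/((e' == e) && (f' == f)).
have [->|] := eqVneq e' e; last by rewrite if_same.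
have [->|] := eqVneq f' f; last by rewrite if_same.
by case: ifP.
Qed.

Lemma tgen_invalid m e f : ~~ (cvalid n e && cvalid n f) -> tgen m e f = 0.
Proof.
rewrite negb_and /tgen => /orP[h|h].
  by rewrite (gen_out (e := e)) ?tens0l ?raddf0 // /cell_in negb_and h orbT.
by rewrite (gen_out (e := f)) ?tens0r ?raddf0 // /cell_in negb_and h orbT.
Qed.

Lemma coef_inj m (x : S m) : (forall e f, coef e f x = 0) -> x = 0.
Proof.
have [b <-] := tgens_surj x => x0; rewrite [b]freeg_decomp raddf_sum big1 // => -[e f] _.
rewrite raddfMz [tgens m _]freeg_liftE; have := x0 e f; rewrite coef_tgens.
by case: ifPn => [_ ->|/tgen_invalid -> _]; rewrite ?mulr0z // mul0rz.
Qed.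

Lemma coef_finite m (x : S m) : exists s : seq (cell * cell),
  uniq s /\ forall e f, coef e f x != 0 -> (e, f) \in s.
Proof.
have [b <-] := tgens_surj x; exists (dom b); split; first exact: uniq_dom.
move=> e f; rewrite coef_tgens; case: ifP => _; last by rewrite eqxx.
by rewrite mem_dom.
Qed.

(** Besides finiteness of the support, the conditions are those satisfied by the
   coordinates of every cochain in the first quadrant ([coef_valid],
   [coef_quadrant]). *)
Lemma coef_realize m (c : cell -> cell -> int) (s : seq (cell * cell)) : uniq s ->
  (forall e f, c e f != 0 -> [/\ (e, f) \in s, cvalid n e && cvalid n f & cdeg e + cdeg f <= m]) ->
  exists x : S m, first_quadrant x /\ forall e f, coef e f x = c e f.
Proof.
move=> su cs; exists (\sum_(ef <- s) tgen m ef.1 ef.2 *~ c ef.1 ef.2); split.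
  apply: big_ind => [u _|x y qx qy u u0|[e f] _]; first by rewrite dsum_fun0.
    by rewrite dsum_funD qx // qy // addr0.
  have [-> u _|c0] := eqVneq (c e f) 0; first by rewrite mulr0z dsum_fun0.
  have [_ _ le] := cs e f c0.
  move=> u u0; rewrite /=.
  have B : zmod_morphism (fun x : S m => dsum_fun x u) by [].
  rewrite -[LHS]/(mk_additive B (tgen m e f *~ c e f)) raddfMz.
  by rewrite -[mk_additive _ _]/(dsum_fun (tgen m e f) u) tgen_quadrant // mul0rz.
move=> e f.
have term ef : coef e f (tgen m ef.1 ef.2 *~ c ef.1 ef.2) =
    ((ef == (e, f)) && (cvalid n ef.1 && cvalid n ef.2))%:Z * c ef.1 ef.2.
  transitivity (coef e f (tgen m ef.1 ef.2) *~ c ef.1 ef.2); first exact: raddfMz.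
  by rewrite coef_tgen mulrzz; case: ef.
have -> : coef e f (\sum_(ef <- s) tgen m ef.1 ef.2 *~ c ef.1 ef.2) =
    \sum_(ef <- s) ((ef == (e, f)) && (cvalid n ef.1 && cvalid n ef.2))%:Z * c ef.1 ef.2.
  rewrite -(eq_bigr _ (fun ef _ => term ef)); exact: raddf_sum.
have [efs|efs] := boolP ((e, f) \in s).
  rewrite (bigD1_seq (e, f)) // eqxx /= big1 ?addr0 => [|ef /negPf ->]; last by rewrite mul0r.
  have [->|c0] := eqVneq (c e f) 0; first by rewrite mulr0.
  by have [_ -> _] := cs e f c0; rewrite mul1r.
rewrite big_seq big1 => [|ef efs'].
  by apply/esym/eqP; apply: contraR efs => /(cs e f)[].
by case: eqP => [ee|]; rewrite ?mul0r //; rewrite -ee efs' in efs.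
Qed.
End Coefficients.

(** * Diagonal blocks *)

Lemma sg_even k : sg (2 * k) = 1.
Proof. by rewrite (_ : 2 * k = k + k) ?sgD ?sg_sq //; ring. Qed.
Lemma sg_shift i j k : i = j + 2 * k -> sg i = sg j.
Proof. by move=> ->; rewrite sgD sg_even mulr1. Qed.
Lemma sg_shift1 i j k : i = j + 2 * k + 1 -> sg i = - sg j.
Proof. by move=> ->; rewrite !sgD sg_even sg1 mulr1 mulrN1. Qed.
Lemma sg_mulself i : sg (i * i) = sg i.
Proof.
have [[[k ->] _]|[[k ->] _]] := sgP i; first by apply: (@sg_shift _ _ (2 * k * k - k)); ring.
by apply: (@sg_shift _ _ (2 * k * k + k)); ring.
Qed.
Lemma sg_mulpred i : sg ((i - 1) * i) = 1.
Proof.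
have [[[k ->] _]|[[k ->] _]] := sgP i.
  by have -> : (2 * k - 1) * (2 * k) = 2 * ((2 * k - 1) * k) by [ring]; exact: sg_even.
by have -> : (2 * k + 1 - 1) * (2 * k + 1) = 2 * (k * (2 * k + 1)) by [ring]; exact: sg_even.
Qed.

Section Blocks.
Variables (A : choiceType) (d : A -> int) (n : A -> nat).
Local Notation cell := (cell A).
Local Notation cdeg := (cdeg d).
Local Notation cvalid := (cvalid n).
Local Notation dcoef := (dcoef d n).
Implicit Types (e f : cell) (c : cell -> cell -> int).

Definition admissible m c := forall e f, c e f != 0 ->
  cvalid e && cvalid f /\ cdeg e + cdeg f <= m.

Section SingleFormula.
Variables (c : cell -> cell -> int) (m : int) (a : A).
Local Notation N := (n a)%:Z.
Local Notation ff := (c (a, true) (a, true)).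
Local Notation fr := (c (a, true) (a, false)).
Local Notation rf := (c (a, false) (a, true)).
Local Notation rr := (c (a, false) (a, false)).

Lemma dcoef_ff : dcoef c m (a, true) (a, true) =
  ff * (1 + sg m * sg (d a)) + sg m * N * (rf + sg (d a) * fr).
Proof.
rewrite /dcoef /cdeg /= sg_mulself.
by rewrite (@sg_shift (m - (d a + d a)) m (- d a)); ring.
Qed.

Lemma dcoef_rf : dcoef c m (a, false) (a, true) =
  rf - sg m * fr + sg m * sg (d a) * N * rr.
Proof.
rewrite /dcoef /cdeg /= sg_mulpred (@sg_shift1 (m - (d a - 1 + d a)) m (- d a)); last by ring.
by rewrite (@sg_shift1 (d a - 1) (d a) (-1)); ring.
Qed.

Lemma dcoef_fr : dcoef c m (a, true) (a, false) =
  fr - sg m * rf - sg m * N * rr.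
Proof.
rewrite /dcoef /cdeg /= mulrC [d a * _]mulrC sg_mulpred.
by rewrite (@sg_shift1 (m - (d a + (d a - 1))) m (- d a)); ring.
Qed.

Lemma dcoef_rr : dcoef c m (a, false) (a, false) = rr * (1 - sg m * sg (d a)).
Proof.
rewrite /dcoef /cdeg /= sg_mulself (@sg_shift1 (d a - 1) (d a) (-1)); last by ring.
by rewrite (@sg_shift (m - (d a - 1 + (d a - 1))) m (1 - d a)); ring.
Qed.
End SingleFormula.

Lemma sg_succ m : sg (m + 1) = - sg m.
Proof. by rewrite sgD sg1 mulrN1. Qed.

Definition single_cochain (a : A) (yff yfr yrf yrr : int) : cell -> cell -> int := fun e f =>
  if (e.1 == a) && (f.1 == a) then
    (if e.2 then (if f.2 then yff else yfr) else (if f.2 then yrf else yrr)) else 0.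

Lemma single_block_exact c m a : admissible m c ->
  (forall e f, e.1 = a -> f.1 = a -> dcoef c (m + 1) e f = 0) ->
  (m = 2 * d a -> sg m = sg (d a) -> n a = 0%N -> c (a, true) (a, true) = 0) ->
  (m = 2 * d a -> sg m = sg (d a) -> forall h, (n a)%:Z = 2 * h ->
     exists q, c (a, true) (a, true) - (n a)%:Z * c (a, false) (a, true) = 2 * (n a)%:Z * q) ->
  (m = 2 * d a -> sg m = sg (d a) -> forall h, (n a)%:Z = 2 * h + 1 ->
     exists q, c (a, true) (a, true) = (n a)%:Z * q) ->
  (2 * d a < m -> sg m = sg (d a) -> forall h, (n a)%:Z = 2 * h ->
     exists q, c (a, true) (a, true) = 2 * q) ->
  (m = 2 * d a - 1 -> sg (d a) = -1 -> (n a)%:Z <> 0 ->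
     exists q, c (a, false) (a, true) = (n a)%:Z * q) ->
  (2 * d a - 1 <= m -> sg m = - sg (d a) -> (n a)%:Z <> 0 ->
     forall h, (n a)%:Z = 2 * h -> exists q, c (a, false) (a, false) = 2 * q) ->
  exists y, admissible (m - 1) y /\
    forall e f, e.1 = a -> f.1 = a -> dcoef y m e f = c e f.
Proof.
move=> cA cD F1 F2 F3 F4 F5 F6.
have adm b1 b2 : c (a, b1) (a, b2) <> 0 ->
    cvalid (a, b1) && cvalid (a, b2) /\ cdeg (a, b1) + cdeg (a, b2) <= m.
  by move=> /eqP; apply: cA.
have E1 := cD (a, true) (a, true) erefl erefl; rewrite dcoef_ff sg_succ in E1.
have E2 := cD (a, false) (a, true) erefl erefl; rewrite dcoef_rf sg_succ in E2.
have E3 := cD (a, true) (a, false) erefl erefl; rewrite dcoef_fr sg_succ in E3.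
have E4 := cD (a, false) (a, false) erefl erefl; rewrite dcoef_rr sg_succ in E4.
have := @single_exact (n a) (d a) m (sg m) (sg (d a)) (c (a, true) (a, true))
  (c (a, true) (a, false)) (c (a, false) (a, true)) (c (a, false) (a, false)) (sgP m) (sgP (d a)).
case=> //.
- by move=> /adm[_]; rewrite /cdeg /=; lia.
- by move=> /adm[]; rewrite /cvalid /cdeg /=; lia.
- by move=> /adm[]; rewrite /cvalid /cdeg /=; lia.
- by move=> /adm[]; rewrite /cvalid /cdeg /=; lia.
- by rewrite -E1; ring.
- by rewrite -E2; ring.
- by rewrite -E3; ring.
- by rewrite -E4; ring.
- by move=> md se n0; apply: F1 => //; lia.
move=> yff [yfr [yrf [yrr [[V1 V2 V3 V4] Q1 Q2 Q3 Q4]]]].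
exists (single_cochain a yff yfr yrf yrr); split.
  move=> [x b1] [x' b2]; rewrite /single_cochain /=.
  have [->|_] := eqVneq x a; last by rewrite eqxx.
  have [->|_] := eqVneq x' a; last by rewrite eqxx.
  rewrite /cvalid /cdeg /=.
  by case: b1; case: b2 => /eqP h; [have := V1 h | have := V2 h | have := V3 h | have := V4 h]; lia.
move=> [x b1] [x' b2] /= -> ->.
case: b1; case: b2; rewrite ?(dcoef_ff, dcoef_rf, dcoef_fr, dcoef_rr);
  rewrite /single_cochain /= !eqxx /=.
- by rewrite -[RHS]Q1; ring.
- by rewrite -[RHS]Q3; ring.
- by rewrite -[RHS]Q2; ring.
- by rewrite -[RHS]Q4; ring.
Qed.

Lemma dcoef_single_out a yff yfr yrf yrr m e f : (e.1 == a) && (f.1 == a) = false ->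
  dcoef (single_cochain a yff yfr yrf yrr) m e f = 0.
Proof.
move=> h; rewrite /dcoef /single_cochain /= h andbC h !mul0r !if_same.
by rewrite !(mulr0, addr0).
Qed.

Lemma single_boundary y m a : admissible (m - 1) y ->
  [/\ m = 2 * d a -> n a = 0%N -> dcoef y m (a, true) (a, true) = 0,
      m = 2 * d a -> forall h, (n a)%:Z = 2 * h -> exists q,
        dcoef y m (a, true) (a, true) - (n a)%:Z * dcoef y m (a, false) (a, true) =
        2 * (n a)%:Z * q,
      m = 2 * d a -> exists q, dcoef y m (a, true) (a, true) = (n a)%:Z * q &
      sg m = sg (d a) -> forall h, (n a)%:Z = 2 * h -> exists q,
        dcoef y m (a, true) (a, true) = 2 * q] /\
  [/\ m = 2 * d a - 1 -> sg (d a) = -1 -> exists q,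
        dcoef y m (a, false) (a, true) = (n a)%:Z * q &
      sg m = - sg (d a) -> exists q, dcoef y m (a, false) (a, false) = 2 * q].
Proof.
move=> yA; rewrite dcoef_ff dcoef_rf dcoef_rr.
have low b1 b2 : m - 1 < cdeg (a, b1) + cdeg (a, b2) -> y (a, b1) (a, b2) = 0.
  by move=> lt; apply/eqP; apply: contraTT lt => /yA[_ le]; rewrite -leNgt.
have m2 : m = 2 * d a -> sg m = 1 by move=> ->; rewrite sg_even.
split; split.
- move=> md n0; rewrite (low true true) ?n0; last by rewrite /cdeg /=; lia.
  by rewrite mul0r mulr0 mul0r addr0.
- move=> md h nh; rewrite (low true true); last by rewrite /cdeg /=; lia.
  have [[_ e1]|[_ e1]] := sgP (d a); rewrite (m2 md) e1.
    by exists (y (a, true) (a, false) - h * y (a, false) (a, false)); rewrite nh; ring.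
  by exists (h * y (a, false) (a, false)); rewrite nh; ring.
- move=> md; rewrite (low true true); last by rewrite /cdeg /=; lia.
  by rewrite (m2 md); exists (y (a, false) (a, true) + sg (d a) * y (a, true) (a, false)); ring.
- move=> me h nh; exists (y (a, true) (a, true) +
    sg m * h * (y (a, false) (a, true) + sg (d a) * y (a, true) (a, false))).
  by rewrite nh me sg_sq; ring.
- move=> md e1; rewrite (low true false) ?(low false true);
    [|by rewrite /cdeg /=; lia | by rewrite /cdeg /=; lia].
  by exists (sg m * sg (d a) * y (a, false) (a, false)); ring.
- move=> me; exists (y (a, false) (a, false)).
  by rewrite me mulNr sg_sq; ring.
Qed.

Lemma single_cocycle m a ff fr rf rr :
  (ff != 0 -> 2 * d a <= m) ->
  (fr != 0 -> n a <> 0%N /\ 2 * d a - 1 <= m) ->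
  (rf != 0 -> n a <> 0%N /\ 2 * d a - 1 <= m) ->
  (rr != 0 -> n a <> 0%N /\ 2 * d a - 2 <= m) ->
  ff * (1 - sg m * sg (d a)) - sg m * (n a)%:Z * (rf + sg (d a) * fr) = 0 ->
  rf + sg m * fr - sg m * sg (d a) * (n a)%:Z * rr = 0 ->
  fr + sg m * rf + sg m * (n a)%:Z * rr = 0 ->
  rr * (1 + sg m * sg (d a)) = 0 ->
  admissible m (single_cochain a ff fr rf rr) /\
  forall e f, dcoef (single_cochain a ff fr rf rr) (m + 1) e f = 0.
Proof.
move=> V1 V2 V3 V4 E1 E2 E3 E4; split.
  move=> [x b1] [x' b2]; rewrite /single_cochain /=.
  have [->|_] := eqVneq x a; last by rewrite eqxx.
  have [->|_] := eqVneq x' a; last by rewrite eqxx.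
  rewrite /cvalid /cdeg /=.
  by case: b1; case: b2 => /= h; [have := V1 h | have := V2 h | have := V3 h | have := V4 h]; lia.
move=> [x b1] [x' b2]; have [xa|/negbTE xa] := boolP ((x == a) && (x' == a)); last first.
  exact: dcoef_single_out.
case/andP: xa => /eqP -> /eqP ->.
case: b1; case: b2; rewrite ?(dcoef_ff, dcoef_rf, dcoef_fr, dcoef_rr) sg_succ;
  rewrite /single_cochain /= !eqxx /=.
- by rewrite -[RHS]E1; ring.
- by rewrite -[RHS]E3; ring.
- by rewrite -[RHS]E2; ring.
- by rewrite -[RHS]E4; ring.
Qed.
End Blocks.

(** * Blocks of two elements *)

Section PairBlocks.
Variables (A : choiceType) (d : A -> int) (n : A -> nat).
Local Notation cell := (cell A).
Local Notation cdeg := (cdeg d).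
Local Notation cvalid := (cvalid n).
Local Notation dcoef := (dcoef d n).
Local Notation admissible := (admissible d n).
Implicit Types (e f : cell) (c : cell -> cell -> int).

(** The action of C_2 in coordinates. *)
Definition twist c e f := sg (cdeg e * cdeg f) * c f e.

Lemma twistK c e f : twist (twist c) e f = c e f.
Proof. by rewrite /twist mulrA [cdeg f * _]mulrC sg_sq mul1r. Qed.

Lemma cdeg_face e : e.2 -> cdeg e = cdeg (e.1, false) + 1.
Proof. by case: e => x [] // _; rewrite /cdeg /= subrK. Qed.

Lemma dcoef_twist c M e f : dcoef (twist c) M e f = sg (cdeg e * cdeg f) * dcoef c M f e.
Proof.
rewrite /dcoef /twist [cdeg f + cdeg e]addrC [cdeg f * cdeg e]mulrC.
set s := sg (M - _); set t := sg (cdeg e * cdeg f).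
have tt : t * t = 1 by apply: sg_sq.
have E1 : (if e.2 then sg (cdeg (e.1, false) * cdeg f) * c f (e.1, false) * n e.1 else 0) =
    t * (sg (cdeg f) * (if e.2 then c f (e.1, false) * n e.1 else 0)).
  case: ifP => e2; last by rewrite !mulr0.
  rewrite !mulrA; congr (_ * _ * _); rewrite /t (cdeg_face e2) -sgD.
  by apply/esym/(@sg_shift _ _ (cdeg f)); ring.
have E2 : sg (cdeg e) * (if f.2 then sg (cdeg e * cdeg (f.1, false)) * c (f.1, false) e * n f.1 else 0) =
    t * (if f.2 then c (f.1, false) e * n f.1 else 0).
  case: ifP => f2; last by rewrite !mulr0.
  rewrite !mulrA; congr (_ * _ * _); rewrite /t (cdeg_face f2) -sgD.
  by congr sg; ring.
rewrite E1 E2 -[c e f]mul1r -tt; ring.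
Qed.

Section Formula.
Variables (c : cell -> cell -> int) (M : int) (x y : A).
Local Notation s := (sg (M - (d x + d y))).
Local Notation g := (sg (d x)).
Local Notation v b1 b2 := (c (x, b1) (y, b2)).
Local Notation w b1 b2 := (twist c (x, b1) (y, b2)).

Lemma dcoef_pair_tt : dcoef c M (x, true) (y, true) =
  v true true + s * w true true +
  s * ((n x)%:Z * v false true + g * (n y)%:Z * v true false).
Proof. by rewrite /dcoef /twist /cdeg /=; ring. Qed.

Lemma dcoef_pair_ft : dcoef c M (x, false) (y, true) =
  v false true - s * w false true + s * g * (n y)%:Z * v false false.
Proof.
rewrite /dcoef /twist /cdeg /= (@sg_shift1 (M - (d x - 1 + d y)) (M - (d x + d y)) 0); last by ring.
by rewrite (@sg_shift1 (d x - 1) (d x) (-1)); ring.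
Qed.

Lemma dcoef_pair_tf : dcoef c M (x, true) (y, false) =
  v true false - s * w true false - s * (n x)%:Z * v false false.
Proof.
rewrite /dcoef /twist /cdeg /= (@sg_shift1 (M - (d x + (d y - 1))) (M - (d x + d y)) 0); last by ring.
by ring.
Qed.

Lemma dcoef_pair_ff : dcoef c M (x, false) (y, false) = v false false + s * w false false.
Proof.
rewrite /dcoef /twist /cdeg /=.
by rewrite (@sg_shift (M - (d x - 1 + (d y - 1))) (M - (d x + d y)) 1); ring.
Qed.
End Formula.

(** The coordinate w is the value of the twisted cochain on the products in the
   order of v, hence the sign. *)
Definition pair_cochain (x y : A) (v w : bool -> bool -> int) : cell -> cell -> int := fun e f =>
  if (e.1 == x) && (f.1 == y) then v e.2 f.2
  else if (e.1 == y) && (f.1 == x) then sg (cdeg e * cdeg f) * w f.2 e.2 else 0.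

Definition in_pair (x y : A) e f := (e.1 == x) && (f.1 == y) || (e.1 == y) && (f.1 == x).

Section PairCochain.
Variables (x y : A) (v w : bool -> bool -> int).
Hypothesis xy : x != y.

Lemma pair_cochainE b1 b2 : pair_cochain x y v w (x, b1) (y, b2) = v b1 b2.
Proof. by rewrite /pair_cochain !eqxx. Qed.

Lemma pair_cochain_twist b1 b2 : twist (pair_cochain x y v w) (x, b1) (y, b2) = w b1 b2.
Proof.
rewrite /twist /pair_cochain /= !eqxx eq_sym (negPf xy) /= [cdeg (y, b2) * _]mulrC mulrA.
by rewrite sg_sq mul1r.
Qed.

Lemma pair_cochain_out e f : ~~ in_pair x y e f -> pair_cochain x y v w e f = 0.
Proof. by rewrite /in_pair /pair_cochain negb_or => /andP[/negPf -> /negPf ->]. Qed.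

Lemma in_pairC e f : in_pair x y e f = in_pair x y f e.
Proof. by rewrite /in_pair orbC ![(f.1 == _) && _]andbC. Qed.

Lemma dcoef_pair_out M e f : ~~ in_pair x y e f -> dcoef (pair_cochain x y v w) M e f = 0.
Proof.
move=> h; rewrite /dcoef !pair_cochain_out //; last by rewrite in_pairC.
by rewrite !mul0r !if_same !(mulr0, addr0).
Qed.

Lemma pair_admissible m :
  (forall b1 b2, v b1 b2 <> 0 -> cvalid (x, b1) && cvalid (y, b2) /\ cdeg (x, b1) + cdeg (y, b2) <= m) ->
  (forall b1 b2, w b1 b2 <> 0 -> cvalid (x, b1) && cvalid (y, b2) /\ cdeg (x, b1) + cdeg (y, b2) <= m) ->
  admissible m (pair_cochain x y v w).
Proof.
move=> vA wA [x' b1] [y' b2]; rewrite /pair_cochain /=.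
case: ifP => [/andP[/eqP -> /eqP ->] /eqP|_]; first exact: vA.
case: ifP => [/andP[/eqP -> /eqP ->]|]; last by rewrite eqxx.
rewrite mulf_eq0 negb_or => /andP[_ /eqP]; rewrite andbC addrC; exact: wA.
Qed.
End PairCochain.

Lemma pair_ext c c' (x y : A) :
  (forall b1 b2, c (x, b1) (y, b2) = c' (x, b1) (y, b2)) ->
  (forall b1 b2, twist c (x, b1) (y, b2) = twist c' (x, b1) (y, b2)) ->
  forall e f, in_pair x y e f -> c e f = c' e f.
Proof.
move=> E1 E2 [x' b1] [y' b2] /orP[] /andP[/eqP /= -> /eqP ->] //.
have := E2 b2 b1; rewrite /twist => /(congr1 (fun z => sg (cdeg (x, b2) * cdeg (y, b1)) * z)).
by rewrite !mulrA sg_sq !mul1r.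
Qed.

Lemma pair_block_exact c m (x y : A) : x != y -> admissible m c ->
  (forall e f, in_pair x y e f -> dcoef c (m + 1) e f = 0) ->
  (m = d x + d y -> exists a b, c (x, true) (y, true) = (n x)%:Z * a + (n y)%:Z * b) ->
  (m = d x + d y - 1 -> (n x)%:Z <> 0 -> (n y)%:Z <> 0 -> exists t,
     c (x, false) (y, true) = (n y)%:Z * t /\ c (x, true) (y, false) = - sg (d x) * (n x)%:Z * t) ->
  exists z, admissible (m - 1) z /\ forall e f, in_pair x y e f -> dcoef z m e f = c e f.
Proof.
move=> xy cA cD F1 F2.
have ip b1 b2 : in_pair x y (x, b1) (y, b2) by rewrite /in_pair /= !eqxx.
have adm b1 b2 : c (x, b1) (y, b2) <> 0 ->
    cvalid (x, b1) && cvalid (y, b2) /\ cdeg (x, b1) + cdeg (y, b2) <= m.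
  by move=> /eqP; apply: cA.
have admw b1 b2 : twist c (x, b1) (y, b2) <> 0 ->
    cvalid (x, b1) && cvalid (y, b2) /\ cdeg (x, b1) + cdeg (y, b2) <= m.
  rewrite andbC addrC => h; apply: cA; apply: contra_notN h => /eqP h.
  by rewrite /twist h mulr0.
have Dv b1 b2 := cD _ _ (ip b1 b2).
have Dw b1 b2 : dcoef (twist c) (m + 1) (x, b1) (y, b2) = 0.
  by rewrite dcoef_twist cD ?mulr0 // /in_pair /= !eqxx orbT.
set D := d x + d y in F1 F2 *.
have sD : sg (m + 1 - (d x + d y)) = - sg (m - D).
  by apply: (@sg_shift1 _ _ 0); rewrite /D; ring.
have V1 := Dv true true; have V2 := Dv false true; have V3 := Dv true false; have V4 := Dv false false.
have W1 := Dw true true; have W2 := Dw false true; have W3 := Dw true false; have W4 := Dw false false.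
rewrite dcoef_pair_tt sD in V1; rewrite dcoef_pair_ft sD in V2.
rewrite dcoef_pair_tf sD in V3; rewrite dcoef_pair_ff sD in V4.
rewrite dcoef_pair_tt sD twistK in W1; rewrite dcoef_pair_ft sD twistK in W2.
rewrite dcoef_pair_tf sD twistK in W3; rewrite dcoef_pair_ff sD twistK in W4.
have := @pair_exact (n x) (n y) D m (sg (m - D)) (sg (d x))
  (c (x, true) (y, true)) (c (x, false) (y, true)) (c (x, true) (y, false)) (c (x, false) (y, false))
  (twist c (x, true) (y, true)) (twist c (x, false) (y, true)) (twist c (x, true) (y, false))
  (twist c (x, false) (y, false)) (sgP _) (sg_sq _).
case=> //.
- by move=> /adm[]; rewrite /cvalid /cdeg /=; lia.
- by move=> /admw[]; rewrite /cvalid /cdeg /=; lia.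
- by move=> /adm[]; rewrite /cvalid /cdeg /=; lia.
- by move=> /admw[]; rewrite /cvalid /cdeg /=; lia.
- by move=> /adm[]; rewrite /cvalid /cdeg /=; lia.
- by move=> /admw[]; rewrite /cvalid /cdeg /=; lia.
- by move=> /adm[]; rewrite /cvalid /cdeg /=; lia.
- by move=> /admw[]; rewrite /cvalid /cdeg /=; lia.
- by rewrite -V1; ring.
- by rewrite -W1; ring.
- by rewrite -V2; ring.
- by rewrite -W2; ring.
- by rewrite -V3; ring.
- by rewrite -W3; ring.
- by rewrite -V4; ring.
move=> pff [prf [pfr [prr [qff [qrf [qfr [qrr]]]]]]].
move=> [[R1 R2 R3 R4] [R5 R6 R7 R8] [Q1 Q2 Q3 Q4] [Q5 Q6 Q7 Q8]].
pose pick (tt ft tf ff : int) (b1 b2 : bool) :=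
  if b1 then (if b2 then tt else tf) else (if b2 then ft else ff).
pose z := pair_cochain x y (pick pff prf pfr prr) (pick qff qrf qfr qrr).
exists z; split.
  apply: pair_admissible => b1 b2; rewrite /cvalid /cdeg /=; case: b1; case: b2 => /= h.
  - by have := R1 h; lia.
  - by have := R5 h; lia.
  - by have := R3 h; lia.
  - by have := R7 h; lia.
  - by have := R2 h; lia.
  - by have := R6 h; lia.
  - by have := R4 h; lia.
  - by have := R8 h; lia.
have zE (b1 b2 : bool) := pair_cochainE x y (pick pff prf pfr prr) (pick qff qrf qfr qrr) b1 b2.
have zT (b1 b2 : bool) := pair_cochain_twist (pick pff prf pfr prr) (pick qff qrf qfr qrr) xy b1 b2.
rewrite -/z in zE zT.
apply: pair_ext => b1 b2.
  case: b1; case: b2; rewrite ?(dcoef_pair_tt, dcoef_pair_ft, dcoef_pair_tf, dcoef_pair_ff);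
    rewrite !zE !zT /=.
  - by rewrite -[RHS]Q1; ring.
  - by rewrite -[RHS]Q5; ring.
  - by rewrite -[RHS]Q3; ring.
  - by rewrite -[RHS]Q7; ring.
have -> : twist (dcoef z m) (x, b1) (y, b2) = dcoef (twist z) m (x, b1) (y, b2).
  by rewrite dcoef_twist.
case: b1; case: b2; rewrite ?(dcoef_pair_tt, dcoef_pair_ft, dcoef_pair_tf, dcoef_pair_ff) !twistK;
  rewrite !zE !zT /=.
- by rewrite -[RHS]Q2; ring.
- by rewrite -[RHS]Q6; ring.
- by rewrite -[RHS]Q4; ring.
- by rewrite -[RHS]Q8; ring.
Qed.

Lemma pair_boundary z m (x y : A) : admissible (m - 1) z ->
  (m = d x + d y -> exists a b,
     dcoef z m (x, true) (y, true) = (n x)%:Z * a + (n y)%:Z * b) /\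
  (m = d x + d y - 1 -> exists t, dcoef z m (x, false) (y, true) = (n y)%:Z * t /\
     dcoef z m (x, true) (y, false) = - sg (d x) * (n x)%:Z * t).
Proof.
move=> zA.
have low b1 b2 : m - 1 < cdeg (x, b1) + cdeg (y, b2) ->
    z (x, b1) (y, b2) = 0 /\ twist z (x, b1) (y, b2) = 0.
  move=> lt; split; first by apply/eqP; apply: contraTT lt => /zA[_ le]; rewrite -leNgt.
  rewrite /twist (_ : z _ _ = 0) ?mulr0 //.
  by apply/eqP; apply: contraTT lt => /zA[_ le]; rewrite -leNgt addrC.
split=> md.
  have [l1 l2] : z (x, true) (y, true) = 0 /\ twist z (x, true) (y, true) = 0.
    by apply: low; rewrite /cdeg /=; lia.
  rewrite dcoef_pair_tt l1 l2 md subrr.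
  exists (z (x, false) (y, true)), (sg (d x) * z (x, true) (y, false)).
  by rewrite /(sg 0) expr0z; ring.
have [l1 l2] : z (x, false) (y, true) = 0 /\ twist z (x, false) (y, true) = 0.
  by apply: low; rewrite /cdeg /=; lia.
have [l3 l4] : z (x, true) (y, false) = 0 /\ twist z (x, true) (y, false) = 0.
  by apply: low; rewrite /cdeg /=; lia.
have s1 : sg (m - (d x + d y)) = -1.
  by rewrite md addrAC subrr.
exists (- sg (d x) * z (x, false) (y, false)).
rewrite dcoef_pair_ft dcoef_pair_tf l1 l2 l3 l4 s1; split; first by ring.
have gg := sg_sq (d x).
transitivity (sg (d x) * sg (d x) * (n x)%:Z * z (x, false) (y, false)); last by ring.
by rewrite gg; ring.
Qed.

Lemma pair_cocycle m (x y : A) v w : x != y ->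
  (forall b1 b2, v b1 b2 <> 0 -> cvalid (x, b1) && cvalid (y, b2) /\ cdeg (x, b1) + cdeg (y, b2) <= m) ->
  (forall b1 b2, w b1 b2 <> 0 -> cvalid (x, b1) && cvalid (y, b2) /\ cdeg (x, b1) + cdeg (y, b2) <= m) ->
  let s := sg (m - (d x + d y)) in let g := sg (d x) in
  v true true - s * w true true - s * ((n x)%:Z * v false true + g * (n y)%:Z * v true false) = 0 ->
  w true true - s * v true true - s * ((n x)%:Z * w false true + g * (n y)%:Z * w true false) = 0 ->
  v false true + s * w false true - s * g * (n y)%:Z * v false false = 0 ->
  w false true + s * v false true - s * g * (n y)%:Z * w false false = 0 ->
  v true false + s * w true false + s * (n x)%:Z * v false false = 0 ->
  w true false + s * v true false + s * (n x)%:Z * w false false = 0 ->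
  v false false - s * w false false = 0 -> w false false - s * v false false = 0 ->
  admissible m (pair_cochain x y v w) /\
  forall e f, dcoef (pair_cochain x y v w) (m + 1) e f = 0.
Proof.
move=> xy vA wA s g E1 E2 E3 E4 E5 E6 E7 E8; split; first exact: pair_admissible.
move=> e f; have [ip|nip] := boolP (in_pair x y e f); last exact: dcoef_pair_out.
have sD : sg (m + 1 - (d x + d y)) = - s by apply: (@sg_shift1 _ _ 0); ring.
have zE (b1 b2 : bool) := pair_cochainE x y v w b1 b2.
have zT (b1 b2 : bool) := pair_cochain_twist v w xy b1 b2.
set z := pair_cochain x y v w in zE zT *.
apply: (@pair_ext (dcoef z (m + 1)) (fun _ _ => 0) x y) ip => b1 b2.
  case: b1; case: b2; rewrite ?(dcoef_pair_tt, dcoef_pair_ft, dcoef_pair_tf, dcoef_pair_ff);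
    rewrite !zE !zT sD.
  - by rewrite -[RHS]E1; ring.
  - by rewrite -[RHS]E5; ring.
  - by rewrite -[RHS]E3; ring.
  - by rewrite -[RHS]E7; ring.
have -> : twist (dcoef z (m + 1)) (x, b1) (y, b2) = dcoef (twist z) (m + 1) (x, b1) (y, b2).
  by rewrite dcoef_twist.
rewrite /(twist (fun _ _ => 0)) mulr0.
case: b1; case: b2; rewrite ?(dcoef_pair_tt, dcoef_pair_ft, dcoef_pair_tf, dcoef_pair_ff) !twistK;
  rewrite !zE !zT sD.
- by rewrite -[RHS]E2; ring.
- by rewrite -[RHS]E6; ring.
- by rewrite -[RHS]E4; ring.
- by rewrite -[RHS]E8; ring.
Qed.
End PairBlocks.

(** * Labels and the functionals that detect them *)

Section Labels.
Variables (A : choiceType) (d : A -> int) (n : A -> nat).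
Hypothesis hn : forall a, n a = 0%N \/ power_of_2 (n a) \/ odd (n a).
Local Notation cell := (cell A).
Local Notation cdeg := (cdeg d).
Local Notation dcoef := (dcoef d n).
Local Notation admissible := (admissible d n).
Implicit Types (e f : cell) (c : cell -> cell -> int) (l : label A) (P : upair A).

Lemma upair_enum P : exists xy : A * A,
  (upair_set P : seq A) = [:: xy.1; xy.2] /\ xy.1 != xy.2.
Proof.
case: P => S /= S2.
have Su : uniq (S : seq A) := fset_uniq S.
have : size (S : seq A) = 2 by exact: S2.
case: (S : seq A) Su => [|x [|y [|z r]]] //= /andP[xy _] _.
by exists (x, y); split=> //; rewrite inE in xy.
Qed.

Definition pfst P : A := (projT1 (cid (upair_enum P))).1.
Definition psnd P : A := (projT1 (cid (upair_enum P))).2.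
Lemma pairE P : (upair_set P : seq A) = [:: pfst P; psnd P].
Proof. by rewrite /pfst /psnd; case: cid => xy []. Qed.
Lemma pair_neq P : pfst P != psnd P.
Proof. by rewrite /pfst /psnd; case: cid => xy []. Qed.

Lemma upair_inj P P' : upair_set P =i upair_set P' -> P = P'.
Proof.
case: P => S hS; case: P' => S' hS' /= /fsetP SS'; subst S'.
by rewrite (Prop_irrelevance hS hS').
Qed.

(** A base names a block: the diagonal block of one element, or the block of an
   unordered pair. *)
Definition base : Type := (A + upair A)%type.

Definition in_block (b : base) e f : bool :=
  match b with
  | inl a => (e.1 == a) && (f.1 == a)
  | inr P => in_pair (pfst P) (psnd P) e f
  end.

Lemma base_exists (x y : A) : exists b : base,
  (forall e f, e.1 = x -> f.1 = y -> in_block b e f) /\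
  forall b' e f, e.1 = x -> f.1 = y -> in_block b' e f -> b' = b.
Proof.
have mem P : forall z, z \in upair_set P = (z == pfst P) || (z == psnd P).
  by move=> z; rewrite -[z \in _]/(z \in (upair_set P : seq A)) pairE !inE.
have [xy|xy] := eqVneq x y.
  exists (inl x); split=> [e f|[a|P] e f] /= ex fy; rewrite ?ex ?fy -?xy ?eqxx //.
    by move=> /andP[/eqP ->].
  rewrite /in_pair ex fy -xy; have := pair_neq P => /eqP ne.
  by case/orP => /andP[/eqP e1 /eqP e2]; case: ne; rewrite -e1 -e2.
have h : #|` [fset x; y]%fset| = 2 by rewrite cardfs2 xy.
exists (inr (UPair h)); split=> [e f|[a|P] e f] /= ex fy.
  rewrite /in_pair ex fy.
  have := mem (UPair h) x; have := mem (UPair h) y.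
  move: (pfst (UPair h)) (psnd (UPair h)) => a b; rewrite /= !inE !eqxx orbT /=.
  move=> /esym/orP[]/eqP y1 /esym/orP[]/eqP x1; rewrite -?x1 -?y1 ?eqxx ?orbT //.
    by move: xy; rewrite x1 y1 eqxx.
  by move: xy; rewrite x1 y1 eqxx.
  by rewrite ex fy => /andP[/eqP xa /eqP ya]; rewrite xa ya eqxx in xy.
rewrite /in_pair ex fy => ip; congr inr; apply: upair_inj => z; rewrite mem /= !inE.
by case/orP: ip => /andP[/eqP -> /eqP ->] //; rewrite orbC.
Qed.

Definition base_of x y := projT1 (cid (base_exists x y)).
Lemma base_ofP e f : in_block (base_of e.1 f.1) e f.
Proof. exact: (projT2 (cid (base_exists e.1 f.1))).1. Qed.
Lemma base_of_uniq b e f : in_block b e f -> b = base_of e.1 f.1.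
Proof. exact: (projT2 (cid (base_exists e.1 f.1))).2. Qed.

Definition lbase l : base :=
  match l with
  | PairTensor P | PairTor P => inr P
  | FreeEven0 a | FreeEven a _ | FreeOdd a _ | OddTorsionEven a | OddTorsionOdd a
  | TwoTorsionEven0 a | TwoTorsionEvenLow a | TwoTorsionEven a _
  | TwoTorsionOdd0 a | TwoTorsionOdd a _ => inl a
  end.

(** The only label that a block may carry in degree m.  The value is meaningful only
   if some label of this block occurs in degree m. *)
Definition lab (m : int) (b : base) : label A :=
  match b with
  | inr P => if m == d (pfst P) + d (psnd P) then PairTensor P else PairTor P
  | inl a =>
    if n a == 0%N then
      if (2 %| d a)%Z then
        if m == 2 * d a then FreeEven0 a else FreeEven a (absz (m - (2 * d a + 2))%R %/ 2)%N
      else FreeOdd a (absz (m - (2 * d a + 1))%R %/ 2)%N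
    else if odd (n a) then
      if (2 %| d a)%Z then OddTorsionEven a else OddTorsionOdd a
    else if (2 %| d a)%Z then
      if m == 2 * d a then TwoTorsionEven0 a
      else if m == 2 * d a - 1 then TwoTorsionEvenLow a
      else TwoTorsionEven a (absz (m - (2 * d a + 1))%R)
    else if m == 2 * d a - 1 then TwoTorsionOdd0 a else TwoTorsionOdd a (absz (m - 2 * d a)%R)
  end.

Lemma pow2_even k : power_of_2 k -> k != 0%N /\ odd k = false.
Proof.
move=> [e [e0 ->]]; rewrite expn_eq0 /=; split=> //.
by rewrite oddX; case: e e0.
Qed.

Lemma pair_deg P : \sum_(a <- upair_set P) d a = d (pfst P) + d (psnd P).
Proof. by rewrite pairE big_cons big_seq1. Qed.

(** Since [lab] depends only on the degree and on the block, different labels of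
   the same degree live in different blocks.  This is what makes their detecting
   forms independent. *)
Lemma label_lab l : label_occurs d n l -> l = lab (label_deg d l) (lbase l).
Proof.
case: l => [P|P|a|a i|a i|a|a|a|a|a i|a|a i] /=; rewrite ?pair_deg /even_deg.
- by rewrite eqxx.
- by move=> _; case: eqP => // h; exfalso; lia.
- by move=> [-> ->]; rewrite !eqxx.
- move=> [-> ->]; rewrite eqxx; case: eqP => [h|_]; first by exfalso; lia.
  by congr FreeEven; lia.
- move=> [-> /negP/negbTE ->]; rewrite eqxx; congr FreeOdd; lia.
- by move=> [no ->]; rewrite no; case: eqP => // n0; rewrite n0 in no.
- by move=> [no /negP/negbTE ->]; rewrite no; case: eqP => // n0; rewrite n0 in no.
- by move=> [/pow2_even[/negbTE -> ->] ->]; rewrite eqxx.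
- move=> [/pow2_even[/negbTE -> ->] ->]; rewrite eqxx; case: eqP => // h; exfalso; lia.
- move=> [/pow2_even[/negbTE -> ->] ->].
  do 2 (case: eqP => [h|_]; first by exfalso; lia).
  by congr TwoTorsionEven; lia.
- by move=> [/pow2_even[/negbTE -> ->] /negP/negbTE ->]; rewrite eqxx.
- move=> [/pow2_even[/negbTE -> ->] /negP/negbTE ->].
  case: eqP => [h|_]; first by exfalso; lia.
  by congr TwoTorsionOdd; lia.
Qed.

(** The linear form whose value, modulo [relation], is the component of a cocycle in
   the summand of l.  For the families of 2-torsion summands it is the
   coefficient at F (x) F or at R (x) R, according to the parity of the degree: a
   multiple of F (x) F is invariant up to the sign of the column exactly in
   every other degree, and likewise for R (x) R with the opposite parity.  In the
   Tor summand of a pair, the cocycles of the lowest degree are the multiples of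
   one combination of R (x) F and F (x) R, and Bezout coefficients recover the
   multiple. *)
Definition detect l c : int :=
  match l with
  | PairTensor P => c (pfst P, true) (psnd P, true)
  | PairTor P => let uv := egcdz (n (pfst P)) (n (psnd P)) in
     uv.2 * c (pfst P, false) (psnd P, true) -
     sg (d (pfst P)) * uv.1 * c (pfst P, true) (psnd P, false)
  | FreeEven0 a | FreeEven a _ | FreeOdd a _ => c (a, true) (a, true)
  | OddTorsionEven a => c (a, true) (a, true)
  | OddTorsionOdd a => c (a, false) (a, true)
  | TwoTorsionEven0 a => c (a, true) (a, true) - (n a)%:Z * c (a, false) (a, true)
  | TwoTorsionEvenLow a => c (a, false) (a, false)
  | TwoTorsionEven a i => if odd i then c (a, true) (a, true) else c (a, false) (a, false)
  | TwoTorsionOdd0 a => c (a, false) (a, true)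
  | TwoTorsionOdd a i => if odd i then c (a, true) (a, true) else c (a, false) (a, false)
  end.

Definition relation l (k : int) : Prop :=
  match l with
  | PairTensor P | PairTor P => exists a b, k = (n (pfst P))%:Z * a + (n (psnd P))%:Z * b
  | FreeEven0 _ => k = 0
  | FreeEven _ _ | FreeOdd _ _ => exists q, k = 2 * q
  | OddTorsionEven a | OddTorsionOdd a => exists q, k = (n a)%:Z * q
  | TwoTorsionEven0 a => exists q, k = 2 * (n a)%:Z * q
  | TwoTorsionEvenLow _ | TwoTorsionEven _ _ => exists q, k = 2 * q
  | TwoTorsionOdd0 a => exists q, k = (n a)%:Z * q
  | TwoTorsionOdd _ _ => exists q, k = 2 * q
  end.

Lemma zquot2 (r s : int) : exists c : {additive int -> Zquot [:: r; s]},
  (forall v, exists k, c k = v) /\ forall k, c k = 0 <-> exists a b, k = r * a + s * b.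
Proof.
exists (\pi_(Zquot [:: r; s]) : {additive int -> _}); split=> [v|k].
  by exists (repr v); apply: reprK.
split=> [/pi_eq0|[a [b ->]]]; last first.
  apply/pi_eq0; rewrite inE; exists (fun i => if i == ord0 then a else b).
  by rewrite big_ord_recl big_ord1 /= mulrC [b * _]mulrC.
rewrite inE => -[c ->]; exists (c ord0), (c (fintype.lift ord0 ord0)).
by rewrite big_ord_recl big_ord1 /= mulrC [X in _ + X]mulrC.
Qed.

Lemma label_class l : exists c : {additive int -> label_grp n l},
  (forall v, exists k, c k = v) /\ forall k, c k = 0 <-> relation l k.
Proof.
case: l => [P|P|a|a i|a i|a|a|a|a|a i|a|a i] /=; try exact: zquot1.
- by rewrite pairE; apply: zquot2.
- by rewrite pairE; apply: zquot2.
- by exists idfun; split=> // v; exists v.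
Qed.

Definition occurs_at m l := label_occurs d n l /\ label_deg d l = m.

Lemma sg_evenP i : sg i = 1 -> exists k, i = 2 * k.
Proof. by have [[? _]|[_ ->]] := sgP i. Qed.
Lemma sg_oddP i : sg i = -1 -> exists k, i = 2 * k + 1.
Proof. by have [[_ ->]|[? _]] := sgP i. Qed.
Lemma even_degP a : even_deg d a <-> exists k, d a = 2 * k.
Proof.
by rewrite /even_deg; split=> [/dvdzP[k ->]|[k ->]]; [exists k; rewrite mulrC | rewrite dvdz_mulr].
Qed.
Lemma odd_degP a : ~ even_deg d a <-> exists k, d a = 2 * k + 1.
Proof.
rewrite even_degP; have [[[k kE] _]|[[k kE] _]] := sgP (d a).
  by split=> [h|[k' k'E]]; [case: h; exists k | exfalso; lia].
by split=> [h|_ [k' k'E]]; [exists k | lia].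
Qed.

Lemma pow2_or a h : (n a)%:Z = 2 * h -> n a = 0%N \/ power_of_2 (n a).
Proof. by move=> nh; have [|[|no]] := hn a; [left | right | exfalso; lia]. Qed.

Lemma egcdz_split (r s : int) : r <> 0 -> s <> 0 -> exists g r' s',
  [/\ r = g * r', s = g * s', g <> 0 & (egcdz r s).1 * r' + (egcdz r s).2 * s' = 1].
Proof.
move=> r0 s0; case: egcdzP => u v uv _ /=.
have g0 : gcdz r s != 0 by rewrite gcdz_eq0; case: eqP => // _; case: eqP.
have [r' rE] := dvdzP (dvdz_gcdl r s); have [s' sE] := dvdzP (dvdz_gcdr r s).
exists (gcdz r s), r', s'; split; [by rewrite mulrC | by rewrite mulrC | exact/eqP |].
move: (gcdz r s) g0 uv rE sE => g g0 uv rE sE.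
by apply: (mulIf g0); rewrite mul1r -[RHS]uv rE sE; ring.
Qed.

(** Dividing by the greatest common divisor of r and s leaves coprime
   coefficients, so the solutions of the cocycle equation are the multiples of one
   of them; the value of the form is that multiple, here divisible by the greatest
   common divisor. *)
Lemma pair_torsion (r s g u v rf fr a b : int) : g * g = 1 -> (r <> 0) -> (s <> 0) ->
  (u, v) = egcdz r s -> r * rf + g * s * fr = 0 -> v * rf - g * u * fr = r * a + s * b ->
  exists t, rf = s * t /\ fr = - g * r * t.
Proof.
move=> gg r0 s0 uvE cyc tE; have [h [r' [s' [rE sE h0]]]] := egcdz_split r0 s0.
rewrite -uvE /= => uv1; exists (r' * a + s' * b).
have cyc' : r' * rf + g * s' * fr = 0.
  apply: (mulfI (x := h)); first exact/eqP.
  by rewrite mulr0 -[RHS]cyc rE sE; ring.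
have T : v * rf - g * u * fr = h * (r' * a + s' * b) by rewrite tE rE sE; ring.
split.
  transitivity (rf * (u * r' + v * s') - u * (r' * rf + g * s' * fr)); first by rewrite uv1 cyc'; ring.
  transitivity (s' * (v * rf - g * u * fr)); first by ring.
  by rewrite T sE; ring.
have sf : s' * fr = - g * r' * rf.
  transitivity (g * g * (s' * fr)); first by rewrite gg mul1r.
  transitivity (g * (r' * rf + g * s' * fr) - g * r' * rf); first by ring.
  by rewrite cyc'; ring.
transitivity (fr * (u * r' + v * s')); first by rewrite uv1 mulr1.
transitivity (u * r' * fr + v * (s' * fr)); first by ring.
transitivity (g * g * u * r' * fr + v * (s' * fr)); first by rewrite gg mul1r.
rewrite sf; transitivity (- g * r' * (v * rf - g * u * fr)); first by ring.
by rewrite T rE; ring.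
Qed.

(** The arithmetic of a block states the vanishing of a form case by case; each case
   that can arise in degree m is a label of the block. *)
Lemma block_exact m c b : admissible m c ->
  (forall e f, in_block b e f -> dcoef c (m + 1) e f = 0) ->
  (forall l, occurs_at m l -> lbase l = b -> relation l (detect l c)) ->
  exists y, admissible (m - 1) y /\ forall e f, in_block b e f -> dcoef y m e f = c e f.
Proof.
move=> cA; case: b => [a|P] cD cl; last first.
  apply: (pair_block_exact (pair_neq P)) => //.
    by move=> md; apply: (cl (PairTensor P)) => //; split=> //=; rewrite pair_deg.
  move=> md n1 n2.
  have occ : occurs_at m (PairTor P).
    split; last by rewrite /= pair_deg.
    move=> x xP; have : x \in (upair_set P : seq A) by exact: xP.
    by rewrite pairE !inE => /orP[]/eqP -> h; [apply: n1 | apply: n2]; rewrite h.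
  have [a [b]] := cl (PairTor P) occ erefl; rewrite /= => tE.
  apply: (@pair_torsion _ _ _ (egcdz (n (pfst P)) (n (psnd P))).1
    (egcdz (n (pfst P)) (n (psnd P))).2 _ _ a b (sg_sq (d (pfst P)))) => //.
    by case: (egcdz _ _).
  have := cD (pfst P, true) (psnd P, true); rewrite /= /in_pair !eqxx => /(_ isT).
  have low e f : cdeg e + cdeg f = m + 1 -> c e f = 0.
    by move=> ef; apply/eqP; apply: contraTT isT => /cA[_]; rewrite ef; lia.
  have md1 : m + 1 = d (pfst P) + d (psnd P) by rewrite md; ring.
  rewrite dcoef_pair_tt /twist (low (pfst P, true)) ?md1 //.
  rewrite (low (psnd P, true)) ?md1 //; last by rewrite /cdeg addrC.
  by rewrite subrr [sg 0]expr0z !mulr0 !mul1r !add0r.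
suff [y [yA yE]] : exists y, admissible (m - 1) y /\
    forall e f, e.1 = a -> f.1 = a -> dcoef y m e f = c e f.
  by exists y; split=> // e f /= /andP[/eqP e1 /eqP f1]; apply: yE.
apply: (single_block_exact cA).
- by move=> e f e1 f1; apply: cD; rewrite /= e1 f1 !eqxx.
- move=> md se n0; apply: (cl (FreeEven0 a)) => //; split=> //=; split=> //.
  by apply/even_degP/sg_evenP; rewrite -se md sg_even.
- move=> md se h nh; have ev : even_deg d a.
    by apply/even_degP/sg_evenP; rewrite -se md sg_even.
  have [n0|p2] := pow2_or nh.
    exists 0; rewrite n0 mul0r subr0 mulr0.
    by apply: (cl (FreeEven0 a)).
  by apply: (cl (TwoTorsionEven0 a)).
- move=> md se h nh; have ev : even_deg d a.
    by apply/even_degP/sg_evenP; rewrite -se md sg_even.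
  by apply: (cl (OddTorsionEven a)) => //; split=> //; split=> //; lia.
- move=> md se h nh.
  have [n0|p2] := pow2_or nh; have [[[k kE] s1]|[[k kE] s1]] := sgP (d a).
  + have [k' k'E] := sg_evenP (etrans se s1).
    have := cl (FreeEven a (absz (k' - 2 * k - 1)%R)); rewrite /=.
    apply=> //; split; last by rewrite /=; lia.
    by split=> //; apply/even_degP; exists k.
  + have [k' k'E] := sg_oddP (etrans se s1).
    have := cl (FreeOdd a (absz (k' - 2 * k - 1)%R)); rewrite /=.
    apply=> //; split; last by rewrite /=; lia.
    by split=> //; apply/odd_degP; exists k.
  + have [k' k'E] := sg_evenP (etrans se s1).
    have := cl (TwoTorsionEven a (absz (m - (2 * d a + 1))%R)).
    rewrite /= (_ : odd _) //; last by lia.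
    apply=> //; split; last by rewrite /=; lia.
    by split=> //; apply/even_degP; exists k.
  + have [k' k'E] := sg_oddP (etrans se s1).
    have := cl (TwoTorsionOdd a (absz (m - 2 * d a)%R)).
    rewrite /= (_ : odd _) //; last by lia.
    apply=> //; split; last by rewrite /=; lia.
    by split=> //; apply/odd_degP; exists k.
- move=> md s1 n0; have od : ~ even_deg d a by apply/odd_degP/sg_oddP.
  have [n00|[p2|no]] := hn a; first by rewrite n00 in n0.
    by apply: (cl (TwoTorsionOdd0 a)).
  by apply: (cl (OddTorsionOdd a)).
- move=> md se n0 h nh; have [n00|p2] := pow2_or nh; first by rewrite n00 in n0.
  have [[[k kE] s1]|[[k kE] s1]] := sgP (d a); rewrite s1 ?opprK in se.
  + have [k' k'E] := sg_oddP se; have ev : even_deg d a by apply/even_degP; exists k.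
    have [meq|mne] := eqVneq m (2 * d a - 1).
      by apply: (cl (TwoTorsionEvenLow a)).
    have := cl (TwoTorsionEven a (absz (m - (2 * d a + 1))%R)).
    rewrite /= (_ : odd _ = false); last by lia.
    by apply=> //; split=> //=; lia.
  + have [k' k'E] := sg_evenP se; have od : ~ even_deg d a by apply/odd_degP; exists k.
    have := cl (TwoTorsionOdd a (absz (m - 2 * d a)%R)).
    rewrite /= (_ : odd _ = false); last by lia.
    by apply=> //; split=> //=; lia.
Qed.
End Labels.

(** * Boundaries and generators *)

Section Generators.
Variables (A : choiceType) (d : A -> int) (n : A -> nat).
Local Notation cell := (cell A).
Local Notation cdeg := (cdeg d).
Local Notation dcoef := (dcoef d n).
Local Notation admissible := (admissible d n).
Local Notation occurs_at := (occurs_at d n).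
Local Notation detect := (detect d n).
Local Notation relation := (relation n).
Implicit Types (e f : cell) (c : cell -> cell -> int) (l : label A) (P : upair A).

Lemma upair_torsion P : (forall a, a \in upair_set P -> n a <> 0%N) ->
  n (pfst P) <> 0%N /\ n (psnd P) <> 0%N.
Proof.
have mem z : z \in upair_set P = (z == pfst P) || (z == psnd P).
  by rewrite -[z \in _]/(z \in (upair_set P : seq A)) pairE !inE.
by move=> h; split; apply: (h); rewrite mem eqxx ?orbT.
Qed.

Lemma even_sg a : even_deg d a -> sg (d a) = 1.
Proof. by move=> /even_degP[k ->]; rewrite sg_even. Qed.
Lemma odd_sg a : ~ even_deg d a -> sg (d a) = -1.
Proof. by move=> /odd_degP[k ->]; rewrite sg_succ sg_even. Qed.

Lemma pow2_half k : power_of_2 k -> exists h : int, k%:Z = 2 * h.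
Proof. by move=> /pow2_even[_ ev]; exists (k %/ 2)%N; lia. Qed.

Lemma sg_succ2 i (k : nat) j : i = 2 * j + k%:Z -> sg i = if odd k then -1 else 1.
Proof.
move=> ->; rewrite sgD sg_even mul1r.
by have [[[q qE] ->]|[[q qE] ->]] := sgP k; case: ifP => // ok; exfalso; lia.
Qed.

(** The signs in the differential add up to 0 or 2, which gives the factors 2.  The
   terms that would spoil divisibility by n a in the lowest degrees come from
   products in negative columns. *)
Lemma detect_boundary m y l : admissible (m - 1) y -> occurs_at m l ->
  relation l (detect l (dcoef y m)).
Proof.
move=> yA [occ md]; case: l occ md => [P|P|a|a i|a i|a|a|a|a|a i|a|a i] /=;
  rewrite ?pair_deg.
- by move=> _ /esym md; have [h _] := pair_boundary (pfst P) (psnd P) yA; apply: h.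
- move=> /upair_torsion[n1 n2] /esym md.
  have [_ /(_ md)[t [-> ->]]] := pair_boundary (pfst P) (psnd P) yA.
  exists ((egcdz (n (pfst P)) (n (psnd P))).1 * t), ((egcdz (n (pfst P)) (n (psnd P))).2 * t).
  transitivity ((egcdz (n (pfst P)) (n (psnd P))).2 * ((n (psnd P))%:Z * t) +
    sg (d (pfst P)) * sg (d (pfst P)) * (egcdz (n (pfst P)) (n (psnd P))).1 * (n (pfst P))%:Z * t).
    by ring.
  by rewrite sg_sq; ring.
- by move=> [n0 _] /esym md; have [[h _ _ _] _] := single_boundary a yA; apply: h.
- move=> [n0 /even_sg ev] /esym md; have [[_ _ _ h] _] := single_boundary a yA.
  by apply: (h _ 0); rewrite ?n0 // ev (@sg_shift _ 0 (d a + 1 + i)) //; rewrite md; ring.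
- move=> [n0 /odd_sg ev] /esym md; have [[_ _ _ h] _] := single_boundary a yA.
  by apply: (h _ 0); rewrite ?n0 // ev (@sg_shift1 _ 0 (d a + i)) //; rewrite md; ring.
- by move=> _ /esym md; have [[_ _ h _] _] := single_boundary a yA; apply: h.
- by move=> [_ /odd_sg od] /esym md; have [_ [h _]] := single_boundary a yA; apply: h.
- move=> [/pow2_half[h nh] _] /esym md; have [[_ H _ _] _] := single_boundary a yA.
  exact: H nh.
- move=> [_ /even_sg ev] /esym md; have [_ [_ h]] := single_boundary a yA.
  by apply: h; rewrite ev (@sg_shift1 _ 0 (d a - 1)) //; rewrite md; ring.
- move=> [/pow2_half[h nh] /even_sg ev] /esym md.
  have sm : sg m = if odd i then 1 else -1.
    rewrite (@sg_succ2 _ i.+1 (d a)) /=; last by rewrite md; lia.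
    by case: (odd i).
  have [[_ _ _ H] [_ H']] := single_boundary a yA.
  by case: ifP sm => _ sm; [apply: (H _ h) | apply: H'] => //; rewrite sm ev.
- by move=> [_ /odd_sg od] /esym md; have [_ [h _]] := single_boundary a yA; apply: h.
- move=> [/pow2_half[h nh] /odd_sg od] /esym md.
  have sm := sg_succ2 md.
  have [[_ _ _ H] [_ H']] := single_boundary a yA.
  by case: ifP sm => _ sm; [apply: (H _ h) | apply: H'] => //; rewrite sm od.
Qed.

Lemma detect_out l c : (forall e f, in_block (lbase l) e f -> c e f = 0) -> detect l c = 0.
Proof.
case: l => [P|P|a|a i|a i|a|a|a|a|a i|a|a i] /= c0; rewrite ?c0 //= /in_pair ?eqxx //;
  by rewrite ?(mulr0, subr0, if_same).
Qed.

Definition generates m l c :=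
  [/\ admissible m c, forall e f, dcoef c (m + 1) e f = 0, detect l c = 1 &
      forall e f, ~~ in_block (lbase l) e f -> c e f = 0].

Lemma single_cochain_out (a : A) ff fr rf rr e f : ~~ ((e.1 == a) && (f.1 == a)) ->
  single_cochain a ff fr rf rr e f = 0.
Proof. by rewrite /single_cochain => /negPf ->. Qed.

Lemma single_generates m l a ff fr rf rr : lbase l = inl a ->
  admissible m (single_cochain a ff fr rf rr) /\
    (forall e f, dcoef (single_cochain a ff fr rf rr) (m + 1) e f = 0) ->
  detect l (single_cochain a ff fr rf rr) = 1 ->
  exists c, generates m l c.
Proof.
move=> la [cA cD] c1; exists (single_cochain a ff fr rf rr); split=> // e f.
by rewrite la; apply: single_cochain_out.
Qed.

Lemma generates_FF m l a : lbase l = inl a -> sg m = sg (d a) -> 2 * d a <= m ->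
  detect l (single_cochain a 1 0 0 0) = 1 -> exists c, generates m l c.
Proof.
move=> la sm le; apply: single_generates => //; apply: single_cocycle => //; try by ring.
by rewrite sm mul1r sg_sq; ring.
Qed.

(** With n = 2 h, the product R (x) R is completed to a cocycle by h times the mixed
   products. *)
Lemma generates_RR m l a h : lbase l = inl a -> sg m = - sg (d a) -> n a <> 0%N ->
  (n a)%:Z = 2 * h -> 2 * d a - 1 <= m ->
  detect l (single_cochain a 0 (- sg m * h) (- h) 1) = 1 -> exists c, generates m l c.
Proof.
move=> la sm n0 nh le; apply: single_generates => //; have s1 := sg_sq m.
have s2 : sg m * sg (d a) = -1 by rewrite sm mulNr sg_sq.
apply: single_cocycle => //; rewrite ?nh ?s2.
- by move=> _; split=> //; lia.
- transitivity (h * (sg m * (2 * h)) * (1 + sg m * sg (d a))); first by ring.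
  by rewrite s2; ring.
- transitivity (- h * (1 + sg m * sg m) + (2 * h)); first by ring.
  by rewrite s1; ring.
- by ring.
- by ring.
Qed.

(** For d a odd, n a times the sum of R (x) F and F (x) R is the coboundary of
   R (x) R, so the sum itself is a cocycle. *)
Lemma generates_RF m l a : lbase l = inl a -> sg (d a) = -1 -> n a <> 0%N ->
  m = 2 * d a - 1 -> detect l (single_cochain a 0 1 1 0) = 1 -> exists c, generates m l c.
Proof.
move=> la s2 n0 md; apply: single_generates => //.
have s1 : sg m = -1 by rewrite (@sg_shift1 _ 0 (d a - 1)) // md; ring.
apply: single_cocycle => //; rewrite ?s1 ?s2; try by ring.
- by move=> _; split=> //; lia.
- by move=> _; split=> //; lia.
Qed.

Lemma detect_single (a : A) ff fr rf rr b1 b2 : single_cochain a ff fr rf rr (a, b1) (a, b2) =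
  (if b1 then (if b2 then ff else fr) else (if b2 then rf else rr)).
Proof. by rewrite /single_cochain /= !eqxx. Qed.

(** The cocycle is F (x) F where this is a cocycle, and otherwise one of those above;
   for a pair, it is F (x) F' symmetrized, or the generator of the cocycles in
   degree D - 1 symmetrized. *)
Lemma generator m l : occurs_at m l -> exists c, generates m l c.
Proof.
move=> [occ /esym md].
case: l occ md => [P|P|a|a i|a i|a|a|a|a|a i|a|a i] /=; rewrite ?pair_deg.
- move=> _ md; pose v (b1 b2 : bool) : int := (b1 && b2)%:R.
  have vA b1 b2 : v b1 b2 <> 0 ->
      cvalid n (pfst P, b1) && cvalid n (psnd P, b2) /\
      cdeg (pfst P, b1) + cdeg (psnd P, b2) <= m.
    by case: b1; case: b2 => //= _; split=> //; rewrite md /cdeg /=.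
  exists (pair_cochain d (pfst P) (psnd P) v v).
  have s1 : sg (m - (d (pfst P) + d (psnd P))) = 1 by rewrite md subrr.
  have [||||||||cA cD] := pair_cocycle (pair_neq P) vA vA; rewrite ?s1 /v /=; try by ring.
  split=> //; first by rewrite /= pair_cochainE.
  by move=> e f /= h; apply: pair_cochain_out.
- move=> /upair_torsion[n1 n2] md.
  have [||g [r [s [rE sE g0 uv]]]] := @egcdz_split (n (pfst P)) (n (psnd P)); [lia | lia |].
  pose v (b1 b2 : bool) : int :=
    if b1 == b2 then 0 else if b1 then - sg (d (pfst P)) * r else s.
  have vA b1 b2 : v b1 b2 <> 0 ->
      cvalid n (pfst P, b1) && cvalid n (psnd P, b2) /\
      cdeg (pfst P, b1) + cdeg (psnd P, b2) <= m.
    by case: b1; case: b2 => //= _; rewrite /cvalid md /cdeg /=; lia.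
  exists (pair_cochain d (pfst P) (psnd P) v v).
  have s1 : sg (m - (d (pfst P) + d (psnd P))) = -1 by rewrite md addrAC subrr.
  have E0 : (n (pfst P))%:Z * s + sg (d (pfst P)) * (n (psnd P))%:Z * (- sg (d (pfst P)) * r) = 0.
    rewrite rE sE; transitivity (g * r * s * (1 - sg (d (pfst P)) * sg (d (pfst P)))); first by ring.
    by rewrite sg_sq subrr mulr0.
  have [||||||||cA cD] := pair_cocycle (pair_neq P) vA vA; rewrite ?s1 /v /= ?E0; try by ring.
  split=> //; last by move=> e f /= h; apply: pair_cochain_out.
  rewrite /= !pair_cochainE /v /= -[RHS]uv.
  transitivity (sg (d (pfst P)) * sg (d (pfst P)) * (egcdz (n (pfst P)) (n (psnd P))).1 * r +
    (egcdz (n (pfst P)) (n (psnd P))).2 * s); first by ring.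
  by rewrite sg_sq; ring.
- move=> [n0 /even_sg ev] md; apply: (@generates_FF _ _ a) => //.
  + by rewrite md sg_even.
  + by rewrite md.
  + exact: detect_single.
- move=> [n0 /even_sg ev] md; apply: (@generates_FF _ _ a) => //.
  + by rewrite ev (@sg_shift _ 0 (d a + 1 + i)) // md; ring.
  + by rewrite md; lia.
  + exact: detect_single.
- move=> [n0 /odd_sg od] md; apply: (@generates_FF _ _ a) => //.
  + by rewrite od (@sg_shift1 _ 0 (d a + i)) // md; ring.
  + by rewrite md; lia.
  + exact: detect_single.
- move=> [n0 /even_sg ev] md; apply: (@generates_FF _ _ a) => //.
  + by rewrite md sg_even.
  + by rewrite md.
  + exact: detect_single.
- move=> [n0 /odd_sg od] md; apply: (@generates_RF _ _ a) => //.
  + by move=> n00; rewrite n00 in n0.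
  + exact: detect_single.
- move=> [n0 /even_sg ev] md; apply: (@generates_FF _ _ a) => //.
  + by rewrite md sg_even.
  + by rewrite md.
  + by rewrite /= !detect_single mulr0 subr0.
- move=> [/[dup] /pow2_even[/eqP n0 _] /pow2_half[h nh] /even_sg ev] md.
  apply: (@generates_RR _ _ a h) => //.
  + by rewrite ev (@sg_shift1 _ 0 (d a - 1)) // md; ring.
  + by rewrite md.
  + exact: detect_single.
- move=> [/[dup] /pow2_even[/eqP n0 _] /pow2_half[h nh] /even_sg ev] md.
  have sm : sg m = if odd i then 1 else -1.
    rewrite (@sg_succ2 _ i.+1 (d a)) /=; last by rewrite md; lia.
    by case: (odd i).
  have [oi|oi] := boolP (odd i); rewrite ?oi ?(negPf oi) in sm.
  + apply: (@generates_FF _ _ a) => //=; [by rewrite sm ev | by rewrite md; lia |].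
    by rewrite oi detect_single.
  + apply: (@generates_RR _ _ a h) => //=; [by rewrite sm ev | by rewrite md; lia |].
    by rewrite (negPf oi) detect_single.
- move=> [/pow2_even[/eqP n0 _] /odd_sg od] md; apply: (@generates_RF _ _ a) => //.
  exact: detect_single.
- move=> [/[dup] /pow2_even[/eqP n0 _] /pow2_half[h nh] /odd_sg od] md.
  have sm := sg_succ2 md.
  have [oi|oi] := boolP (odd i); rewrite ?oi ?(negPf oi) in sm.
  + apply: (@generates_FF _ _ a) => //=; [by rewrite sm od | by rewrite md; lia |].
    by rewrite oi detect_single.
  + apply: (@generates_RR _ _ a h) => //=; [by rewrite sm od | by rewrite md; lia |].
    by rewrite (negPf oi) detect_single.
Qed.

Lemma block_finite b : exists s : seq (cell * cell),
  forall e f, in_block b e f -> (e, f) \in s.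
Proof.
pose cells r : seq cell := [seq (x, t) | x <- r, t <- [:: true; false]].
have mem r (e : cell) : e.1 \in r -> e \in cells r.
  by case: e => x [] xr; apply/allpairsP; [exists (x, true) | exists (x, false)].
pose r := match b with inl a => [:: a] | inr P => [:: pfst P; psnd P] end.
exists [seq (e, f) | e <- cells r, f <- cells r] => e f ef.
apply/allpairsP; exists (e, f); split=> //; apply: mem; rewrite /r; case: b ef {r} => [a|P] /=;
  rewrite ?inE; first by case/andP.
- by rewrite /in_pair; case/orP=> /andP[-> _]; rewrite ?orbT.
- by case/andP.
- by rewrite /in_pair; case/orP=> /andP[_ ->]; rewrite ?orbT.
Qed.
End Generators.

(** * The cohomology of the square *)

Section Assembly.
Variables (A : choiceType) (d : A -> int) (n : A -> nat).
Hypothesis hn : forall a, n a = 0%N \/ power_of_2 (n a) \/ odd (n a).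
Local Notation cell := (cell A).
Local Notation cdeg := (cdeg d).
Local Notation dcoef := (dcoef d n).
Local Notation admissible := (admissible d n).
Local Notation occurs_at := (occurs_at d n).
Local Notation detect := (detect d n).
Local Notation E := (elementary d n).
Local Notation S := (std_complex (c2tensor_square E)).
Implicit Types (e f : cell) (c : cell -> cell -> int) (l : label A).

Lemma detectB l c c' : detect l (fun e f => c e f - c' e f) = detect l c - detect l c'.
Proof. by case: l => [P|P|a|a i|a i|a|a|a|a|a i|a|a i] //=; try case: ifP => // _; ring. Qed.

Lemma in_blockC b e f : in_block b e f = in_block b f e.
Proof. by case: b => [a|P] /=; [rewrite andbC | rewrite in_pairC]. Qed.

Lemma base_ofC x y : base_of x y = base_of y x :> base A.
Proof.
apply: (@base_of_uniq _ _ (y, true) (x, true)); rewrite in_blockC.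
exact: (@base_ofP _ (x, true) (y, true)).
Qed.

Section Degree.
Variable m : int.
Local Notation L := {l : label A | label_occurs d n l /\ label_deg d l = m}.

Definition lclass (l : label A) := projT1 (cid (label_class n l)).
Lemma lclass_surj l v : exists k, lclass l k = v.
Proof. exact: (projT2 (cid (label_class n l))).1. Qed.
Lemma lclass0 l k : lclass l k = 0 <-> relation n l k.
Proof. exact: (projT2 (cid (label_class n l))).2. Qed.

(** A cochain has finitely many nonzero coefficients, each of which lies in one block,
   and a block has one label in degree m. *)
Fact theta_finite (x : S m) :
  finite_set [set l : L | lclass (sval l) (detect (sval l) (fun e f => coef e f x)) <> 0].
Proof.
have [s [_ sP]] := coef_finite x.
pose lb (ef : cell * cell) := lab d n m (base_of ef.1.1 ef.2.1).
have : finite_set ((@sval _ _ : L -> label A) @^-1` (lb @` [set` s])).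
  apply: finite_preimage; last by apply: finite_image; apply: finite_seq.
  by move=> [l lP] [l' l'P] _ _ /= ll; by subst l'; rewrite (Prop_irrelevance lP l'P).
apply: sub_finite_set => -[l [occ ld]] /= nz.
apply: contrapT => out; apply: nz; rewrite detect_out ?raddf0 // => e f ef.
apply/eqP; apply: contra_notT out => /sP efs; exists (e, f) => //.
by rewrite /lb /= -(base_of_uniq ef) -ld -label_lab.
Qed.

Fact theta_additive : zmod_morphism (fun x => mk_dsum (@theta_finite x)).
Proof.
move=> x y; apply: dsumP => l; rewrite dsum_funB /= -raddfB -detectB.
by congr (lclass _ (detect _ _)); do 2 (apply: functional_extensionality_dep => ?); rewrite raddfB.
Qed.

Definition theta : {additive S m -> summands d n m} := mk_additive theta_additive.

Lemma thetaE x (l : L) :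
  dsum_fun (theta x) l = lclass (sval l) (detect (sval l) (fun e f => coef e f x)).
Proof. by []. Qed.

Lemma theta_boundary z : is_cobord (@first_quadrant (c2tensor_square E)) z -> theta z = 0.
Proof.
move=> [y qy <-]; apply: dsumP => -[l lP]; rewrite thetaE dsum_fun0; apply/lclass0.
pose c e f := coef e f y.
have -> : (fun e f => coef e f (cdiff S (subrK 1 m) y)) = dcoef c m.
  by do 2 (apply: functional_extensionality_dep => ?); rewrite coef_diff.
apply: detect_boundary lP => e f c0; split; first exact: coef_valid c0.
exact: coef_quadrant qy c0.
Qed.

(** The primitive is taken to be 0 on the blocks where the cocycle vanishes, so that
   primitives of all blocks add up to a cochain with finite support. *)
Lemma block_primitive c b : admissible m c ->
  (forall e f, dcoef c (m + 1) e f = 0) ->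
  (forall l, occurs_at m l -> relation n l (detect l c)) ->
  exists y, [/\ admissible (m - 1) y,
    forall e f, in_block b e f -> dcoef y m e f = c e f &
    forall e f, y e f != 0 -> exists e' f', in_block b e' f' /\ c e' f' != 0].
Proof.
move=> cA cD cl.
have [[e' [f' h]]|c0] := pselect (exists e' f', in_block b e' f' /\ c e' f' != 0).
  have [|l occ _|y [yA yE]] := @block_exact A d n hn m c b cA; [by [] | exact: cl |].
  by exists y; split=> // e f _; exists e', f'.
exists (fun _ _ => 0); split=> [e f|e f ef|e f]; rewrite ?eqxx //.
rewrite /(dcoef _ _ _ _) !mul0r !if_same !(mulr0, addr0); apply/esym/eqP.
by apply: contra_notT c0 => h; exists e, f.
Qed.

(** The primitives of the blocks are glued: the coefficient at e (x) f is taken from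
   the primitive of the block of e (x) f.  The differential only mixes coefficients
   of one block. *)
Lemma theta_exact z : is_cocycle (@first_quadrant (c2tensor_square E)) z -> theta z = 0 ->
  is_cobord (@first_quadrant (c2tensor_square E)) z.
Proof.
move=> [qz dz] tz; pose c e f := coef e f z.
have cA : admissible m c.
  by move=> e f c0; split; [apply: coef_valid c0 | apply: coef_quadrant qz c0].
have cD e f : dcoef c (m + 1) e f = 0.
  by rewrite -(coef_diff (erefl (m + 1))) dz raddf0.
have cl l : occurs_at m l -> relation n l (detect l c).
  move=> lP; apply/lclass0.
  by have := congr1 (fun t => dsum_fun t (exist _ l lP)) tz.
pose Y b := projT1 (cid (block_primitive b cA cD cl)).
have YP b := projT2 (cid (block_primitive b cA cD cl)).
pose y e f := Y (base_of e.1 f.1) e f.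
have yD e f : dcoef y m e f = c e f.
  have [_ YE _] := YP (base_of e.1 f.1); rewrite -(YE _ _ (base_ofP e f)).
  by rewrite /(dcoef _ _ _ _) /y /= [base_of f.1 e.1]base_ofC.
have [s [_ sP]] := coef_finite z.
pose blk b := projT1 (cid (@block_finite A b)).
have blkP b e f : in_block b e f -> (e, f) \in blk b.
  exact: (projT2 (cid (@block_finite A b))).
pose r := undup (flatten [seq blk (base_of ef.1.1 ef.2.1) | ef <- s]).
have [|e f y0|x [qx xE]] := @coef_realize A d n (m - 1) y r; first exact: undup_uniq.
  have [yA _ /(_ e f y0)[e' [f' [ef' c0]]]] := YP (base_of e.1 f.1).
  have [v le] := yA e f y0; split=> //; rewrite mem_undup; apply/flattenP.
  exists (blk (base_of e'.1 f'.1)); first by apply/mapP; exists (e', f') => //; apply: sP.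
  by rewrite -(base_of_uniq ef'); apply/blkP/base_ofP.
exists x => //; apply/eqP; rewrite -subr_eq0; apply/eqP/coef_inj => e f.
transitivity (coef e f (cdiff S (subrK 1 m) x) - coef e f z); first exact: raddfB.
rewrite coef_diff; apply/eqP; rewrite subr_eq0; apply/eqP.
rewrite -[RHS]yD; congr (dcoef _ _ _ _).
by do 2 (apply: functional_extensionality_dep => ?).
Qed.

Lemma theta_surjective v :
  exists2 z, is_cocycle (@first_quadrant (c2tensor_square E)) z & theta z = v.
Proof.
pose P (v : summands d n m) :=
  exists2 z, is_cocycle (@first_quadrant (c2tensor_square E)) z & theta z = v.
have P0 : P 0 by exists 0; rewrite ?raddf0 //; split; rewrite ?raddf0.
have PB u w : P u -> P w -> P (u - w).
  move=> [z [qz dz] <-] [z' [qz' dz'] <-]; exists (z - z'); rewrite ?raddfB //.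
  by split; [apply: first_quadrantB | rewrite raddfB dz dz' subrr].
have [s ->] := dsum_decomp v; apply: (@subgroup_sum _ P) => // -[l lP].
have [k <-] := lclass_surj (dsum_fun v (exist _ l lP)).
rewrite -[k]intz [lclass _ _]raddfMz [dsum_single _ _]raddfMz; apply: (subgroupMz P0 PB).
have [c [cA cD c1 out]] := generator lP; have [s' s'P] := block_finite (lbase l).
have [|e f c0|z [qz zE]] := @coef_realize A d n m c (undup s'); first exact: undup_uniq.
  have [v1 v2] := cA e f c0; split=> //; rewrite mem_undup; apply: s'P.
  by apply: contraNT c0 => /out ->.
have zc : (fun e f => coef e f z) = c by do 2 (apply: functional_extensionality_dep => ?).
exists z.
  by split=> //; apply: coef_inj => e f; rewrite coef_diff zc cD.
apply: dsumP => -[l' l'P]; rewrite thetaE zc -[sval _]/l'.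
have [ll|ll] := pselect (l = l').
  by subst l'; rewrite (Prop_irrelevance l'P lP) c1 dsum_singleE.
rewrite dsum_single_neq; last by move=> [].
rewrite detect_out ?raddf0 // => e f ef; apply/eqP; apply: contraT => c0.
have le : in_block (lbase l) e f by apply: contraNT c0 => /out ->.
case: ll; have [occ ld] := lP; have [occ' ld'] := l'P.
rewrite (label_lab occ) (label_lab occ') ld ld'.
by rewrite (base_of_uniq le) (base_of_uniq ef).
Qed.

Theorem elementary_square :
  computes (@first_quadrant (c2tensor_square E)) m (summands d n m).
Proof.
exists theta; split; [exact: theta_exact | exact: theta_boundary | exact: theta_surjective].
Qed.
End Degree.
End Assembly.

Theorem theorem4 (W : c2chain) (hW : c2free_resolution W)
    (C : cochain) (hCb : bounded_below C) (hCf : forall p, fg_free (C p))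
    (A : choiceType) (d : A -> int) (n : A -> nat)
    (hn : forall a, n a = 0%N \/ power_of_2 (n a) \/ odd (n a))
    (H : A -> zmodType)
    (hH : forall a, zmod_iso (H a) (Zquot [:: (n a)%:Z]))
    (hsplit : forall p, zmod_iso (cohomology C p)
      (dsum (fun a : {a : A | d a = p} => H (sval a)))) :
  forall m, zmod_iso (cohomology (Tot (hom_dcochain W (c2tensor_square C))) m)
                     (summands d n m).
Proof.
move=> m; apply: computes_iso; apply: (resolution_std hW).
apply: homotopy_equivalent_square (elementary_square d hn m).
have CS := fg_free_split hCf.
apply: (cohomology_homotopy_equivalent CS (elementary_split d n)
  (V := fun p => dsum (fun a : {a : A | d a = p} => H (sval a)))) => p.
  have [_ [s sP]] := CS p.
  by apply: computes_isoV (hsplit p) _; apply: split_computes sP.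
exact: elementary_cohomology.
Qed.
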